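(* Let $n\ge 1$, $r>1$, and let $f\in\mathcal{O}_r$, i.e. $f$ is a holomorphic function on the open complex Euclidean ball $B_c(0,r)\subset\mathbb{C}^n$. Then there is a constant $d=d(f,r)>0$ such that for every $x\in B_c(0,1)$, every real straight line $l_x\subset\mathbb{C}^n=\mathbb{R}^{2n}$ passing through $x$, every interval $I\subset l_x\cap B_c(0,1)$ and every measurable subset $\omega\subset I$ with $|\omega|>0$, $$\sup_I|f|\le\left(\frac{4|I|}{|\omega|}\right)^{d}\sup_\omega|f|.$$
   Context: $B_c(0,s)\subset\mathbb{C}^n$ denotes the open complex Euclidean ball of radius $s$ centered at $0$; $\mathcal{O}_r$ is the set of holomorphic functions on $B_c(0,r)$. For subsets of a real line, $|\cdot|$ denotes one-dimensional Lebesgue measure (length). *)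

(* Defs.v *)
From HB Require Import structures.
From mathcomp Require Import all_boot all_order all_algebra complex.
From mathcomp Require Import all_classical all_reals all_analysis.
Import Order.TTheory GRing.Theory Num.Theory.
Import numFieldNormedType.Exports.

Set Implicit Arguments.
Unset Strict Implicit.
Unset Printing Implicit Defensive.

Local Open Scope classical_set_scope.
Local Open Scope ring_scope.
Local Open Scope complex_scope.

(* numFieldNormedType only covers abstract fields; this gives the concrete
   R[i] the topology of its modulus and makes it a normed R[i]-module. *)
HB.instance Definition _ (R : rcfType) := NormedModule.copy R[i] R[i]^o.

(* The library norm `|z| on 'rV[R[i]]_n is the sup norm, with values in R[i];
   it induces the same topology as the Euclidean norm. *)
Definition enorm (R : realType) (n : nat) (z : 'rV[R[i]]_n) : R :=
  Num.sqrt (\sum_(j < n) ComplexField.Normc.normc (z 0 j) ^+ 2).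

Definition cball (R : realType) (n : nat) (c : 'rV[R[i]]_n) (s : R) :
  set 'rV[R[i]]_n := [set z | enorm (z - c) < s].

(* Here differentiability is over the field R[i]: the differential at z is
   complex linear. Only meant for open U. *)
Definition holomorphic_on (R : realType) (n : nat) (U : set 'rV[R[i]]_n)
    (f : 'rV[R[i]]_n -> R[i]) : Prop :=
  forall z, U z -> differentiable f z.

(* When enorm v = 1, line_param x v is an isometry of R onto the real line
   through x with direction v, so that the notions of interval, measurability
   and length on that line are the pullbacks of those on R. Every real line
   through x is line x v for some such v. *)
Definition line_param (R : realType) (n : nat) (x v : 'rV[R[i]]_n) (t : R) :
  'rV[R[i]]_n := x + t%:C *: v.

Definition line (R : realType) (n : nat) (x v : 'rV[R[i]]_n) :
  set 'rV[R[i]]_n := range (line_param x v).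

Definition line_interval (R : realType) (n : nat) (x v : 'rV[R[i]]_n)
    (A : set 'rV[R[i]]_n) : Prop :=
  is_interval (line_param x v @^-1` A).

(* Lebesgue, rather than Borel, measurability *)
Definition line_measurable (R : realType) (n : nat) (x v : 'rV[R[i]]_n)
    (A : set 'rV[R[i]]_n) : Prop :=
  (wlength (@idfun R))^*%mu.-cara.-measurable (line_param x v @^-1` A).

Definition line_length (R : realType) (n : nat) (x v : 'rV[R[i]]_n)
    (A : set 'rV[R[i]]_n) : \bar R :=
  completed_lebesgue_measure (line_param x v @^-1` A).

Definition sup_modulus (R : realType) (n : nat) (f : 'rV[R[i]]_n -> R[i])
    (A : set 'rV[R[i]]_n) : \bar R :=
  ereal_sup [set (ComplexField.Normc.normc (f z))%:E | z in A].

(* Main.v *)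
(* Along the line x + t v the function f has an expansion \sum_k a_k(x, v) t^k whose
   coefficients are holomorphic in (x, v). By Noetherianity the ideal generated by all
   a_k is generated by finitely many of them; Grauert division makes this quantitative:
   locally in (x, v), |a_k| rho^k <= C \sum_(j < N) |a_j| for all k, and compactness
   gives common constants for all lines meeting the unit ball. On an interval of small
   length l this forces one of the first N terms |a_j| l^j to dominate the others, so that
   the divided difference of f at j + 1 points is close to a_j. A set omega contains N
   points that are separated by a multiple of |omega|; hence |a_j| l^j, and with it f on
   the interval, is at most K (l / |omega|)^N sup_omega |f|. Repeated doubling of the
   interval reaches the diameter of the ball, and K is absorbed in a larger exponent
   because 4 |I| / |omega| >= 4. *)
Require Import Defs.
From HB Require Import structures.
From mathcomp Require Import all_boot all_order all_algebra complex.
From mathcomp Require Import all_classical all_reals all_analysis.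
From mathcomp Require Import ring lra.
Import Order.TTheory GRing.Theory Num.Theory.
Import numFieldNormedType.Exports.

Set Implicit Arguments.
Unset Strict Implicit.
Unset Printing Implicit Defensive.

Local Open Scope classical_set_scope.
Local Open Scope ring_scope.

(** The obstacle is uniformity in the line: [f] may vanish identically on some lines, and constants
    obtained by normalising the expansion on one line may blow up near such a line. Compactness
    therefore cannot be applied to lines one by one; it needs a comparison of the coefficients a_k
    with each other that is already valid for all (x, v) near a given pair, including those where
    every a_k vanishes. No ideal is formed to obtain it. Membership is replaced by the bound |c| <=
    C \sum_(j < N) |a_j| near 0, which passes to remainders of division. Finiteness comes from
    Dickson's lemma on lexicographic leading exponents, and weights t^[wdeg] with small t make each
    leading term outweigh the rest of its series. The input from complex analysis is one variable at
    a time: near a point [f] is bounded, and a bounded, separately holomorphic function of z, the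
    shift of x and the shift of v has a power series, by Cauchy's formula on squares and induction
    on the number of variables. The family passed to division is a_k rho^k, because its bounds do
    not depend on k. *)

Local Notation nm := ComplexField.Normc.normc.
Local Notation Re := complex.Re.
Local Notation Im := complex.Im.

(** * Unordered sums of complex numbers *)

Section Modulus.
Variable R : realType.
Implicit Types z w : R[i].

Lemma nm_ge0 z : 0 <= nm z.
Proof. by case: z => a b; rewrite /= sqrtr_ge0. Qed.

Lemma nm0 : nm 0 = 0 :> R.
Proof. exact: ComplexField.Normc.normc0. Qed.

Lemma nm1 : nm 1 = 1 :> R.
Proof. exact: ComplexField.Normc.normc1. Qed.

Lemma nmM z w : nm (z * w) = nm z * nm w.
Proof. exact: ComplexField.Normc.normcM. Qed.

Lemma nmV z : nm z^-1 = (nm z)^-1.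
Proof. exact: ComplexField.Normc.normcV. Qed.

Lemma nmD z w : nm (z + w) <= nm z + nm w.
Proof. exact: le_normcD. Qed.

Lemma nmN z : nm (- z) = nm z.
Proof. exact: normcN. Qed.

Lemma nmB z w : nm (z - w) <= nm z + nm w.
Proof. by rewrite -(nmN w) nmD. Qed.

Lemma nmBC z w : nm (z - w) = nm (w - z).
Proof. by rewrite -nmN opprB. Qed.

Lemma nm_eq0 z : (nm z == 0) = (z == 0).
Proof.
apply/eqP/eqP => [|->]; [exact: ComplexField.Normc.eq0_normc | exact: nm0].
Qed.

Lemma nm_gt0 z : (0 < nm z) = (z != 0).
Proof. by rewrite lt_def nm_ge0 andbT nm_eq0. Qed.

Lemma nmX z k : nm (z ^+ k) = nm z ^+ k.
Proof. by elim: k => [|k IH]; rewrite ?expr0 ?nm1// !exprS nmM IH. Qed.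

Lemma nm_real (x : R) : nm x%:C%C = `|x|.
Proof. by rewrite /= expr0n/= addr0 sqrtr_sqr. Qed.

Lemma ler_dist_nm z w : nm z - nm w <= nm (z - w).
Proof. by rewrite lerBlDr -{1}(subrK w z) nmD. Qed.

Lemma nm_sum (I : Type) (s : seq I) (P : pred I) (F : I -> R[i]) :
  nm (\sum_(i <- s | P i) F i) <= \sum_(i <- s | P i) nm (F i).
Proof.
elim/big_ind2 : _ => [|x y x' y' h h'|//]; first by rewrite nm0.
by apply: (le_trans (nmD _ _)); apply: lerD.
Qed.

Lemma Re_le_nm z : `|Re z| <= nm z.
Proof.
case: z => a b /=; rewrite -(sqrtr_sqr a).
by rewrite ler_wsqrtr// lerDl sqr_ge0.
Qed.

Lemma Im_le_nm z : `|Im z| <= nm z.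
Proof.
case: z => a b /=; rewrite -(sqrtr_sqr b).
by rewrite ler_wsqrtr// lerDr sqr_ge0.
Qed.

Lemma nm_le_ReIm z : nm z <= `|Re z| + `|Im z|.
Proof.
case: z => a b /=; rewrite -(ler_pXn2r (_ : 0 < 2)%N)//; last 2 first.
- by rewrite nnegrE sqrtr_ge0.
- by rewrite nnegrE addr_ge0.
rewrite sqr_sqrtr ?addr_ge0 ?sqr_ge0// sqrrD !real_normK ?num_real//.
by rewrite lerD2r lerDl mulrn_wge0// mulr_ge0.
Qed.

End Modulus.

Section FiniteSubsums.
Variables (R : realType) (T : choiceType).
Implicit Types (s t : seq T) (F : T -> R).

Lemma ler_sum_subseq s t F : (forall x, 0 <= F x) -> uniq s ->
  {subset s <= t} -> \sum_(x <- s) F x <= \sum_(x <- t) F x.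
Proof.
move=> F0; elim: s t => [|x s IH] t; first by rewrite big_nil sumr_ge0.
rewrite /= => /andP[xs us] st; rewrite big_cons.
have xt : x \in t by apply: st; rewrite inE eqxx.
rewrite (perm_big _ (perm_to_rem xt)) big_cons lerD2l; apply: IH => // y ys.
have : y \in t by apply: st; rewrite inE ys orbT.
rewrite (perm_mem (perm_to_rem xt)) inE => /orP[/eqP yx|//].
by rewrite -yx ys in xs.
Qed.

End FiniteSubsums.

Section UnorderedSums.
Variables (R : realType) (T : choiceType).
Implicit Types (u v : T -> R[i]) (l : R[i]) (s t : seq T).

Definition asum_le u (B : R) :=
  forall s, uniq s -> \sum_(x <- s) nm (u x) <= B.

(** Convergence along the finite subsets of [T] ordered by inclusion, with duplicate-free lists as
    finite sets. No enumeration of [T] is fixed, so sums over multi-indices can be regrouped and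
    exchanged freely. *)
Definition is_csum u l := forall e : R, 0 < e -> exists2 s0, uniq s0 &
  forall s, uniq s -> {subset s0 <= s} -> nm (\sum_(x <- s) u x - l) <= e.

Definition csum u : R[i] := xget 0 [set l | is_csum u l].

Lemma asum_le_ge0 u B : asum_le u B -> 0 <= B.
Proof. by move=> /(_ [::] isT); rewrite big_nil. Qed.

Lemma asum_le_pt u B x : asum_le u B -> nm (u x) <= B.
Proof. by move=> /(_ [:: x] isT); rewrite big_seq1. Qed.

Lemma asum_le_dom u v B : (forall x, nm (u x) <= nm (v x)) -> asum_le v B ->
  asum_le u B.
Proof. by move=> uv vB s us; apply: le_trans (vB s us); apply: ler_sum. Qed.

Lemma asum_leW u B B' : B <= B' -> asum_le u B -> asum_le u B'.
Proof. by move=> BB' h s us; apply: le_trans BB'; apply: h. Qed.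

Lemma asum_leD u v B B' : asum_le u B -> asum_le v B' ->
  asum_le (fun x => u x + v x) (B + B').
Proof.
move=> hu hv s us; apply: (@le_trans _ _ (\sum_(x <- s) (nm (u x) + nm (v x)))).
  by apply: ler_sum => x _; exact: nmD.
by rewrite big_split lerD ?hu ?hv.
Qed.

Lemma asum_leZ u B a : asum_le u B -> asum_le (fun x => a * u x) (nm a * B).
Proof.
move=> hu s us; under eq_bigr do rewrite nmM.
by rewrite -mulr_sumr ler_wpM2l ?nm_ge0 ?hu.
Qed.

Lemma asum_le0 : asum_le (fun=> 0) 0.
Proof. by move=> s _; rewrite big1// => x _; rewrite nm0. Qed.

Lemma asum_le_sum (I : eqType) (r : seq I) (u : I -> T -> R[i]) (B : I -> R) :
  (forall i, i \in r -> asum_le (u i) (B i)) ->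
  asum_le (fun x => \sum_(i <- r) u i x) (\sum_(i <- r) B i).
Proof.
elim: r => [|i r IH] h.
  rewrite big_nil; apply: asum_le_dom asum_le0 => x.
  by rewrite big_nil.
rewrite big_cons; apply: asum_le_dom (asum_leD (h i _) (IH _)) => [x||j jr].
- by rewrite big_cons.
- by rewrite inE eqxx.
- by apply: h; rewrite inE jr orbT.
Qed.

Lemma is_csum_unique u l l' : is_csum u l -> is_csum u l' -> l = l'.
Proof.
move=> h h'; apply/eqP; rewrite -subr_eq0 -nm_eq0 eq_le nm_ge0 andbT.
apply/ler_addgt0Pl => e e0; rewrite addr0.
have [s us hs] := h (e / 2) ltac:(lra); have [t ut ht] := h' (e / 2) ltac:(lra).
pose r := undup (s ++ t).
have {}hs : nm (\sum_(x <- r) u x - l) <= e / 2.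
  by apply: hs; rewrite ?undup_uniq// => x xs; rewrite mem_undup mem_cat xs.
have {}ht : nm (\sum_(x <- r) u x - l') <= e / 2.
  by apply: ht; rewrite ?undup_uniq// => x xs; rewrite mem_undup mem_cat xs orbT.
rewrite (_ : l - l' = (\sum_(x <- r) u x - l') - (\sum_(x <- r) u x - l)).
  by apply: (le_trans (nmB _ _)); lra.
ring.
Qed.

Lemma is_csumD u v l l' : is_csum u l -> is_csum v l' ->
  is_csum (fun x => u x + v x) (l + l').
Proof.
move=> h h' e e0.
have [s us hs] := h (e / 2) ltac:(lra); have [t ut ht] := h' (e / 2) ltac:(lra).
exists (undup (s ++ t)) => [|r ur str]; first exact: undup_uniq.
rewrite big_split/= opprD addrACA; apply: (le_trans (nmD _ _)).
have := hs r ur; have := ht r ur; move=> h1 h2.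
have {}h1 : nm (\sum_(x <- r) v x - l') <= e / 2.
  by apply: h1 => x xs; apply: str; rewrite mem_undup mem_cat xs orbT.
have {}h2 : nm (\sum_(x <- r) u x - l) <= e / 2.
  by apply: h2 => x xs; apply: str; rewrite mem_undup mem_cat xs.
lra.
Qed.

Lemma is_csumZ u l a : is_csum u l -> is_csum (fun x => a * u x) (a * l).
Proof.
move=> h e e0; have a0 := nm_ge0 a.
have [s us hs] := h (e / (nm a + 1)) ltac:(by rewrite divr_gt0; lra).
exists s => // r ur sr; rewrite -mulr_sumr -mulrBr nmM.
have := hs r ur sr; rewrite ler_pdivlMr; last lra.
move: (nm_ge0 (\sum_(x <- r) u x - l)); nra.
Qed.

Lemma is_csumN u l : is_csum u l -> is_csum (fun x => - u x) (- l).
Proof.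
move=> /(is_csumZ (-1)); rewrite mulN1r.
by under [X in is_csum X]eq_fun do rewrite mulN1r.
Qed.

Lemma is_csumB u v l l' : is_csum u l -> is_csum v l' ->
  is_csum (fun x => u x - v x) (l - l').
Proof. by move=> h /is_csumN; exact: is_csumD. Qed.

Lemma is_csum0 : is_csum (fun=> 0) 0.
Proof. by move=> e e0; exists [::] => // s _ _; rewrite big1// subr0 nm0 ltW. Qed.

Lemma is_csum_sum (I : eqType) (r : seq I) (u : I -> T -> R[i]) (l : I -> R[i]) :
  (forall i, i \in r -> is_csum (u i) (l i)) ->
  is_csum (fun x => \sum_(i <- r) u i x) (\sum_(i <- r) l i).
Proof.
elim: r => [|i r IH] h.
  by rewrite big_nil; under [X in is_csum X]eq_fun do rewrite big_nil; exact: is_csum0.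
rewrite big_cons; under [X in is_csum X]eq_fun do rewrite big_cons.
apply: is_csumD; first by apply: h; rewrite inE eqxx.
by apply: IH => j jr; apply: h; rewrite inE jr orbT.
Qed.

Lemma is_csum_fin u s : uniq s -> (forall x, x \notin s -> u x = 0) ->
  is_csum u (\sum_(x <- s) u x).
Proof.
move=> us h e e0; exists s => // r ur sr.
suff -> : \sum_(x <- r) u x = \sum_(x <- s) u x by rewrite subrr nm0 ltW.
rewrite (bigID (mem s))/= [X in _ + X]big1 ?addr0 => [|x]; last exact: h.
rewrite -big_filter; apply: perm_big; apply: uniq_perm => //.
  exact: filter_uniq.
move=> x; rewrite mem_filter andbC; have [xs|//] := boolP (x \in s).
  by rewrite sr.
by rewrite andbF.
Qed.

Lemma is_csum_le u l B : asum_le u B -> is_csum u l -> nm l <= B.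
Proof.
move=> uB h; apply/ler_addgt0Pr => e e0.
have [s us /(_ s us) hs] := h e e0; have {}hs := hs (fun x => id).
apply: (@le_trans _ _ (nm (\sum_(x <- s) u x) + nm (\sum_(x <- s) u x - l))).
  rewrite -[X in nm X <= _](subKr (\sum_(x <- s) u x)); exact: nmB.
by apply: lerD => //; apply: (le_trans (nm_sum _ _ _)); exact: uB.
Qed.

(** A finite set whose sum is within [e] of the supremum of all finite sums leaves at most [e] for
    any set disjoint from it. *)
Lemma asum_tail u B : asum_le u B -> forall e : R, 0 < e ->
  exists2 s0, uniq s0 &
  forall s, uniq s -> {in s, forall x, x \notin s0} ->
    \sum_(x <- s) nm (u x) <= e.
Proof.
move=> uB e e0.
pose A := [set a : R | exists2 s, uniq s & a = \sum_(x <- s) nm (u x)].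
have hA : has_sup A.
  split; first by exists 0, [::]; rewrite ?big_nil.
  by exists B => _ [s us ->]; exact: uB.
have [_ [s0 us0 ->] hs0] := sup_adherent e0 hA.
exists s0 => // s us ss0.
have : \sum_(x <- s0 ++ s) nm (u x) <= sup A.
  apply: ub_le_sup; first by case: hA.
  exists (s0 ++ s) => //; rewrite cat_uniq us0 us andbT/=.
  by apply/hasPn => x /ss0.
by rewrite big_cat/=; lra.
Qed.

Let is_csum_nneg_ex (a : T -> R) B : (forall x, 0 <= a x) ->
  (forall s, uniq s -> \sum_(x <- s) a x <= B) ->
  exists l, is_csum (fun x => (a x)%:C%C) l.
Proof.
move=> a0 aB.
pose A := [set b : R | exists2 s, uniq s & b = \sum_(x <- s) a x].
have hA : has_sup A.
  split; first by exists 0, [::]; rewrite ?big_nil.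
  by exists B => _ [s us ->]; exact: aB.
exists ((sup A)%:C)%C => e e0; have [_ [s0 us0 ->] hs0] := sup_adherent e0 hA.
exists s0 => // s us s0s.
rewrite -(rmorph_sum (real_complex R)) -(rmorphB (real_complex R)) nm_real.
have h1 : \sum_(x <- s) a x <= sup A.
  by apply: ub_le_sup; [case: hA | exists s].
have h2 : \sum_(x <- s0) a x <= \sum_(x <- s) a x by exact: ler_sum_subseq.
by rewrite ler0_norm; lra.
Qed.

(** Finite sums of a nonnegative family increase to their supremum. The general case follows because
    Re u and Im u are differences of the nonnegative families |u| + Re u, |u| + Im u and |u|. *)
Lemma is_csum_ex u B : asum_le u B -> exists l, is_csum u l.
Proof.
move=> uB.
have hRe x : 0 <= nm (u x) + Re (u x).
  by have := Re_le_nm (u x); rewrite ler_norml; lra.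
have hIm x : 0 <= nm (u x) + Im (u x).
  by have := Im_le_nm (u x); rewrite ler_norml; lra.
have [l0 h0] : exists l, is_csum (fun x => (nm (u x))%:C%C) l.
  by apply: is_csum_nneg_ex uB => x; exact: nm_ge0.
have [l1 h1] : exists l, is_csum (fun x => (nm (u x) + Re (u x))%:C%C) l.
  apply: (@is_csum_nneg_ex _ (B + B)) => // s us; rewrite big_split lerD ?uB//.
  apply: le_trans (uB s us); apply: ler_sum => x _.
  by have := Re_le_nm (u x); rewrite ler_norml; lra.
have [l2 h2] : exists l, is_csum (fun x => (nm (u x) + Im (u x))%:C%C) l.
  apply: (@is_csum_nneg_ex _ (B + B)) => // s us; rewrite big_split lerD ?uB//.
  apply: le_trans (uB s us); apply: ler_sum => x _.
  by have := Im_le_nm (u x); rewrite ler_norml; lra.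
exists ((l1 - l0) + 'i%C * (l2 - l0)).
rewrite (_ : u = fun x => ((nm (u x) + Re (u x))%:C - (nm (u x))%:C)%C +
   'i%C * ((nm (u x) + Im (u x))%:C - (nm (u x))%:C)%C); last first.
  apply/funext => x; rewrite [LHS]complexE -!(rmorphB (real_complex R)).
  by congr (_%:C%C + _ * _%:C%C); ring.
by apply: is_csumD; [|apply: is_csumZ]; apply: is_csumB.
Qed.

Lemma csumE u l : is_csum u l -> csum u = l.
Proof.
by move=> h; rewrite /csum; case: xgetP => [y _ hy|/(_ l)//]; exact: is_csum_unique hy h.
Qed.

Lemma csumP u B : asum_le u B -> is_csum u (csum u).
Proof. by move=> /is_csum_ex[l hl]; rewrite (csumE hl). Qed.

Lemma csum_le u B : asum_le u B -> nm (csum u) <= B.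
Proof. by move=> h; apply: is_csum_le h (csumP h). Qed.

End UnorderedSums.

(** * Reindexing sums along injections *)

Section Reindex.
Variables (R : realType) (T T' : choiceType).

(** Preimages of finite sets under an injection are finite; this turns finite sums over [T'] into
    finite sums over [T] when the family vanishes off the image. *)
Lemma pullback_seq (h : T -> T') : injective h ->
  exists g : seq T' -> seq T, forall s, uniq s -> uniq (g s) /\
    (forall x, x \in g s = (h x \in s)).
Proof.
move=> hi; pose g y := if pselect (exists x, h x = y) is left e
  then Some (sval (cid e)) else None.
have gh x : g (h x) = Some x.
  rewrite /g; case: pselect => [e|[]]; last by exists x.
  by congr Some; apply: hi; case: cid.
have hg : ocancel g h by move=> y; rewrite /g; case: pselect => //= e; case: cid.
exists (pmap g) => s us; split; first exact: (pmap_uniq hg).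
move=> x; rewrite mem_pmap; apply/mapP/idP => [[y ys]|hxs].
  by move=> e; move: (hg y); rewrite -e /= => ->.
by exists (h x).
Qed.

Variables (h : T -> T') (u : T' -> R[i]).
Hypotheses (hi : injective h) (hu : forall y, u y != 0 -> exists x, y = h x).

Let sum_pullback (V : nmodType) (F : R[i] -> V) s r : F 0 = 0 -> uniq s -> uniq r ->
  (forall x, (x \in r) = (h x \in s)) ->
  \sum_(y <- s) F (u y) = \sum_(x <- r) F (u (h x)).
Proof.
move=> F0 us ur rs; rewrite (bigID (mem (map h r)))/= [X in _ + X]big1_seq.
  rewrite addr0 -[RHS](big_map h xpredT (F \o u))/= -big_filter.
  apply: perm_big; apply: uniq_perm; rewrite ?filter_uniq ?map_inj_uniq//.
  move=> y; rewrite mem_filter; apply/idP/idP => [/andP[]//|yr].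
  by rewrite yr/=; case/mapP: yr => x xr ->; rewrite -rs.
move=> y /andP[yr ys]; have [->//|/hu[x yx]] := eqVneq (u y) 0.
by case/negP: yr; rewrite yx mem_map// rs -yx.
Qed.

Lemma asum_le_reindex B : asum_le (u \o h) B -> asum_le u B.
Proof.
have [g hg] := pullback_seq hi; move=> uB s us; have [ug gs] := hg s us.
by rewrite (@sum_pullback _ (fun z => nm z : R) _ (g s)) ?nm0//; exact: uB.
Qed.

Lemma is_csum_reindex l : is_csum (u \o h) l -> is_csum u l.
Proof.
have [g hg] := pullback_seq hi; move=> hl e e0.
have [s0 us0 hs0] := hl e e0; exists (map h s0) => [|s us ss].
  by rewrite map_inj_uniq.
have [ug gs] := hg s us; rewrite (@sum_pullback _ id _ (g s))//.
by apply: hs0 => // x xs; rewrite gs; apply: ss; rewrite mem_map.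
Qed.

End Reindex.

Lemma asum_le_comp (R : realType) (T T' : choiceType) (h : T -> T')
    (u : T' -> R[i]) B : injective h -> asum_le u B -> asum_le (u \o h) B.
Proof.
move=> hi uB s us; rewrite -(big_map h xpredT (fun y => nm (u y))) uB//.
by rewrite map_inj_uniq.
Qed.

Lemma sum_frac_size_le (R : realType) (T : Type) (s : seq T) (e : R) :
  0 <= e -> \sum_(x <- s) (e / (size s).+1%:R) <= e.
Proof.
move=> e0; rewrite big_const_seq count_predT iter_addr_0 -[leLHS]mulr_natr.
by rewrite -mulrA ler_piMr// mulrC ler_pdivrMr// mul1r ler_nat.
Qed.

(** * Double and iterated sums *)

Section Fubini.
Variables (R : realType) (T T' : choiceType).
Implicit Types (u : T * T' -> R[i]).

(** For a finite set of outer indices, each inner sum is replaced by a finite one with error [e / 2]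
    divided among the indices. The inner sets are taken large enough for the resulting set of pairs
    to contain [s0]. *)
Lemma is_csum_iter u l v : is_csum u l ->
  (forall x, is_csum (fun y => u (x, y)) (v x)) -> is_csum v l.
Proof.
move=> hu hv e e0; have [s0 us0 hs0] := hu (e / 2) ltac:(lra).
exists (undup (unzip1 s0)) => [|s us ss]; first exact: undup_uniq.
pose d : R := e / 2 / (size s).+1%:R.
have d0 : 0 < d by rewrite divr_gt0//; lra.
have /choice[t ht] : forall x, exists t, [/\ uniq t,
    (forall y, (x, y) \in s0 -> y \in t) &
    nm (\sum_(y <- t) u (x, y) - v x) <= d].
  move=> x; have [t ut /= ht] := hv x d d0.
  exists (undup (t ++ unzip2 s0)); split; first exact: undup_uniq.
    move=> y ys; rewrite mem_undup mem_cat; apply/orP; right.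
    by apply/mapP; exists (x, y).
  apply: ht => [|y yt]; first exact: undup_uniq.
  by rewrite mem_undup mem_cat yt.
pose P := [seq (x, y) | x <- s, y <- t x].
have uP : uniq P.
  apply: allpairs_uniq_dep => // [x _|]; first by case: (ht x).
  by move=> [x y] [x' y'] /= _ _ [-> ->].
have sP : {subset s0 <= P}.
  move=> [x y] xy; apply/allpairsPdep; exists x, y; split=> //.
    by apply: ss; rewrite mem_undup; apply/mapP; exists (x, y).
  by case: (ht x) => _ h _; exact: h.
have h1 := hs0 P uP sP.
have h2 : nm (\sum_(x <- s) v x - \sum_(p <- P) u p) <= e / 2.
  rewrite big_allpairs_dep/= -sumrB; apply: (le_trans (nm_sum _ _ _)).
  apply: (@le_trans _ _ (\sum_(x <- s) d)).
    by apply: ler_sum => x _; rewrite nmBC; case: (ht x).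
  by apply: sum_frac_size_le; lra.
rewrite (_ : _ - l = (\sum_(x <- s) v x - \sum_(p <- P) u p) +
  (\sum_(p <- P) u p - l)); last by rewrite addrA subrK.
by apply: (le_trans (nmD _ _)); lra.
Qed.

Lemma asum_le_slice u B x : asum_le u B -> asum_le (fun y => u (x, y)) B.
Proof.
by move=> uB; apply: (@asum_le_comp _ _ _ (pair x) u) => // y y' [].
Qed.

Lemma asum_le_iter u B : asum_le u B -> asum_le (fun x => csum (fun y => u (x, y))) B.
Proof.
move=> uB s us; apply/ler_addgt0Pr => e e0.
pose d : R := e / (size s).+1%:R.
have d0 : 0 < d by rewrite divr_gt0.
have /choice[t ht] : forall x, exists t, uniq t /\
    nm (csum (fun y => u (x, y))) <= \sum_(y <- t) nm (u (x, y)) + d.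
  move=> x; have [t ut /= ht] := csumP (asum_le_slice x uB) d0.
  exists t; split=> //; have {}ht := ht t ut (fun=> id).
  rewrite -[X in nm X <= _](subKr (\sum_(y <- t) u (x, y))).
  by apply: (le_trans (nmB _ _)); rewrite lerD// nm_sum.
pose P := [seq (x, y) | x <- s, y <- t x].
have uP : uniq P.
  apply: allpairs_uniq_dep => // [x _|]; first by case: (ht x).
  by move=> [x y] [x' y'] /= _ _ [-> ->].
apply: le_trans (_ : \sum_(p <- P) nm (u p) + e <= _); last first.
  by rewrite lerD2r uB.
rewrite big_allpairs_dep/=.
apply: (@le_trans _ _ (\sum_(x <- s) (\sum_(y <- t x) nm (u (x, y)) + d))).
  by apply: ler_sum => x _; case: (ht x).
by rewrite big_split lerD2l/= sum_frac_size_le// ltW.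
Qed.

Lemma csum_iter u B : asum_le u B -> is_csum (fun x => csum (fun y => u (x, y))) (csum u).
Proof.
move=> uB; apply: (is_csum_iter (csumP uB)) => x.
exact: csumP (asum_le_slice x uB).
Qed.

Lemma asum_le_swap u B : asum_le u B -> asum_le (fun p => u (p.2, p.1)) B.
Proof.
move=> uB; apply: (@asum_le_comp _ _ _ (fun p => (p.2, p.1)) u) => //.
by move=> [a b] [c d] [-> ->].
Qed.

Lemma asum_le_mul (a : T -> R[i]) (b : T' -> R[i]) A B :
  asum_le a A -> asum_le b B -> asum_le (fun p => a p.1 * b p.2) (A * B).
Proof.
move=> hA hB s us.
pose P := [seq (x, y) | x <- undup (unzip1 s), y <- undup (unzip2 s)].
apply: le_trans (_ : \sum_(p <- P) nm (a p.1 * b p.2) <= _).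
  apply: ler_sum_subseq => // [p|[x y] xys]; first exact: nm_ge0.
  apply/allpairsP; exists (x, y); rewrite !mem_undup; split=> //.
    by apply/mapP; exists (x, y).
  by apply/mapP; exists (x, y).
rewrite big_allpairs_dep/=; under eq_bigr do (under eq_bigr do rewrite nmM).
under eq_bigr do rewrite -mulr_sumr; rewrite -mulr_suml.
apply: ler_pM; rewrite ?sumr_ge0 ?hA ?hB ?undup_uniq// => *; exact: nm_ge0.
Qed.

Lemma asum_le_pair u (b : T -> R) B :
  (forall x, asum_le (fun y => u (x, y)) (b x)) ->
  (forall s, uniq s -> \sum_(x <- s) b x <= B) -> asum_le u B.
Proof.
move=> ub bB s us.
pose P := [seq (x, y) | x <- undup (unzip1 s), y <- undup (unzip2 s)].
apply: le_trans (_ : \sum_(p <- P) nm (u p) <= _).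
  apply: ler_sum_subseq => // [p|[x y] xys]; first exact: nm_ge0.
  apply/allpairsP; exists (x, y); rewrite !mem_undup; split=> //.
    by apply/mapP; exists (x, y).
  by apply/mapP; exists (x, y).
rewrite big_allpairs_dep/=; apply: le_trans (bB _ (undup_uniq (unzip1 s))).
by apply: ler_sum => x _; apply: ub; exact: undup_uniq.
Qed.

End Fubini.

Lemma csum_swap (R : realType) (T T' : choiceType) (u : T * T' -> R[i]) B :
  asum_le u B ->
  csum (fun x => csum (fun y => u (x, y))) =
  csum (fun y => csum (fun x => u (x, y))).
Proof.
move=> uB; have h1 := csum_iter uB; have h2 := csum_iter (asum_le_swap uB).
rewrite (csumE h1) (csumE h2); symmetry; apply: csumE.
apply: (@is_csum_reindex _ _ _ (fun p => (p.2, p.1))).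
- by move=> [a b] [c d] [-> ->].
- by move=> [a b] _; exists (b, a).
- have := csumP uB; congr is_csum; apply/funext => -[a b] //.
Qed.

Lemma sum_geom_le (R : realType) (x B : R) (s : seq nat) :
  0 <= x -> x < 1 -> 0 <= B -> uniq s -> \sum_(k <- s) (B * x ^+ k) <= B / (1 - x).
Proof.
move=> x0 x1 B0 us; rewrite -mulr_sumr ler_wpM2l//.
apply: le_trans (_ : \sum_(k <- index_iota 0 (\max_(k <- s) k).+1) x ^+ k <= _).
  apply: ler_sum_subseq => // [k|k ks]; first exact: exprn_ge0.
  by rewrite mem_index_iota ltnS; exact: (@leq_bigmax_seq _ _ xpredT id k ks isT).
rewrite big_mkord.
rewrite -[leRHS]mul1r ler_pdivlMr ?subr_gt0// mulrC -opprB mulNr -subrX1.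
by rewrite opprB gerBl exprn_ge0.
Qed.

Lemma asum_le_geom (R : realType) (a : nat -> R[i]) (x B : R) :
  0 <= x -> x < 1 -> (forall k, nm (a k) <= B * x ^+ k) ->
  asum_le a (B / (1 - x)).
Proof.
move=> x0 x1 ab s us.
have B0 : 0 <= B by have := ab 0%N; rewrite expr0 mulr1; apply: le_trans; exact: nm_ge0.
by apply: le_trans (sum_geom_le x0 x1 B0 us); apply: ler_sum.
Qed.

(** * Cauchy's theorem on rectangles *)

Section SegmentIntegral.
Variable R : realType.
Implicit Types (a b c t : R) (phi psi : R -> R[i]).

Definition rcont phi t := forall e : R, 0 < e -> exists2 d : R, 0 < d &
  forall s, `|s - t| < d -> nm (phi s - phi t) <= e.

Definition rcont_on a b phi := forall t, a <= t -> t <= b -> rcont phi t.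

Definition segint a b phi : R[i] :=
  Complex (\int[lebesgue_measure]_(t in `[a, b]) Re (phi t))
          (\int[lebesgue_measure]_(t in `[a, b]) Im (phi t)).

Lemma rcont_cst (z : R[i]) t : rcont (fun=> z) t.
Proof. by move=> e e0; exists 1 => // s _; rewrite subrr nm0 ltW. Qed.

Lemma rcontD phi psi t : rcont phi t -> rcont psi t -> rcont (fun s => phi s + psi s) t.
Proof.
move=> h h' e e0; have [d d0 hd] := h (e / 2) ltac:(lra).
have [d' d'0 hd'] := h' (e / 2) ltac:(lra).
exists (Num.min d d') => [|s]; first by rewrite lt_min d0.
rewrite lt_min => /andP[/hd h1 /hd' h2]; rewrite opprD addrACA.
by apply: (le_trans (nmD _ _)); lra.
Qed.

Lemma rcontM phi psi t : rcont phi t -> rcont psi t -> rcont (fun s => phi s * psi s) t.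
Proof.
move=> h h' e e0.
pose A := nm (phi t) + 1; pose B := nm (psi t) + 1.
have A0 : 0 < A by have := nm_ge0 (phi t); rewrite /A; lra.
have B0 : 0 < B by have := nm_ge0 (psi t); rewrite /B; lra.
have [d d0 hd] := h (Num.min 1 (e / 2 / B)) ltac:(by rewrite lt_min ltr01 !divr_gt0).
have [d' d'0 hd'] := h' (e / 2 / A) ltac:(by rewrite !divr_gt0).
exists (Num.min d d') => [|s]; first by rewrite lt_min d0.
rewrite lt_min => /andP[/hd]; rewrite le_min => /andP[h1 h2] /hd' h3.
rewrite (_ : _ - _ = phi s * (psi s - psi t) + (phi s - phi t) * psi t); last by ring.
apply: (le_trans (nmD _ _)); rewrite !nmM.
have ps : nm (phi s) <= A.
  by rewrite /A -[phi s](subrK (phi t)); have := nmD (phi s - phi t) (phi t); lra.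
have pt : nm (psi t) <= B by rewrite /B; lra.
rewrite ler_pdivlMr// in h2; rewrite ler_pdivlMr// in h3.
have := nm_ge0 (phi s - phi t); have := nm_ge0 (psi s - psi t).
have := nm_ge0 (phi s); have := nm_ge0 (psi t); nra.
Qed.

Lemma rcontZ (z : R[i]) phi t : rcont phi t -> rcont (fun s => z * phi s) t.
Proof. exact/rcontM/rcont_cst. Qed.

Lemma rcontN phi t : rcont phi t -> rcont (fun s => - phi s) t.
Proof.
by move=> h; under eq_fun do rewrite -mulN1r; exact: rcontZ.
Qed.

Lemma rcontB phi psi t : rcont phi t -> rcont psi t -> rcont (fun s => phi s - psi s) t.
Proof. by move=> h /rcontN; exact: rcontD. Qed.

Let integrable_of_rcont (P : R[i] -> R) a b phi :
  (forall z w, `|P z - P w| <= nm (z - w)) -> rcont_on a b phi ->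
  lebesgue_measure.-integrable `[a, b] (EFin \o (P \o phi)).
Proof.
move=> hP h; apply: continuous_compact_integrable; first exact: segment_compact.
apply: continuous_in_subspaceT => t; rewrite inE/= in_itv/= => /andP[at_ tb].
apply/cvgrPdist_le => e e0; have [d d0 hd] := h t at_ tb e e0.
near=> s; rewrite distrC; apply: le_trans (hP _ _) _; apply: hd.
rewrite distrC; near: s; exact: cvgr_dist_lt.
Unshelve. all: by end_near. Qed.

Lemma integrable_Re a b phi : rcont_on a b phi ->
  lebesgue_measure.-integrable `[a, b] (EFin \o (fun t => Re (phi t))).
Proof.
apply: (@integrable_of_rcont (fun z : R[i] => Re z)) => -[x y] [x' y'].
exact: (Re_le_nm (Complex x y - Complex x' y')).
Qed.

Lemma integrable_Im a b phi : rcont_on a b phi ->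
  lebesgue_measure.-integrable `[a, b] (EFin \o (fun t => Im (phi t))).
Proof.
apply: (@integrable_of_rcont (fun z : R[i] => Im z)) => -[x y] [x' y'].
exact: (Im_le_nm (Complex x y - Complex x' y')).
Qed.

Lemma fine_length_itv a b : a <= b ->
  fine (lebesgue_measure (`[a, b]%classic : set R)) = b - a.
Proof.
move=> ab; rewrite lebesgue_measure_itv/= lte_fin.
by case: ltgtP ab => //= -> _; rewrite subrr.
Qed.

Lemma eq_segint a b phi psi : (forall t, a <= t -> t <= b -> phi t = psi t) ->
  segint a b phi = segint a b psi.
Proof.
move=> h; rewrite /segint; congr Complex; apply: eq_Rintegral => t;
  by rewrite inE/= in_itv/= => /andP[at_ tb]; rewrite h.
Qed.

Lemma segint_cst a b (z : R[i]) : a <= b -> segint a b (fun=> z) = (b - a)%:C%C * z.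
Proof.
move=> ab; rewrite /segint !Rintegral_cst// fine_length_itv//.
by case: z => x y; simpc; rewrite ![_ * (b - a)]mulrC.
Qed.

Lemma segintD a b phi psi : rcont_on a b phi -> rcont_on a b psi ->
  segint a b (fun t => phi t + psi t) = segint a b phi + segint a b psi.
Proof.
move=> h h'; rewrite /segint; simpc.
rewrite -!RintegralD//; try exact: integrable_Re; try exact: integrable_Im.
by congr Complex; apply: eq_Rintegral => t _; case: (phi t); case: (psi t).
Qed.

Lemma segintZ a b (z : R[i]) phi : rcont_on a b phi ->
  segint a b (fun t => z * phi t) = z * segint a b phi.
Proof.
move=> h; case: z => x y; rewrite /segint; simpc.
have mab : measurable (`[a, b]%classic : set R) by [].
have iR := integrable_Re h; have iI := integrable_Im h.
rewrite -!RintegralZl//.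
have iZ (r : R) (f : R -> R) : lebesgue_measure.-integrable `[a, b] (EFin \o f) ->
    lebesgue_measure.-integrable `[a, b] (EFin \o (fun t => r * f t)).
  move=> hf; rewrite (_ : _ \o _ = (fun t => r%:E * (EFin \o f) t)%E).
    exact: integrableZl.
  by apply/funext => t /=; rewrite EFinM.
rewrite -RintegralB//; try exact: iZ.
rewrite -RintegralD//; try exact: iZ.
by congr Complex; apply: eq_Rintegral => t _; case: (phi t) => p q; rewrite /=; ring.
Qed.

Lemma segintN a b phi : rcont_on a b phi ->
  segint a b (fun t => - phi t) = - segint a b phi.
Proof.
move=> h; rewrite -mulN1r -segintZ//; apply: eq_segint => t _ _.
by rewrite mulN1r.
Qed.

Lemma segintB a b phi psi : rcont_on a b phi -> rcont_on a b psi ->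
  segint a b (fun t => phi t - psi t) = segint a b phi - segint a b psi.
Proof.
move=> h h'; rewrite segintD ?segintN// => t at_ tb.
by apply: rcontN; exact: h'.
Qed.

Lemma segint_split a b c phi : a <= c -> c <= b -> rcont_on a b phi ->
  segint a b phi = segint a c phi + segint c b phi.
Proof.
move=> ac cb h; rewrite /segint; simpc.
have split_ (f : R -> R) : lebesgue_measure.-integrable `[a, b] (EFin \o f) ->
    \int[lebesgue_measure]_(t in `[a, b]) f t =
    \int[lebesgue_measure]_(t in `[a, c]) f t + \int[lebesgue_measure]_(t in `[c, b]) f t.
  move=> hf; rewrite -(@Rintegral_itv_obnd_cbnd _ c).
    by rewrite -(@Rintegral_itvB _ f (BLeft a) (BRight b) c hf)// 1?addrC ?subrK ?bnd_simp.
  apply: integrableS hf => //; apply: subset_itvr; rewrite bnd_simp//.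
congr Complex; apply: split_; [exact: integrable_Re|exact: integrable_Im].
Qed.

(** The factor 2 comes from bounding real and imaginary parts separately. *)
Lemma segint_le a b phi M : a <= b -> rcont_on a b phi ->
  (forall t, a <= t -> t <= b -> nm (phi t) <= M) ->
  nm (segint a b phi) <= 2 * M * (b - a).
Proof.
move=> ab h hM; apply: (le_trans (nm_le_ReIm _)) => /=.
have bnd (f : R -> R) : lebesgue_measure.-integrable `[a, b] (EFin \o f) ->
    (forall t, a <= t -> t <= b -> `|f t| <= M) ->
    `|\int[lebesgue_measure]_(t in `[a, b]) f t| <= M * (b - a).
  move=> hf fM; apply: le_trans (le_normr_Rintegral _ hf) _ => //.
  have -> : M * (b - a) = \int[lebesgue_measure]_(t in `[a, b]) M.
    by rewrite Rintegral_cst// fine_length_itv.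
  apply: le_Rintegral => //.
  - by have := integrable_norm hf; congr (_.-integrable _ _).
  - apply: continuous_compact_integrable; first exact: segment_compact.
    by apply: continuous_subspaceT => ?; exact: cvg_cst.
  - by move=> t; rewrite /= in_itv/= => /andP[]; exact: fM.
rewrite (_ : 2 * M * (b - a) = M * (b - a) + M * (b - a)); last by ring.
apply: lerD; apply: bnd.
- exact: integrable_Re.
- by move=> t at_ tb; apply: le_trans (Re_le_nm _) (hM t at_ tb).
- exact: integrable_Im.
- by move=> t at_ tb; apply: le_trans (Im_le_nm _) (hM t at_ tb).
Qed.

Lemma segint_near_cst a b phi (z : R[i]) M : a <= b -> rcont_on a b phi ->
  (forall t, a <= t -> t <= b -> nm (phi t - z) <= M) ->
  nm (segint a b phi - (b - a)%:C%C * z) <= 2 * M * (b - a).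
Proof.
move=> ab h hM; rewrite -segint_cst// -segintB//; last by move=> t _ _; exact: rcont_cst.
apply: segint_le => // t at_ tb; apply: rcontB; [exact: h|exact: rcont_cst].
Qed.

End SegmentIntegral.

(** * Goursat's lemma *)

Section Goursat.
Variable R : realType.
Implicit Types (x y t : R) (z w : R[i]) (h F : R[i] -> R[i]).

Definition cdiff h z := exists l : R[i], forall e : R, 0 < e ->
  exists2 d : R, 0 < d &
  forall w, nm w < d -> nm (h (z + w) - h z - l * w) <= e * nm w.

Definition ccont h z := forall e : R, 0 < e -> exists2 d : R, 0 < d &
  forall w, nm w < d -> nm (h (z + w) - h z) <= e.

Lemma cdiff_cont h z : cdiff h z -> ccont h z.
Proof.
move=> [l hl] e e0; have [d d0 hd] := hl 1 ltr01.
have l0 := nm_ge0 l.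
exists (Num.min d (e / (nm l + 1))) => [|w].
  by rewrite lt_min d0 divr_gt0//; lra.
rewrite lt_min => /andP[/hd h1]; rewrite ltr_pdivlMr => [h2|]; last lra.
rewrite -(subrK (l * w) (_ - _)); apply: (le_trans (nmD _ _)).
by rewrite nmM; lra.
Qed.

Lemma cdiff_cst (c : R[i]) z : cdiff (fun=> c) z.
Proof.
exists 0 => e e0; exists 1 => // w _.
by rewrite subrr sub0r mul0r oppr0 nm0 mulr_ge0 ?nm_ge0 ?ltW.
Qed.

Lemma cdiffD F h z : cdiff F z -> cdiff h z -> cdiff (fun w => F w + h w) z.
Proof.
move=> [l hl] [l' hl']; exists (l + l') => e e0.
have [d d0 hd] := hl (e / 2) ltac:(lra); have [d' d'0 hd'] := hl' (e / 2) ltac:(lra).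
exists (Num.min d d') => [|w]; first by rewrite lt_min d0.
rewrite lt_min => /andP[/hd h1 /hd' h2].
rewrite (_ : _ - _ = (F (z + w) - F z - l * w) + (h (z + w) - h z - l' * w)); last by ring.
by apply: (le_trans (nmD _ _)); lra.
Qed.

Lemma cdiffM F h z : cdiff F z -> cdiff h z -> cdiff (fun w => F w * h w) z.
Proof.
move=> dF dh; have [l hl] := dF; have [l' hl'] := dh.
exists (l * h z + F z * l') => e e0.
pose A := nm (F z) + nm (h z) + nm l + 1.
have [nF nh nl] : [/\ nm (F z) <= A, nm (h z) <= A & nm l <= A].
  by move: (nm_ge0 (F z)) (nm_ge0 (h z)) (nm_ge0 l); rewrite /A; split; lra.
have A0 : 0 < A by move: (nm_ge0 (F z)) (nm_ge0 (h z)) (nm_ge0 l); rewrite /A; lra.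
pose e' := e / 4 / A.
have e'0 : 0 < e' by rewrite !divr_gt0.
have [d d0 hd] := hl (Num.min e' 1) ltac:(by rewrite lt_min e'0 ltr01).
have [d' d'0 hd'] := hl' e' e'0.
have [d2 d20 hd2] := cdiff_cont dh e'0.
exists (Num.min d (Num.min d' d2)) => [|w]; first by rewrite !lt_min d0 d'0.
rewrite !lt_min => /and3P[/hd h1 /hd' h2 /hd2 h3].
rewrite (_ : _ - _ = (F (z + w) - F z - l * w) * h z +
  (F (z + w) - F z - l * w) * (h (z + w) - h z) + l * w * (h (z + w) - h z) +
  F z * (h (z + w) - h z - l' * w)); last by ring.
have {h1}[h1 h1'] : nm (F (z + w) - F z - l * w) <= e' * nm w /\
    nm (F (z + w) - F z - l * w) <= nm w.
  split; apply: (le_trans h1); last rewrite -[leRHS]mul1r.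
    by rewrite ler_wpM2r ?nm_ge0// ge_min lexx.
  by rewrite ler_wpM2r ?nm_ge0// ge_min lexx orbT.
apply: (le_trans (nmD _ _)); apply: (le_trans (lerD (nmD _ _) (lexx _))).
apply: (le_trans (lerD (lerD (nmD _ _) (lexx _)) (lexx _))); rewrite !nmM.
have w0 := nm_ge0 w.
have eA : e * nm w = e' * nm w * A * 4 by rewrite /e'; field; rewrite gt_eqF.
have A1 : 1 <= A by move: (nm_ge0 (F z)) (nm_ge0 (h z)) (nm_ge0 l); rewrite /A; lra.
have p0 : 0 <= e' * nm w by rewrite mulr_ge0// ltW.
have t1 : nm (F (z + w) - F z - l * w) * nm (h z) <= e' * nm w * A.
  by apply: ler_pM; rewrite ?nm_ge0.
have t2 : nm (F (z + w) - F z - l * w) * nm (h (z + w) - h z) <= e' * nm w * A.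
  apply: (@le_trans _ _ (nm w * e')); first by apply: ler_pM; rewrite ?nm_ge0.
  by rewrite mulrC ler_peMr.
have t3 : nm l * nm w * nm (h (z + w) - h z) <= e' * nm w * A.
  rewrite (_ : e' * _ * _ = A * nm w * e'); last by ring.
  by apply: ler_pM; rewrite ?mulr_ge0 ?nm_ge0// ler_wpM2r.
have t4 : nm (F z) * nm (h (z + w) - h z - l' * w) <= e' * nm w * A.
  by rewrite [leRHS]mulrC; apply: ler_pM; rewrite ?nm_ge0.
lra.
Qed.

Lemma cdiffV z : z != 0 -> cdiff (fun w => w^-1) z.
Proof.
move=> z0; exists (- (z ^+ 2)^-1) => e e0.
have n0 : 0 < nm z by rewrite nm_gt0.
have d2 : 0 < e * nm z ^+ 3 / 2 by rewrite divr_gt0// mulr_gt0// exprn_gt0.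
exists (Num.min (nm z / 2) (e * nm z ^+ 3 / 2)) => [|w].
  by rewrite lt_min d2 divr_gt0.
rewrite lt_min => /andP[w1 w2].
have zw : nm z / 2 <= nm (z + w).
  by have := nmB (z + w) w; rewrite addrK; lra.
have zw0 : z + w != 0 by rewrite -nm_gt0; lra.
rewrite (_ : _ - _ = w ^+ 2 / (z ^+ 2 * (z + w))); last first.
  by field; apply/andP; split.
rewrite nmM nmX nmV nmM nmX ler_pdivrMr; last first.
  by rewrite mulr_gt0 ?exprn_gt0//; lra.
apply: (@le_trans _ _ (e * nm w * (nm z ^+ 2 * (nm z / 2)))); last first.
  by rewrite ler_wpM2l ?ler_wpM2l ?exprn_ge0 ?mulr_ge0 ?nm_ge0// ltW.
have w0 := nm_ge0 w; rewrite expr2.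
rewrite (_ : e * nm w * _ = nm w * (e * nm z ^+ 3 / 2)); last by field.
by rewrite ler_wpM2l// ltW.
Qed.

Lemma eq_cdiff F h z : F =1 h -> cdiff F z -> cdiff h z.
Proof. by move=> /funext ->. Qed.

Lemma cdiffV_sub z w : z != w -> cdiff (fun w' => (w' - w)^-1) z.
Proof.
move=> zw; have := @cdiffV (z - w); rewrite subr_eq0 => /(_ zw)[l hl].
exists l => e e0; have [d d0 hd] := hl e e0; exists d => // v vd.
by rewrite [z + v - w]addrAC; exact: hd.
Qed.

Lemma rcont_hline h x y t : ccont h (Complex t y) -> rcont (fun s => h (Complex s y)) t.
Proof.
move=> hc e e0; have [d d0 hd] := hc e e0; exists d => // s st.
have := hd (s - t)%:C%C; rewrite nm_real => /(_ st).
by simpc; rewrite [t + _]addrC subrK.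
Qed.

Lemma rcont_vline h x y t : ccont h (Complex x t) -> rcont (fun s => h (Complex x s)) t.
Proof.
move=> hc e e0; have [d d0 hd] := hc e e0; exists d => // s st.
have := hd ('i%C * (s - t)%:C%C); rewrite nmM nm_real.
rewrite /= expr0n/= expr1n add0r sqrtr1 mul1r => /(_ st).
by simpc; rewrite [t + _]addrC subrK.
Qed.

(** The counterclockwise contour integral with opposite sides paired: bottom minus top, and right
    minus left with dz = i dy. *)
Definition rectint x0 x1 y0 y1 h : R[i] :=
  segint x0 x1 (fun t => h (Complex t y0) - h (Complex t y1)) +
  'i%C * segint y0 y1 (fun t => h (Complex x1 t) - h (Complex x0 t)).

Definition on_hline h x0 x1 y := forall t, x0 <= t -> t <= x1 -> ccont h (Complex t y).
Definition on_vline h x y0 y1 := forall t, y0 <= t -> t <= y1 -> ccont h (Complex x t).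

Lemma rcont_on_hline h x0 x1 y : on_hline h x0 x1 y ->
  rcont_on x0 x1 (fun s => h (Complex s y)).
Proof. by move=> hh t t0 t1; apply: rcont_hline; [exact: y | exact: hh]. Qed.

Lemma rcont_on_vline h x y0 y1 : on_vline h x y0 y1 ->
  rcont_on y0 y1 (fun s => h (Complex x s)).
Proof. by move=> hh t t0 t1; apply: rcont_vline; [exact: x | exact: hh]. Qed.

Lemma rcont_onB a b (phi psi : R -> R[i]) : rcont_on a b phi -> rcont_on a b psi ->
  rcont_on a b (fun s => phi s - psi s).
Proof. by move=> h h' t ta tb; apply: rcontB; [exact: h|exact: h']. Qed.

Lemma rectint_vsplit h x0 x1 x2 y0 y1 : x0 <= x1 -> x1 <= x2 ->
  on_hline h x0 x2 y0 -> on_hline h x0 x2 y1 ->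
  on_vline h x0 y0 y1 -> on_vline h x1 y0 y1 -> on_vline h x2 y0 y1 ->
  rectint x0 x2 y0 y1 h = rectint x0 x1 y0 y1 h + rectint x1 x2 y0 y1 h.
Proof.
move=> le1 le2 /rcont_on_hline h0 /rcont_on_hline h1 /rcont_on_vline v0.
move=> /rcont_on_vline v1 /rcont_on_vline v2.
rewrite /rectint (@segint_split _ x0 x2 x1)//; last exact: rcont_onB.
by do 3 rewrite (@segintB _ y0 y1)//; ring.
Qed.

Lemma rectint_hsplit h x0 x1 y0 y1 y2 : y0 <= y1 -> y1 <= y2 ->
  on_vline h x0 y0 y2 -> on_vline h x1 y0 y2 ->
  on_hline h x0 x1 y0 -> on_hline h x0 x1 y1 -> on_hline h x0 x1 y2 ->
  rectint x0 x1 y0 y2 h = rectint x0 x1 y0 y1 h + rectint x0 x1 y1 y2 h.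
Proof.
move=> le1 le2 /rcont_on_vline v0 /rcont_on_vline v1 /rcont_on_hline h0.
move=> /rcont_on_hline h1 /rcont_on_hline h2.
rewrite /rectint (@segint_split _ y0 y2 y1)//; last exact: rcont_onB.
by do 3 rewrite (@segintB _ x0 x1)//; ring.
Qed.

(* The condition on [p] and [q] says that an affine function with these increments
   integrates to 0 around the rectangle. *)
Lemma rectint_near h x0 x1 y0 y1 M N p q : x0 <= x1 -> y0 <= y1 ->
  on_hline h x0 x1 y0 -> on_hline h x0 x1 y1 ->
  on_vline h x0 y0 y1 -> on_vline h x1 y0 y1 ->
  (forall t, x0 <= t -> t <= x1 ->
     nm (h (Complex t y0) - h (Complex t y1) - p) <= M) ->
  (forall t, y0 <= t -> t <= y1 ->
     nm (h (Complex x1 t) - h (Complex x0 t) - q) <= N) ->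
  (x1 - x0)%:C%C * p + 'i%C * ((y1 - y0)%:C%C * q) = 0 ->
  nm (rectint x0 x1 y0 y1 h) <= 2 * M * (x1 - x0) + 2 * N * (y1 - y0).
Proof.
move=> lex ley /rcont_on_hline h0 /rcont_on_hline h1 /rcont_on_vline v0.
move=> /rcont_on_vline v1 hM hN pq.
rewrite -[rectint _ _ _ _ _]subr0 -pq /rectint opprD addrACA -mulrBr.
apply: (le_trans (nmD _ _)); apply: lerD.
  exact: segint_near_cst lex (rcont_onB h0 h1) hM.
rewrite nmM (_ : nm 'i%C = 1) ?mul1r.
  exact: segint_near_cst ley (rcont_onB v1 v0) hN.
by rewrite /= expr0n/= expr1n add0r sqrtr1.
Qed.

Lemma rectint_le h x0 x1 y0 y1 M : x0 <= x1 -> y0 <= y1 ->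
  on_hline h x0 x1 y0 -> on_hline h x0 x1 y1 ->
  on_vline h x0 y0 y1 -> on_vline h x1 y0 y1 ->
  (forall t, x0 <= t -> t <= x1 -> nm (h (Complex t y0)) <= M) ->
  (forall t, x0 <= t -> t <= x1 -> nm (h (Complex t y1)) <= M) ->
  (forall t, y0 <= t -> t <= y1 -> nm (h (Complex x0 t)) <= M) ->
  (forall t, y0 <= t -> t <= y1 -> nm (h (Complex x1 t)) <= M) ->
  nm (rectint x0 x1 y0 y1 h) <= 4 * M * (x1 - x0 + (y1 - y0)).
Proof.
move=> lex ley h0 h1 v0 v1 b1 b2 b3 b4.
rewrite mulrDr (_ : 4 * M = 2 * (M + M)); last by ring.
apply: (@rectint_near _ _ _ _ _ _ _ 0 0) => //; last by rewrite !mulr0 addr0.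
  by move=> t t0 t1; rewrite subr0; apply: (le_trans (nmB _ _)); rewrite lerD ?b1 ?b2.
by move=> t t0 t1; rewrite subr0; apply: (le_trans (nmB _ _)); rewrite lerD ?b3 ?b4.
Qed.

Definition on_rect (P : R[i] -> Prop) x0 x1 y0 y1 :=
  forall x y, x0 <= x -> x <= x1 -> y0 <= y -> y <= y1 -> P (Complex x y).

Lemma on_rectW P x0 x1 y0 y1 x0' x1' y0' y1' :
  x0 <= x0' -> x1' <= x1 -> y0 <= y0' -> y1' <= y1 ->
  on_rect P x0 x1 y0 y1 -> on_rect P x0' x1' y0' y1'.
Proof. by move=> a b c d h x y *; apply: h; lra. Qed.

Lemma one_of_four (q a b c d : R) : q <= a + b + (c + d) ->
  [\/ q <= 4 * a, q <= 4 * b, q <= 4 * c | q <= 4 * d].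
Proof.
move=> h; have [?|?] := leP q (4 * a); first by constructor 1.
have [?|?] := leP q (4 * b); first by constructor 2.
have [?|?] := leP q (4 * c); first by constructor 3.
by constructor 4; lra.
Qed.

Lemma rectint_halve h x0 x1 y0 y1 : x0 <= x1 -> y0 <= y1 ->
  on_rect (ccont h) x0 x1 y0 y1 ->
  exists a b, [/\ x0 <= a, a + (x1 - x0) / 2 <= x1, y0 <= b, b + (y1 - y0) / 2 <= y1 &
    nm (rectint x0 x1 y0 y1 h) <=
    4 * nm (rectint a (a + (x1 - x0) / 2) b (b + (y1 - y0) / 2) h)].
Proof.
move=> lex ley hc; pose xm := x0 + (x1 - x0) / 2; pose ym := y0 + (y1 - y0) / 2.
have x1E : xm + (x1 - x0) / 2 = x1 by rewrite /xm; field.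
have y1E : ym + (y1 - y0) / 2 = y1 by rewrite /ym; field.
have [xm0 xm1] : x0 <= xm /\ xm <= x1 by rewrite /xm; lra.
have [ym0 ym1] : y0 <= ym /\ ym <= y1 by rewrite /ym; lra.
have E : rectint x0 x1 y0 y1 h = rectint x0 xm y0 ym h + rectint x0 xm ym y1 h +
    (rectint xm x1 y0 ym h + rectint xm x1 ym y1 h).
  have hV x : x0 <= x -> x <= x1 -> on_vline h x y0 y1 by move=> u v t; exact: hc.
  have hH u v y : x0 <= u -> v <= x1 -> y0 <= y -> y <= y1 -> on_hline h u v y.
    move=> xu vx yy0 yy1 t ut tv; apply: hc => //; [exact: le_trans ut|exact: le_trans vx].
  rewrite (@rectint_vsplit h x0 xm x1)//; [|exact: hH|exact: hH|exact: hV|exact: hV|exact: hV].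
  congr (_ + _); apply: rectint_hsplit => //; do ?[exact: hV|exact: hH].
have : nm (rectint x0 x1 y0 y1 h) <=
    nm (rectint x0 xm y0 ym h) + nm (rectint x0 xm ym y1 h) +
    (nm (rectint xm x1 y0 ym h) + nm (rectint xm x1 ym y1 h)).
  by rewrite E; apply: (le_trans (nmD _ _)); rewrite lerD ?nmD.
move=> /one_of_four[c|c|c|c].
- by exists x0, y0; split=> //; rewrite -/xm -/ym.
- by exists x0, ym; rewrite y1E; split=> //; rewrite -/xm.
- by exists xm, y0; rewrite x1E; split=> //; rewrite -/ym.
- by exists xm, ym; rewrite x1E y1E; split.
Qed.

(** The affine part of [h] at the point (px, py) has constant differences between opposite sides and
    integrates to 0, so only the remainder, at most [e * s] at each boundary point, is left. The
    perimeter supplies the second factor s. *)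
Lemma rectint_small h l e d px py x0 x1 y0 y1 : x0 <= px -> px <= x1 -> y0 <= py ->
  py <= y1 -> 0 <= e -> x1 - x0 + (y1 - y0) < d -> on_rect (ccont h) x0 x1 y0 y1 ->
  (forall w, nm w < d ->
     nm (h (Complex px py + w) - h (Complex px py) - l * w) <= e * nm w) ->
  nm (rectint x0 x1 y0 y1 h) <= 4 * e * (x1 - x0 + (y1 - y0)) ^+ 2.
Proof.
move=> px0 px1 py0 py1 e0 sd hc hl; have [lex ley] : x0 <= x1 /\ y0 <= y1 by lra.
set s := x1 - x0 + (y1 - y0) in sd *.
have rem x y : x0 <= x -> x <= x1 -> y0 <= y -> y <= y1 ->
    nm (h (Complex x y) - h (Complex px py) - l * Complex (x - px) (y - py)) <= e * s.
  move=> xa xb ya yb; have nw : nm (Complex (x - px) (y - py)) <= s.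
    apply: (le_trans (nm_le_ReIm _)) => /=; clear hl hc.
    by apply: lerD; rewrite ler_norml; apply/andP; split; lra.
  have := hl (Complex (x - px) (y - py)); simpc.
  rewrite ![_ + (_ - _)]addrC !subrK => hw.
  by apply: (le_trans (hw (le_lt_trans nw sd))); rewrite ler_wpM2l.
have rem2 x y x' y' q : x0 <= x -> x <= x1 -> y0 <= y -> y <= y1 ->
    x0 <= x' -> x' <= x1 -> y0 <= y' -> y' <= y1 -> q = l * Complex (x - x') (y - y') ->
    nm (h (Complex x y) - h (Complex x' y') - q) <= 2 * (e * s).
  move=> a1 a2 a3 a4 b1 b2 b3 b4 ->; rewrite [X in nm X](_ : _ =
    (h (Complex x y) - h (Complex px py) - l * Complex (x - px) (y - py)) -
    (h (Complex x' y') - h (Complex px py) - l * Complex (x' - px) (y' - py))).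
    by apply: (le_trans (nmB _ _)); rewrite mulr_natl mulr2n; apply: lerD; exact: rem.
  rewrite (_ : Complex (x - x') (y - y') = Complex (x - px) (y - py) -
    Complex (x' - px) (y' - py)); first by ring.
  by simpc; congr Complex; ring.
rewrite (_ : 4 * e * s ^+ 2 = 2 * (2 * (e * s)) * (x1 - x0) + 2 * (2 * (e * s)) * (y1 - y0)).
  apply: (@rectint_near _ _ _ _ _ _ _ (l * Complex 0 (y0 - y1)) (l * Complex (x1 - x0) 0)) => //.
  - by move=> t t0 t1; exact: hc.
  - by move=> t t0 t1; exact: hc.
  - by move=> t t0 t1; exact: hc.
  - by move=> t t0 t1; exact: hc.
  - by move=> t t0 t1; apply: rem2; rewrite ?subrr.
  - by move=> t t0 t1; apply: rem2; rewrite ?subrr.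
  by case: (l) => lx ly; simpc; congr Complex; ring.
by rewrite /s; ring.
Qed.

(** Repeated quartering keeps the integral up to a factor 4^n, while [rectint_small] at the common
    point of the rectangles bounds it by e times the square of a length of order 2^-n. *)
Lemma goursat h x0 x1 y0 y1 : x0 <= x1 -> y0 <= y1 ->
  on_rect (cdiff h) x0 x1 y0 y1 -> rectint x0 x1 y0 y1 h = 0.
Proof.
move=> lex ley hd.
have hc : on_rect (ccont h) x0 x1 y0 y1 by move=> x y *; apply/cdiff_cont/hd.
pose W n := (x1 - x0) / 2 ^+ n; pose H n := (y1 - y0) / 2 ^+ n.
have W0 n : 0 <= W n by rewrite divr_ge0 ?exprn_ge0// subr_ge0.
have H0 n : 0 <= H n by rewrite divr_ge0 ?exprn_ge0// subr_ge0.
have WS n : W n.+1 = W n / 2 by rewrite /W exprS invfM mulrA mulrAC.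
have HS n : H n.+1 = H n / 2 by rewrite /H exprS invfM mulrA mulrAC.
pose inside n (p : R * R) := [/\ x0 <= p.1, p.1 + W n <= x1, y0 <= p.2 & p.2 + H n <= y1].
pose I n (p : R * R) := nm (rectint p.1 (p.1 + W n) p.2 (p.2 + H n) h).
have /choice[f hf] : forall np : nat * (R * R), exists q : R * R,
    inside np.1 np.2 -> [/\ np.2.1 <= q.1, q.1 + W np.1.+1 <= np.2.1 + W np.1,
      np.2.2 <= q.2, q.2 + H np.1.+1 <= np.2.2 + H np.1 &
      I np.1 np.2 <= 4 * I np.1.+1 q].
  move=> [n [a b]] /=.
  have [[/= a0 a1 b0 b1]|] := pselect (inside n (a, b)); last by exists (0, 0).
  have [] := @rectint_halve h a (a + W n) b (b + H n).
  - by rewrite lerDl.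
  - by rewrite lerDl.
  - exact: on_rectW hc.
  move=> a' [b']; rewrite ![_ + _ - _]addrAC !subrr !add0r -WS -HS => -[*].
  by exists (a', b') => _; split.
pose p := fix p n := if n is n'.+1 then f (n', p n') else (x0, y0).
have pin n : inside n (p n).
  elim: n => [|n IH].
    by rewrite /inside /= /W /H expr0 !divr1 ![_ + (_ - _)]addrC !subrK !lexx.
  have [/= h1 h2 h3 h4 _] := hf (n, p n) IH.
  case: IH => i1 i2 i3 i4; split; [exact: le_trans h1|exact: le_trans i2|
    exact: le_trans h3|exact: le_trans i4].
have pstep n := hf (n, p n) (pin n).
have pI n : nm (rectint x0 x1 y0 y1 h) <= 4 ^+ n * I n (p n).
  elim: n => [|n IH].
    by rewrite expr0 mul1r /I /= /W /H expr0 !divr1 ![_ + (_ - _)]addrC !subrK.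
  apply: (le_trans IH); rewrite exprSr -mulrA ler_wpM2l ?exprn_ge0//.
  by case: (pstep n).
have pmono n k : [/\ (p n).1 <= (p (n + k)%N).1,
    (p (n + k)%N).1 + W (n + k)%N <= (p n).1 + W n, (p n).2 <= (p (n + k)%N).2 &
    (p (n + k)%N).2 + H (n + k)%N <= (p n).2 + H n].
  elim: k => [|k [i1 i2 i3 i4]]; first by rewrite addn0.
  rewrite addnS; have [/= h1 h2 h3 h4 _] := pstep (n + k)%N.
  split; [exact: le_trans h1|exact: le_trans i2|exact: le_trans h3|exact: le_trans i4].
have pcross n k : (p k).1 <= (p n).1 + W n /\ (p k).2 <= (p n).2 + H n.
  have [/subnKC kn|/ltnW/subnKC kn] := leqP k n.
    have [i1 i2 i3 i4] := pmono k (n - k)%N; rewrite kn in i1 i2 i3 i4.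
    by split; [apply: (le_trans i1)|apply: (le_trans i3)]; rewrite lerDl.
  have [i1 i2 i3 i4] := pmono n (k - n)%N; rewrite kn in i1 i2 i3 i4.
  by split; [apply: le_trans i2|apply: le_trans i4]; rewrite lerDl.
(* The lower left corners increase in both coordinates and, by [pcross], stay below every upper
   right corner, so their suprema lie in all rectangles. *)
pose px := sup (range (fun k => (p k).1)); pose py := sup (range (fun k => (p k).2)).
have hpx n : (p n).1 <= px /\ px <= (p n).1 + W n.
  split; first by apply: ub_le_sup; [exists x1 => _ [k _ <-]; have [_ + _ _] := pin k;
    apply: le_trans; rewrite lerDl | exists n].
  by apply: ge_sup; [exists (p 0%N).1, 0%N | move=> _ [k _ <-]; case: (pcross n k)].
have hpy n : (p n).2 <= py /\ py <= (p n).2 + H n.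
  split; first by apply: ub_le_sup; [exists y1 => _ [k _ <-]; have [_ _ _ +] := pin k;
    apply: le_trans; rewrite lerDl | exists n].
  by apply: ge_sup; [exists (p 0%N).2, 0%N | move=> _ [k _ <-]; case: (pcross n k)].
have [l hl] : cdiff h (Complex px py).
  have [u1 u2] := hpx 0%N; have [v1 v2] := hpy 0%N.
  have [i1 i2 i3 i4] := pin 0%N.
  by apply: hd; [exact: le_trans u1|exact: le_trans u2 i2|exact: le_trans v1|exact: le_trans v2 i4].
(* The summand 1 keeps [D] positive when the rectangle degenerates. *)
pose D := (x1 - x0) + (y1 - y0) + 1.
have D0 : 0 < D by rewrite /D; lra.
suff bnd e : 0 < e -> nm (rectint x0 x1 y0 y1 h) <= 4 * D ^+ 2 * e.
  apply/eqP; rewrite -nm_eq0 eq_le nm_ge0 andbT.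
  apply/ler_addgt0Pl => e e0; rewrite addr0.
  have D2 : 0 < 4 * D ^+ 2 by rewrite mulr_gt0 ?exprn_gt0.
  apply: (le_trans (bnd (e / (4 * D ^+ 2)) _)); first by rewrite divr_gt0.
  by rewrite mulrC divfK ?gt_eqF.
move=> e0; have [d d0 hdd] := hl e e0.
have [n hn] : exists n, D / 2 ^+ n < d.
  have [n hn] : exists n : nat, D / d < n%:R.
    by exists (Num.bound (D / d)); apply: archi_boundP; rewrite divr_ge0// ltW.
  exists n; rewrite ltr_pdivrMr ?exprn_gt0// mulrC -ltr_pdivrMr//.
  apply: (lt_trans hn); rewrite -natrX ltr_nat; exact: ltn_expl.
have WHD : W n + H n <= D / 2 ^+ n.
  by rewrite /D /W /H !mulrDl mul1r lerDl invr_ge0 exprn_ge0.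
have [a0 a1 b0 b1] := pin n; have [u1 u2] := hpx n; have [v1 v2] := hpy n.
apply: (le_trans (pI n)).
have -> : 4 * D ^+ 2 * e = 4 ^+ n * (4 * e * (D / 2 ^+ n) ^+ 2).
  rewrite (_ : 4 = 2 ^+ 2 :> R); last by rewrite -natrX.
  rewrite -exprM mulnC exprM; field; rewrite expf_neq0//.
have WE : (p n).1 + W n - (p n).1 + ((p n).2 + H n - (p n).2) = W n + H n.
  by rewrite ![_ + _ - _]addrAC !subrr !add0r.
rewrite ler_wpM2l ?exprn_ge0//.
apply: (le_trans (rectint_small u1 u2 v1 v2 (ltW e0) _ (on_rectW a0 a1 b0 b1 hc) hdd)).
  by rewrite WE; exact: le_lt_trans hn.
rewrite WE ler_wpM2l ?mulr_ge0 ?(ltW e0)//.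
by rewrite lerXn2r ?nnegrE ?addr_ge0//; apply: le_trans WHD; rewrite addr_ge0.
Qed.

End Goursat.

(** * Power series expansion *)

Section CauchySeries.
Variable R : realType.
Implicit Types (x y t a : R) (z w : R[i]) (h F : R[i] -> R[i]).

Lemma cdiffX h z n : cdiff h z -> cdiff (fun w => h w ^+ n) z.
Proof.
move=> hz; elim: n => [|n IH]; first exact: (cdiff_cst 1 z).
by apply: eq_cdiff (cdiffM hz IH) => w; rewrite exprS.
Qed.

(** The outer rectangle minus the inner one is a left and a right strip of full height, plus a
    bottom and a top piece between them; [F] is holomorphic on all four, so Goursat's lemma removes
    them. *)
Lemma rectint_frame F X0 X1 Y0 Y1 x0 x1 y0 y1 :
  X0 <= x0 -> x0 <= x1 -> x1 <= X1 -> Y0 <= y0 -> y0 <= y1 -> y1 <= Y1 ->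
  (forall x y, X0 <= x -> x <= X1 -> Y0 <= y -> y <= Y1 ->
     ~ [/\ x0 < x, x < x1, y0 < y & y < y1] -> cdiff F (Complex x y)) ->
  rectint X0 X1 Y0 Y1 F = rectint x0 x1 y0 y1 F.
Proof.
move=> a1 a2 a3 b1 b2 b3 hF.
have hV x : X0 <= x -> x <= X1 -> x <= x0 \/ x1 <= x -> on_vline F x Y0 Y1.
  by move=> u v o t t0 t1; apply/cdiff_cont/hF => // -[]; case: o; lra.
have hH y : Y0 <= y -> y <= Y1 -> y <= y0 \/ y1 <= y -> on_hline F X0 X1 y.
  by move=> u v o t t0 t1; apply/cdiff_cont/hF => // -[]; case: o; lra.
have hVW x u v : Y0 <= u -> v <= Y1 -> on_vline F x Y0 Y1 -> on_vline F x u v.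
  by move=> i j k t t0 t1; apply: k; lra.
have hHW y u v : X0 <= u -> v <= X1 -> on_hline F X0 X1 y -> on_hline F u v y.
  by move=> i j k t t0 t1; apply: k; lra.
have [X0x1 x0X1] : X0 <= x1 /\ x0 <= X1 by split; lra.
have [Y0y1 y0Y1] : Y0 <= y1 /\ y0 <= Y1 by split; lra.
have [X01 Y01] : X0 <= X1 /\ Y0 <= Y1 by split; lra.
have e1 : rectint X0 X1 Y0 Y1 F = rectint X0 x0 Y0 Y1 F + rectint x0 X1 Y0 Y1 F.
  by apply: rectint_vsplit; [| |apply: hHW; [| |apply: hH]|apply: hHW; [| |apply: hH]|
    apply: hV|apply: hV|apply: hV]; do ?[done|by left|by right].
have e2 : rectint x0 X1 Y0 Y1 F = rectint x0 x1 Y0 Y1 F + rectint x1 X1 Y0 Y1 F.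
  by apply: rectint_vsplit; [| |apply: hHW; [| |apply: hH]|apply: hHW; [| |apply: hH]|
    apply: hV|apply: hV|apply: hV]; do ?[done|by left|by right].
have e3 : rectint x0 x1 Y0 Y1 F = rectint x0 x1 Y0 y0 F + rectint x0 x1 y0 Y1 F.
  by apply: rectint_hsplit; [| |apply: hVW; [| |apply: hV]|apply: hVW; [| |apply: hV]|
    apply: hHW; [| |apply: hH]|apply: hHW; [| |apply: hH]|apply: hHW; [| |apply: hH]]; do ?[done|by left|by right].
have e4 : rectint x0 x1 y0 Y1 F = rectint x0 x1 y0 y1 F + rectint x0 x1 y1 Y1 F.
  by apply: rectint_hsplit; [| |apply: hVW; [| |apply: hV]|apply: hVW; [| |apply: hV]|
    apply: hHW; [| |apply: hH]|apply: hHW; [| |apply: hH]|apply: hHW; [| |apply: hH]]; do ?[done|by left|by right].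
rewrite e1 e2 e3 e4 (@goursat _ F X0)//; last first.
  by move=> x y *; apply: hF; [lra|lra|lra|lra|case; lra].
rewrite (@goursat _ F x1)//; last first.
  by move=> x y *; apply: hF; [lra|lra|lra|lra|case; lra].
rewrite (@goursat _ F x0 _ Y0)//; last first.
  by move=> x y *; apply: hF; [lra|lra|lra|lra|case; lra].
rewrite (@goursat _ F x0 _ y1)//; last first.
  by move=> x y *; apply: hF; [lra|lra|lra|lra|case; lra].
by rewrite !add0r !addr0.
Qed.

Definition sqbd a (P : R[i] -> Prop) := forall x y, `|x| <= a -> `|y| <= a ->
  `|x| = a \/ `|y| = a -> P (Complex x y).

(** Squares replace the circles of the classical Cauchy formula, so that only integrals along
    axis-parallel segments occur. *)
Definition sqint a h := rectint (- a) a (- a) a h.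

Lemma sqbd_hv a (P : R[i] -> Prop) : 0 < a -> sqbd a P ->
  [/\ forall t, - a <= t -> t <= a -> P (Complex t (- a)),
      forall t, - a <= t -> t <= a -> P (Complex t a),
      forall t, - a <= t -> t <= a -> P (Complex (- a) t) &
      forall t, - a <= t -> t <= a -> P (Complex a t)].
Proof.
move=> a0 hP; have aE := gtr0_norm a0.
split=> t t0 t1; have ta : `|t| <= a by rewrite ler_norml t0.
- by apply: hP; rewrite ?normrN ?aE//; right.
- by apply: hP; rewrite ?normrN ?aE//; right.
- by apply: hP; rewrite ?normrN ?aE//; left.
- by apply: hP; rewrite ?normrN ?aE//; left.
Qed.

Lemma sqbd_nm a : sqbd a (fun z => a <= nm z).
Proof.
move=> x y xa ya [e|e].
  by rewrite -e; exact: (Re_le_nm (Complex x y)).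
by rewrite -e; exact: (Im_le_nm (Complex x y)).
Qed.

Lemma sqbd_and a (P Q : R[i] -> Prop) : sqbd a P -> sqbd a Q ->
  sqbd a (fun z => P z /\ Q z).
Proof. by move=> hP hQ x y *; split; [exact: hP|exact: hQ]. Qed.

Lemma sqbd_impl a (P Q : R[i] -> Prop) : (forall z, P z -> Q z) -> sqbd a P -> sqbd a Q.
Proof. by move=> PQ hP x y *; apply: PQ; exact: hP. Qed.

Lemma sqint_le a h M : 0 < a -> sqbd a (ccont h) -> sqbd a (fun z => nm (h z) <= M) ->
  nm (sqint a h) <= 16 * M * a.
Proof.
move=> a0 /sqbd_hv-/(_ a0)[c1 c2 c3 c4] /sqbd_hv-/(_ a0)[b1 b2 b3 b4].
apply: le_trans (@rectint_le _ h (- a) a (- a) a M _ _ _ _ _ _ _ _ _ _) _ => //; lra.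
Qed.

Lemma eq_sqint a F h : 0 < a -> sqbd a (fun z => F z = h z) -> sqint a F = sqint a h.
Proof.
move=> a0 /sqbd_hv-/(_ a0)[c1 c2 c3 c4]; rewrite /sqint /rectint; congr (_ + _ * _);
  by apply: eq_segint => t t0 t1; rewrite ?c1 ?c2 ?c3 ?c4.
Qed.

Lemma sqint_lin a F h z : 0 < a -> sqbd a (ccont F) -> sqbd a (ccont h) ->
  sqint a (fun w => F w + z * h w) = sqint a F + z * sqint a h.
Proof.
move=> a0 /sqbd_hv-/(_ a0)[c1 c2 c3 c4] /sqbd_hv-/(_ a0)[b1 b2 b3 b4].
have {}c1 := rcont_on_hline c1; have {}c2 := rcont_on_hline c2.
have {}c3 := rcont_on_vline c3; have {}c4 := rcont_on_vline c4.
have {}b1 := rcont_on_hline b1; have {}b2 := rcont_on_hline b2.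
have {}b3 := rcont_on_vline b3; have {}b4 := rcont_on_vline b4.
have rZ u v (phi : R -> R[i]) : rcont_on u v phi -> rcont_on u v (fun t => z * phi t).
  by move=> H t t0 t1; exact/rcontZ/H.
have rD u v (phi psi : R -> R[i]) : rcont_on u v phi -> rcont_on u v psi ->
    rcont_on u v (fun t => phi t + psi t).
  by move=> H H' t t0 t1; apply: rcontD; [exact: H|exact: H'].
rewrite /sqint /rectint.
rewrite segintB; [|exact/rD/rZ|exact/rD/rZ].
rewrite segintB; [|exact/rD/rZ|exact/rD/rZ].
rewrite [segint _ _ (fun t => F _ - F _)]segintB//.
rewrite [segint _ _ (fun t => F _ - F _)]segintB//.
rewrite [segint _ _ (fun t => h _ - h _)]segintB//.
rewrite [segint _ _ (fun t => h _ - h _)]segintB//.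
rewrite !segintD ?segintZ//; do ?exact: rZ.
by ring.
Qed.

Lemma inside_sq_nm a z : 0 < a -> `|Re z| <= a -> `|Im z| <= a -> nm z < 2 * a.
Proof.
case: z => x y /= a0 xa ya.
rewrite -(@ger0_norm _ (2 * a)) ?mulr_ge0 ?ltW// -sqrtr_sqr ltr_sqrt; last first.
  by rewrite exprn_gt0// mulr_gt0.
rewrite -[x ^+ 2]real_normK ?num_real// -[y ^+ 2]real_normK ?num_real//.
have := normr_ge0 x; have := normr_ge0 y; rewrite !expr2; nra.
Qed.

Let in_sq a z := `|Re z| <= a /\ `|Im z| <= a.

Lemma sqbd_in a : 0 < a -> sqbd a (in_sq a).
Proof. by move=> a0 x y xa ya _. Qed.

Lemma sqbd_sub_ge a z : nm z < a -> sqbd a (fun w => a - nm z <= nm (w - z)).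
Proof.
move=> za; apply: sqbd_impl (@sqbd_nm _) => w aw.
by have := ler_dist_nm w z; lra.
Qed.

(** The integral of (h w - h z) / (w - z) vanishes: the contour shrinks to a small square about [z],
    on which the numerator is small by continuity and |w - z| is at least the half side. *)
Lemma cauchy_square a h z : 0 < a -> nm z < a ->
  (forall w, in_sq a w -> cdiff h w) ->
  sqint a (fun w => h w * (w - z)^-1) = h z * sqint a (fun w => (w - z)^-1).
Proof.
move=> a0 za hd.
have zne : sqbd a (fun w => w != z).
  by apply: sqbd_impl (sqbd_sub_ge za) => w; rewrite -subr_eq0 -nm_gt0; lra.
have bnd : sqbd a (fun w => w != z /\ cdiff h w).
  by apply: sqbd_and => //; apply: sqbd_impl (sqbd_in a0).
pose G w := (h w - h z) * (w - z)^-1.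
have Gd w : in_sq a w -> w != z -> cdiff G w.
  move=> wa wz; apply: cdiffM; last exact: cdiffV_sub.
  by apply: cdiffD (cdiff_cst (- h z) w); exact: hd.
suff G0 : sqint a G = 0.
  rewrite -[RHS]add0r -G0 -sqint_lin//.
  - by apply: eq_sqint => // x y *; rewrite /G; ring.
  - apply: sqbd_impl (sqbd_and zne (sqbd_in a0)) => w [wz wa].
    by apply/cdiff_cont/Gd.
  - by apply: sqbd_impl zne => w wz; apply/cdiff_cont/cdiffV_sub.
apply/eqP; rewrite -nm_eq0 eq_le nm_ge0 andbT.
apply/ler_addgt0Pl => e e0; rewrite addr0.
have zsq : in_sq a z.
  by split; apply: ltW; [apply: le_lt_trans (Re_le_nm z) _|apply: le_lt_trans (Im_le_nm z) _].
(* On a square of half side [r] the integrand is at most e / 16 / r, and [rectint_le] multiplies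
   this by 4 (2 r + 2 r) = 16 r. *)
have [d d0 hdd] := cdiff_cont (hd z zsq) (e := e / 16) ltac:(lra).
(* Points of the small square are at distance less than 2 r <= d from [z]; the other bound keeps
   this square inside the large one. *)
pose r := Num.min (d / 2) (a - nm z).
have [r0 rd ra] : [/\ 0 < r, r <= d / 2 & r <= a - nm z].
  split; rewrite ?lt_min ?ge_min ?lexx ?orbT//; apply/andP; split; lra.
case: z za hd zne bnd @G Gd zsq hdd @r r0 rd ra => p q za hd zne bnd G Gd zsq hdd r r0 rd ra.
have pa : `|p| + r <= a.
  by have := Re_le_nm (Complex p q) => /= ?; move: ra => /=; lra.
have qa : `|q| + r <= a.
  by have := Im_le_nm (Complex p q) => /= ?; move: ra => /=; lra.
have [p1 p2] : p <= `|p| /\ - p <= `|p| by rewrite ler_norm -normrN ler_norm.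
have [q1 q2] : q <= `|q| /\ - q <= `|q| by rewrite ler_norm -normrN ler_norm.
have [ap pa' aq qa'] : [/\ - a <= p - r, p + r <= a, - a <= q - r & q + r <= a].
  by clear - pa qa p1 p2 q1 q2; split; lra.
have insq x y : p - r <= x -> x <= p + r -> q - r <= y -> y <= q + r ->
    in_sq a (Complex x y).
  move=> i1 i2 i3 i4; split; rewrite /= ler_norml; apply/andP; split.
  - exact: le_trans i1.
  - exact: le_trans pa'.
  - exact: le_trans i3.
  - exact: le_trans qa'.
have [pr qr] : p - r <= p + r /\ q - r <= q + r by clear - r0; split; lra.
have bd x y : p - r <= x -> x <= p + r -> q - r <= y -> y <= q + r ->
    [\/ x = p - r, x = p + r, y = q - r | y = q + r] ->
    [/\ Complex x y != Complex p q, in_sq a (Complex x y) &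
      nm (G (Complex x y)) <= e / 16 / r].
  move=> i1 i2 i3 i4 o.
  have rn : r <= nm (Complex x y - Complex p q).
    simpc; have h1 := Re_le_nm (Complex (x - p) (y - q)).
    have h2 := Im_le_nm (Complex (x - p) (y - q)).
    case: o => o; [apply: le_trans h1|apply: le_trans h1|apply: le_trans h2|
      apply: le_trans h2]; rewrite /= o ler_normr; apply/orP;
      [right|left|right|left]; clear; lra.
  have ne : Complex x y != Complex p q by rewrite -subr_eq0 -nm_gt0; lra.
  split=> //; [exact: insq|]; rewrite /G nmM nmV; apply: ler_pM; rewrite ?invr_ge0 ?nm_ge0//.
    have := hdd (Complex x y - Complex p q); rewrite [X in h X](addrC) subrK; apply.
    have : nm (Complex x y - Complex p q) < 2 * r; last lra.
    by apply: inside_sq_nm => //=; clear - i1 i2 i3 i4; rewrite ler_norml; apply/andP; split; lra.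
  by rewrite lef_pV2// posrE; lra.
have -> : sqint a G = rectint (p - r) (p + r) (q - r) (q + r) G.
  apply: rectint_frame => // x y x0 x1 y0 y1 nin; apply: Gd.
    by split; rewrite /= ler_norml; apply/andP.
  by apply/eqP => -[xp yq]; apply: nin; rewrite xp yq; clear - r0; split; lra.
have bd1 t (t0 : p - r <= t) (t1 : t <= p + r) := bd t (q - r) t0 t1 (lexx _) qr ltac:(by constructor 3).
have bd2 t (t0 : p - r <= t) (t1 : t <= p + r) := bd t (q + r) t0 t1 qr (lexx _) ltac:(by constructor 4).
have bd3 t (t0 : q - r <= t) (t1 : t <= q + r) := bd (p - r) t (lexx _) pr t0 t1 ltac:(by constructor 1).
have bd4 t (t0 : q - r <= t) (t1 : t <= q + r) := bd (p + r) t pr (lexx _) t0 t1 ltac:(by constructor 2).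
apply: le_trans (@rectint_le _ G _ _ _ _ (e / 16 / r) pr qr _ _ _ _ _ _ _ _) _.
- by move=> t t0 t1; have [n i _] := bd1 t t0 t1; apply/cdiff_cont/Gd.
- by move=> t t0 t1; have [n i _] := bd2 t t0 t1; apply/cdiff_cont/Gd.
- by move=> t t0 t1; have [n i _] := bd3 t t0 t1; apply/cdiff_cont/Gd.
- by move=> t t0 t1; have [n i _] := bd4 t t0 t1; apply/cdiff_cont/Gd.
- by move=> t t0 t1; have [] := bd1 t t0 t1.
- by move=> t t0 t1; have [] := bd2 t t0 t1.
- by move=> t t0 t1; have [] := bd3 t t0 t1.
- by move=> t t0 t1; have [] := bd4 t t0 t1.
rewrite le_eqVlt; apply/orP; left; apply/eqP; field; rewrite gt_eqF//.
Qed.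

(** This is 2 pi i. It is left as an integral; only the lower bound [winding_ge2] on its modulus is
    used, so no arctangent has to be evaluated. *)
Definition winding a := sqint a (fun w => w^-1).

(* The difference of the two integrands is O(|w|^-2) and holomorphic outside
   the square, so the contour can be pushed to infinity. *)
Lemma sqint_kernel a z : 0 < a -> nm z < a -> sqint a (fun w => (w - z)^-1) = winding a.
Proof.
move=> a0 za.
pose G w := (w - z)^-1 + (-1) * w^-1.
have Gd w : w != z -> w != 0 -> cdiff G w.
  move=> wz w0; apply: cdiffD; first exact: cdiffV_sub.
  by apply: cdiffM; [exact: cdiff_cst|exact: cdiffV].
have nz L : a <= L -> sqbd L (fun w => w != z /\ w != 0).
  move=> aL; apply: sqbd_impl (@sqbd_nm _) => w Lw.
  rewrite -[w == z]subr_eq0 -!nm_gt0; split; last lra.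
  by have := ler_dist_nm w z; lra.
suff G0 : sqint a G = 0.
  have := G0; rewrite /G sqint_lin//.
  - by rewrite mulN1r => /eqP; rewrite subr_eq0 => /eqP.
  - by apply: sqbd_impl (nz a (lexx _)) => w [wz _]; apply/cdiff_cont/cdiffV_sub.
  - by apply: sqbd_impl (nz a (lexx _)) => w [_ w0]; apply/cdiff_cont/cdiffV.
apply/eqP; rewrite -nm_eq0 eq_le nm_ge0 andbT.
apply/ler_addgt0Pl => e e0; rewrite addr0.
(* With L >= 2 a the integrand z / (w (w - z)) is at most a / (L (L / 2)) on the boundary, and
   [sqint_le] then gives 32 a / L <= e. *)
pose L := Num.max (2 * a) (32 * a / e).
have [La Le] : 2 * a <= L /\ 32 * a / e <= L by split; rewrite le_max lexx ?orbT.
have -> : sqint a G = sqint L G.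
  symmetry; apply: rectint_frame; try lra.
  move=> x y x0 x1 y0 y1 nin.
  have out : a <= nm (Complex x y).
    rewrite leNgt; apply/negP => na; apply: nin.
    have := le_lt_trans (Re_le_nm (Complex x y)) na.
    have := le_lt_trans (Im_le_nm (Complex x y)) na.
    by rewrite /= !ltr_norml => /andP[? ?] /andP[? ?]; split.
  apply: Gd; last by rewrite -nm_gt0; lra.
  by rewrite -subr_eq0 -nm_gt0; have := ler_dist_nm (Complex x y) z; lra.
have L0 : 0 < L by lra.
apply: le_trans (@sqint_le L G (2 * a / L ^+ 2) L0 _ _) _.
- by apply: sqbd_impl (nz L ltac:(lra)) => w [wz w0]; exact/cdiff_cont/Gd.
- apply: sqbd_impl (sqbd_and (nz L ltac:(lra)) (@sqbd_nm _)) => w [[wz w0] Lw].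
  have -> : G w = z * (w^-1 * (w - z)^-1).
    by rewrite /G; field; rewrite subr_eq0 wz.
  rewrite !nmM !nmV (_ : 2 * a / L ^+ 2 = a * (L^-1 * (L / 2)^-1)); last first.
    by field; rewrite gt_eqF.
  apply: ler_pM; rewrite ?mulr_ge0 ?invr_ge0 ?nm_ge0//; first exact: ltW.
  apply: ler_pM; rewrite ?invr_ge0 ?nm_ge0//; rewrite lef_pV2 ?posrE//; try lra.
  by have := ler_dist_nm w z; lra.
  by have := ler_dist_nm w z; lra.
rewrite (_ : 16 * _ * _ = 32 * a / L); last by field; rewrite gt_eqF.
by rewrite ler_pdivrMr// [e * L]mulrC -ler_pdivrMr//.
Qed.

(** By symmetry the integral is 2 i times that of 2 a / (t^2 + a^2) over [-a, a]. This function lies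
    between 1 / a and 2 / a, hence within 1 / (2 a) of 3 / (2 a), so that its integral is within 2
    of 3. *)
Lemma winding_ge2 a : 0 < a -> 2 <= nm (winding a).
Proof.
move=> a0; pose f t : R[i] := (2 * a / (t ^+ 2 + a ^+ 2))%:C%C.
have D0 t : t ^+ 2 + a ^+ 2 != 0.
  by rewrite gt_eqF// ltr_wpDl ?sqr_ge0// exprn_gt0.
have cinv (x y : R) : (Complex x y)^-1 = Complex (x / (x ^+ 2 + y ^+ 2)) (- (y / (x ^+ 2 + y ^+ 2))).
  by [].
have nz x y : `|x| = a \/ `|y| = a -> Complex x y != 0.
  by rewrite eq_complex /=; case=> e; apply/negP => /andP[/eqP x0 /eqP y0];
    move: e a0; rewrite ?x0 ?y0 normr0 => <-; rewrite ltxx.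
have hc : sqbd a (ccont (fun w => w^-1)).
  by move=> x y _ _ /nz xy; apply/cdiff_cont/cdiffV.
have [/rcont_on_hline c1 /rcont_on_hline c2 _ _] := sqbd_hv a0 hc.
have fE t : (Complex t (- a))^-1 - (Complex t a)^-1 = 'i%C * f t.
  rewrite !cinv sqrrN; simpc; congr Complex; field; exact: D0.
have fE' t : (Complex a t)^-1 - (Complex (- a) t)^-1 = f t.
  rewrite !cinv sqrrN [a ^+ 2 + _]addrC; simpc; congr Complex; field; exact: D0.
have fc : rcont_on (- a) a f.
  move=> t t0 t1; have := rcontZ (- 'i%C) (rcontB (c1 t t0 t1) (c2 t t0 t1)).
  congr rcont; apply/funext => s; rewrite fE mulrA mulNr -expr2 sqr_i.
  by rewrite opprK mul1r.
have -> : winding a = 'i%C * (2 * segint (- a) a f).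
  rewrite /winding /sqint /rectint.
  rewrite (@eq_segint _ _ _ _ (fun t => 'i%C * f t)) => [|t _ _]; last exact: fE.
  rewrite segintZ// (@eq_segint _ _ _ (fun t => (Complex a t)^-1 - _) f) => [|t _ _].
    by ring.
  exact: fE'.
have : nm (segint (- a) a f - (a - - a)%:C%C * (3 / (2 * a))%:C%C) <=
    2 * (1 / (2 * a)) * (a - - a).
  apply: segint_near_cst => //; first lra.
  move=> t t0 t1; rewrite -(rmorphB (real_complex R)) nm_real.
  have ta : t ^+ 2 <= a ^+ 2 by rewrite !expr2; nra.
  have t20 := sqr_ge0 t; have a20 : 0 < a ^+ 2 by rewrite exprn_gt0.
  have u1 : 2 * a / (t ^+ 2 + a ^+ 2) <= 2 / a.
    rewrite ler_pdivrMr; last lra.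
    rewrite mulrAC ler_pdivlMr//; rewrite -mulrA -expr2; lra.
  have u2 : 1 / a <= 2 * a / (t ^+ 2 + a ^+ 2).
    rewrite ler_pdivlMr; last lra.
    by rewrite mulrAC ler_pdivrMr// -mulrA -expr2; lra.
  have -> : 3 / (2 * a) = 2 / a - 1 / a / 2 by field; rewrite gt_eqF.
  have -> : 1 / (2 * a) = 1 / a / 2 by field; rewrite gt_eqF.
  have e2 : 2 / a = 2 * (1 / a) by field; rewrite gt_eqF.
  rewrite e2 in u1 *; rewrite ler_norml; apply/andP; split; lra.
rewrite -rmorphM (_ : _ * (3 / _) = 3); last by field; rewrite gt_eqF.
rewrite [leRHS](_ : _ = 2); last by field; rewrite gt_eqF.
move=> near; rewrite !nmM (_ : nm 'i%C = 1); last first.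
  by rewrite /= expr0n/= expr1n add0r sqrtr1.
have -> : nm (2 : R[i]) = 2 by rewrite -(rmorph_nat (real_complex R)) nm_real ger0_norm.
have := ler_dist_nm (3 : R)%:C%C ((3 : R)%:C%C - segint (- a) a f).
rewrite nm_real ger0_norm// subKr.
by rewrite nmBC in near; lra.
Qed.

Definition cauchy_coef a h k : R[i] := (winding a)^-1 * sqint a (fun w => h w * w^-1 ^+ k.+1).

Lemma cauchy_coef_le a h M k : 0 < a -> (forall w, in_sq a w -> cdiff h w) ->
  (forall w, in_sq a w -> nm (h w) <= M) ->
  nm (cauchy_coef a h k) <= 8 * M * a^-1 ^+ k.
Proof.
move=> a0 hd hM; have W2 := winding_ge2 a0.
have nz : sqbd a (fun w => a <= nm w /\ in_sq a w).
  by apply: sqbd_and (@sqbd_nm _) (sqbd_in a0).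
rewrite nmM nmV mulrC ler_pdivrMr; last lra.
apply: le_trans (@sqint_le a _ (M * a^-1 ^+ k.+1) a0 _ _) _.
- apply: sqbd_impl nz => w [aw wi]; apply/cdiff_cont/cdiffM; first exact: hd.
  by apply: cdiffX; apply: cdiffV; rewrite -nm_gt0; lra.
- apply: sqbd_impl nz => w [aw wi]; rewrite nmM nmX nmV; apply: ler_pM;
    rewrite ?exprn_ge0 ?invr_ge0 ?nm_ge0 ?hM//.
  by apply: lerXn2r; rewrite ?nnegrE ?invr_ge0 ?nm_ge0 ?(ltW a0)// lef_pV2 ?posrE//; lra.
have M0 : 0 <= M.
  by apply: le_trans (hM 0 _); rewrite ?nm_ge0//; split; rewrite /= normr0 ltW.
rewrite exprSr (_ : 16 * _ * a = 8 * M * a^-1 ^+ k * 2); last by field; rewrite gt_eqF.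
by rewrite ler_wpM2l// !mulr_ge0// exprn_ge0// invr_ge0 ltW.
Qed.

Lemma expr_small (x C e : R) : 0 <= x -> x < 1 -> 0 < e ->
  exists N, forall n, (N <= n)%N -> C * x ^+ n <= e.
Proof.
move=> x0 x1 e0.
have : (fun n => C * x ^+ n) @ \oo --> C * 0.
  by apply: cvgMr; apply: cvg_expr; rewrite ger0_norm.
rewrite mulr0 => /cvgrPdist_le/(_ e e0)[N _ hN]; exists N => n Nn.
have := hN n Nn; rewrite sub0r normrN; exact: le_trans (ler_norm _).
Qed.

Lemma is_csum_partial (u : nat -> R[i]) l e : is_csum u l -> 0 < e ->
  exists N, forall n, (N <= n)%N -> nm (\sum_(k < n) u k - l) <= e.
Proof.
move=> ul e0; have [s us hs] := ul e e0.
exists (\max_(k <- s) k).+1 => n Nn; rewrite -(big_mkord xpredT).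
apply: hs => [|k ks]; first exact: iota_uniq.
rewrite mem_index_iota (leq_trans _ Nn)// ltnS.
exact: (@leq_bigmax_seq _ _ xpredT id k ks isT).
Qed.

(** Summability already provides some sum; the ordinary partial sums identify it. *)
Lemma is_csum_series (u : nat -> R[i]) l l' : is_csum u l ->
  (forall e, 0 < e -> exists N, forall n, (N <= n)%N ->
     nm (\sum_(k < n) u k - l') <= e) -> is_csum u l'.
Proof.
move=> ul hl; suff -> : l' = l by [].
apply/eqP; rewrite -subr_eq0 -nm_eq0 eq_le nm_ge0 andbT.
apply/ler_addgt0Pl => e e0; rewrite addr0.
have [N hN] := is_csum_partial ul (e := e / 2) ltac:(lra).
have [N' hN'] := hl (e / 2) ltac:(lra).
have h1 := hN _ (leq_maxl N N'); have h2 := hN' _ (leq_maxr N N').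
rewrite (_ : l' - l = (\sum_(k < maxn N N') u k - l) - (\sum_(k < maxn N N') u k - l')).
  by apply: (le_trans (nmB _ _)); lra.
ring.
Qed.

(** Iterating 1 / (w - z) = 1 / w + z / (w (w - z)) in Cauchy's formula gives the partial sums with
    an explicit remainder, z^n times an integral of order a^-n. *)
Lemma cauchy_series a h M z : 0 < a -> (forall w, in_sq a w -> cdiff h w) ->
  (forall w, in_sq a w -> nm (h w) <= M) ->
  nm z < a -> is_csum (fun k => cauchy_coef a h k * z ^+ k) (h z).
Proof.
move=> a0 hd hM za; have W2 := winding_ge2 a0.
have W0 : winding a != 0 by rewrite -nm_gt0; lra.
have M0 : 0 <= M.
  by apply: le_trans (hM 0 _); rewrite ?nm_ge0//; split; rewrite /= normr0 ltW.
pose F k w := h w * w^-1 ^+ k; pose G k w := F k w * (w - z)^-1.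
have nz : sqbd a (fun w => [/\ a <= nm w, in_sq a w & a - nm z <= nm (w - z)]).
  move=> x y xa ya o; split; first exact: (@sqbd_nm _); last exact: (sqbd_sub_ge za).
  exact: sqbd_in.
have Fd k : sqbd a (ccont (F k)).
  apply: sqbd_impl nz => w [aw wi _]; apply/cdiff_cont/cdiffM; first exact: hd.
  by apply: cdiffX; apply: cdiffV; rewrite -nm_gt0; lra.
have Gd k : sqbd a (ccont (G k)).
  apply: sqbd_impl nz => w [aw wi wz]; apply/cdiff_cont/cdiffM; last first.
    by apply: cdiffV_sub; rewrite -subr_eq0 -nm_gt0; lra.
  apply: cdiffM; first exact: hd.
  by apply: cdiffX; apply: cdiffV; rewrite -nm_gt0; lra.
have step k : sqint a (G k) = sqint a (F k.+1) + z * sqint a (G k.+1).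
  rewrite -sqint_lin//; apply: eq_sqint => //; apply: sqbd_impl nz => w [aw _ wz].
  have w0 : w != 0 by rewrite -nm_gt0; lra.
  have wz0 : w - z != 0 by rewrite -nm_gt0; lra.
  by rewrite /G /F exprSr; field; rewrite w0 wz0.
have part n : h z = \sum_(k < n) cauchy_coef a h k * z ^+ k +
    z ^+ n * ((winding a)^-1 * sqint a (G n)).
  elim: n => [|n IH].
    rewrite big_ord0 add0r expr0 mul1r.
    have -> : sqint a (G 0%N) = h z * winding a.
      rewrite -(sqint_kernel a0 za) -cauchy_square//; apply: eq_sqint => //.
      by move=> x y *; rewrite /G /F expr0 mulr1.
    by rewrite mulrCA mulVf// mulr1.
  by rewrite {1}IH step big_ord_recr /= exprSr /cauchy_coef -/(F n.+1); ring.
have zq : nm z * a^-1 < 1 by rewrite ltr_pdivrMr// mul1r.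
have zq0 : 0 <= nm z * a^-1 by rewrite mulr_ge0 ?nm_ge0// invr_ge0 ltW.
have [l hl] : exists l, is_csum (fun k => cauchy_coef a h k * z ^+ k) l.
  apply: (@is_csum_ex _ _ _ (8 * M / (1 - nm z * a^-1))).
  apply: asum_le_geom => // k; rewrite nmM nmX exprMn.
  rewrite [nm z ^+ k * _]mulrC mulrA ler_wpM2r ?exprn_ge0 ?nm_ge0//.
  exact: cauchy_coef_le.
apply: (is_csum_series hl) => e e0.
pose C := 16 * (M * (a - nm z)^-1) * a / 2.
have [N hN] := @expr_small (nm z * a^-1) C e zq0 zq e0.
exists N => n /hN; apply: le_trans.
rewrite nmBC {1}(part n) addrC addKr nmM nmX nmM nmV.
have sG : nm (sqint a (G n)) <= 16 * (M * a^-1 ^+ n * (a - nm z)^-1) * a.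
  apply: sqint_le => //; apply: sqbd_impl nz => w [aw wi wz].
  have a0' : 0 <= a^-1 by rewrite invr_ge0 ltW.
  rewrite /G /F !nmM nmX !nmV; apply: ler_pM;
    rewrite ?mulr_ge0 ?exprn_ge0 ?invr_ge0 ?nm_ge0//.
    apply: ler_pM; rewrite ?exprn_ge0 ?invr_ge0 ?nm_ge0 ?hM//.
    by apply: lerXn2r; rewrite ?nnegrE ?invr_ge0 ?nm_ge0 ?(ltW a0)// lef_pV2 ?posrE//; lra.
  by rewrite lef_pV2 ?posrE//; lra.
have -> : C * (nm z * a^-1) ^+ n =
    nm z ^+ n * (2^-1 * (16 * (M * a^-1 ^+ n * (a - nm z)^-1) * a)).
  by rewrite /C exprMn; field; rewrite subr_eq0 !gt_eqF.
rewrite ler_wpM2l ?exprn_ge0 ?nm_ge0//; apply: ler_pM; rewrite ?invr_ge0 ?nm_ge0//.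
by rewrite lef_pV2 ?posrE//; lra.
Qed.

(** The square of half side rho / 2 fits into the disc of radius [rho], which is why the radius of
    convergence is halved. *)
Lemma cauchy_disc (rho M : R) h : 0 < rho ->
  (forall z, nm z < rho -> cdiff h z) -> (forall z, nm z < rho -> nm (h z) <= M) ->
  exists c : nat -> R[i], (forall k, nm (c k) <= 8 * M * (2 / rho) ^+ k) /\
    forall z, nm z < rho / 2 -> is_csum (fun k => c k * z ^+ k) (h z).
Proof.
move=> r0 hd hM; have a0 : 0 < rho / 2 by rewrite divr_gt0.
have isq w : in_sq (rho / 2) w -> nm w < rho.
  by case=> x y; have := inside_sq_nm a0 x y; rewrite mulrC divfK.
exists (cauchy_coef (rho / 2) h); split=> [k|z zr].
  rewrite -[2 / rho]invf_div; apply: cauchy_coef_le => // w /isq; [exact: hd|exact: hM].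
by apply: (@cauchy_series _ _ M) => // w /isq; [exact: hd|exact: hM].
Qed.

End CauchySeries.

(** * Remainders and uniqueness of power series in one variable *)

Section PowerSeries.
Variable R : realType.
Implicit Types (z w : R[i]) (a : nat -> R[i]).

Lemma nm_le_eps z (C d : R) : 0 < d ->
  (forall e, 0 < e -> e < d -> nm z <= C * e) -> z = 0.
Proof.
move=> d0 h; apply/eqP; rewrite -nm_eq0 eq_le nm_ge0 andbT.
apply/ler_addgt0Pl => e e0; rewrite addr0.
have C1 : 0 < `|C| + 1 by rewrite ltr_wpDl.
pose e' := Num.min (d / 2) (e / (`|C| + 1)).
have e'0 : 0 < e' by rewrite lt_min !divr_gt0.
have e'd : e' < d by rewrite gt_min; apply/orP; left; lra.
apply: (le_trans (h e' e'0 e'd)); apply: (@le_trans _ _ (`|C| * e')).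
  by rewrite ler_wpM2r ?ler_norm// ltW.
have : e' <= e / (`|C| + 1) by rewrite ge_min lexx orbT.
rewrite ler_pdivlMr//; have := normr_ge0 C; nra.
Qed.

Lemma is_csum_tail (u : nat -> R[i]) l n : is_csum u l ->
  is_csum (fun k => if (n <= k)%N then u k else 0) (l - \sum_(k < n) u k).
Proof.
move=> ul.
have h : is_csum (fun k => if (n <= k)%N then 0 else u k) (\sum_(k < n) u k).
  have := @is_csum_fin _ _ (fun k => if (n <= k)%N then 0 else u k) (index_iota 0 n).
  rewrite big_mkord (eq_bigr (fun k : 'I_n => u k)) => [|k _]; last first.
    by rewrite leqNgt ltn_ord.
  apply=> [|k]; first exact: iota_uniq.
  by rewrite mem_index_iota/= -leqNgt => ->.
have := is_csumB ul h; congr is_csum; apply/funext => k.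
by case: ifP => _; rewrite ?subr0 ?subrr.
Qed.

Lemma asum_le_tail (u : nat -> R[i]) (B x : R) n : 0 <= x -> x < 1 ->
  (forall k, (n <= k)%N -> nm (u k) <= B * x ^+ k) ->
  asum_le (fun k => if (n <= k)%N then u k else 0) (B * x ^+ n / (1 - x)).
Proof.
move=> x0 x1 hu; apply: (@asum_le_reindex _ _ _ (addn n)).
- exact: addnI.
- by move=> k; case: ifP => [nk _|_]; [exists (k - n)%N; rewrite subnKC|rewrite eqxx].
- by apply: asum_le_geom => // k /=; rewrite leq_addr -mulrA -exprD hu// leq_addr.
Qed.

Lemma series_remainder a (A q : R) z S n : 0 <= q -> q * nm z <= 1 / 2 ->
  (forall k, (n <= k)%N -> nm (a k) <= A * q ^+ k) ->
  is_csum (fun k => a k * z ^+ k) S ->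
  nm (S - \sum_(k < n) a k * z ^+ k) <= 2 * A * (q * nm z) ^+ n.
Proof.
move=> q0 qz ha hS; have x0 : 0 <= q * nm z by rewrite mulr_ge0 ?nm_ge0.
have A0 : 0 <= A * (q * nm z) ^+ n.
  rewrite exprMn mulrA mulr_ge0 ?exprn_ge0 ?nm_ge0//.
  exact: le_trans (nm_ge0 _) (ha n (leqnn n)).
apply: le_trans (is_csum_le _ (is_csum_tail n hS)) _.
  apply: (@asum_le_tail _ A (q * nm z)) => //; first lra.
  by move=> k nk; rewrite nmM nmX exprMn mulrA ler_wpM2r ?exprn_ge0 ?nm_ge0 ?ha.
by rewrite ler_pdivrMr; nra.
Qed.

(** Once the earlier coefficients vanish, evaluation at a small real [e] gives |a k| e^k =
    O(e^(k+1)). *)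
Lemma series_coef_eq0 a (A q d : R) : 0 < q -> 0 < d -> (forall k, nm (a k) <= A * q ^+ k) ->
  (forall z, nm z < d -> is_csum (fun k => a k * z ^+ k) 0) -> forall k, a k = 0.
Proof.
move=> q0 d0 ha hS; elim/ltn_ind => k IH.
pose d' := Num.min d (1 / 2 / q).
apply: (@nm_le_eps _ (2 * A * q ^+ k.+1) d'); first by rewrite lt_min d0 divr_gt0.
move=> e e0; rewrite lt_min => /andP[ed eq].
have ne : nm e%:C%C = e by rewrite nm_real ger0_norm// ltW.
have := @series_remainder a A q e%:C%C 0 k.+1 (ltW q0) _ (fun k _ => ha k) (hS _ _).
rewrite ne big_ord_recr/= big1 => [|j _]; last by rewrite IH ?mul0r.
rewrite !add0r nmN nmM nmX ne => /(_ _ ed).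
rewrite (_ : 2 * A * _ = 2 * A * q ^+ k.+1 * e * e ^+ k); last first.
  by rewrite exprMn !exprS; ring.
rewrite ler_pM2r ?exprn_gt0//; apply.
have : e <= 1 / 2 / q by exact: ltW.
by rewrite ler_pdivlMr// mulrC.
Qed.

(** A Cauchy criterion for the limit at 0. The limit is built along the points d / 2^(n+1), where
    the successive differences form an absolutely convergent telescoping series. *)
Lemma complex_quotient_lim (q : R[i] -> R[i]) (d K : R) : 0 < d -> 0 <= K ->
  (forall w w', w != 0 -> w' != 0 -> nm w < d -> nm w' < d ->
     nm (q w - q w') <= K * (nm w + nm w')) ->
  exists l, forall w, w != 0 -> nm w < d -> nm (q w - l) <= K * nm w.
Proof.
move=> d0 K0 hq.
pose w_ (n : nat) : R[i] := (d / 2 * 2^-1 ^+ n)%:C%C.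
have h2 n : 0 < (2^-1 ^+ n : R) by rewrite exprn_gt0// invr_gt0.
have w_nm n : nm (w_ n) = d / 2 * 2^-1 ^+ n.
  by rewrite nm_real ger0_norm// mulr_ge0 ?(ltW (h2 n))// divr_ge0// ltW.
have w_gt n : w_ n != 0 by rewrite -nm_gt0 w_nm mulr_gt0// divr_gt0.
have w_lt n : nm (w_ n) < d.
  have : (2^-1 ^+ n : R) <= 1 by rewrite exprn_ile1// ?invr_ge0// invf_le1// ler1n.
  by rewrite w_nm; have := h2 n; nra.
pose u n := q (w_ n.+1) - q (w_ n).
have [l hl] : exists l, is_csum u l.
  apply: (@is_csum_ex _ _ _ (K * d / (1 - 2^-1))).
  apply: asum_le_geom; rewrite ?invr_ge0 ?invf_lt1 ?ltr1n// => n.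
  apply: (le_trans (hq _ _ _ _ _ _)) => //; rewrite -mulrA ler_wpM2l// !w_nm exprS.
  by have := h2 n; nra.
have part n : \sum_(k < n) u k = q (w_ n) - q (w_ 0%N).
  by rewrite -(big_mkord xpredT u) telescope_sumr.
exists (l + q (w_ 0%N)) => w w0 wd; apply/ler_addgt0Pr => e e0.
have [N' hN'] := is_csum_partial hl (e := e / 2) ltac:(lra).
have [N hN] := @expr_small R 2^-1 (K * d) (e / 2) ltac:(by rewrite invr_ge0)
  ltac:(by rewrite invf_lt1// ltr1n) ltac:(lra).
pose n := maxn N N'.
have h1 : K * nm (w_ n) <= e / 2.
  apply: le_trans (hN n (leq_maxl _ _)); rewrite -mulrA ler_wpM2l// w_nm.
  by have := h2 n; nra.
have h3 : nm (\sum_(k < n) u k - l) <= e / 2 by apply: hN'; exact: leq_maxr.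
rewrite (_ : q w - _ = (q w - q (w_ n)) + (\sum_(k < n) u k - l)); last by rewrite part; ring.
apply: (le_trans (nmD _ _)); have := hq w (w_ n) w0 (w_gt n) wd (w_lt n).
by rewrite mulrDr; lra.
Qed.

End PowerSeries.

(** * Power series in several variables *)

Section SeveralVariables.
Variable R : realType.
Implicit Types (z w : R[i]) (l : seq R[i]) (h : seq R[i] -> R[i]).

Fixpoint mono l (al : seq nat) : R[i] :=
  if l is z :: l' then if al is k :: al' then z ^+ k * mono l' al' else 1 else 1.

Definition polyd (r : R) l := all (fun z => nm z < r) l.

(* Holomorphic in each of the first [m] entries separately, in the polydisc of
   radius [r]; no joint continuity is assumed. *)
Fixpoint sephol (r : R) m h : Prop :=
  if m is m'.+1 then
    (forall z, nm z < r -> sephol r m' (fun l => h (z :: l))) /\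
    (forall l, size l = m' -> polyd r l -> forall z, nm z < r ->
       cdiff (fun w => h (w :: l)) z)
  else True.

Lemma sepholD r m h h' : sephol r m h -> sephol r m h' ->
  sephol r m (fun l => h l + h' l).
Proof.
elim: m h h' => [//|m IH] h h' [h1 h2] [h1' h2']; split=> [z zr|l sl lr z zr].
  by apply: IH; [exact: h1|exact: h1'].
by apply: cdiffD; [exact: h2|exact: h2'].
Qed.

Lemma sepholZ r m h c : sephol r m h -> sephol r m (fun l => c * h l).
Proof.
elim: m h => [//|m IH] h [h1 h2]; split=> [z zr|l sl lr z zr].
  by apply: IH; exact: h1.
by apply: cdiffM; [exact: cdiff_cst|exact: h2].
Qed.

Definition consT m (p : nat * m.-tuple nat) : m.+1.-tuple nat := [tuple of p.1 :: p.2].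

Lemma consT_inj m : injective (@consT m).
Proof.
by move=> [k al] [k' al'] /(congr1 (@tval _ _)) /= [-> e]; congr pair; exact: val_inj.
Qed.

Lemma consT_surj m (be : m.+1.-tuple nat) : exists p, be = consT p.
Proof. by exists (thead be, [tuple of behead be]); rewrite /consT [LHS]tuple_eta. Qed.

Lemma asum_le_consT m (u : m.+1.-tuple nat -> R[i]) B :
  asum_le (u \o @consT m) B -> asum_le u B.
Proof. by apply: asum_le_reindex => [|be _]; [exact: consT_inj|exact: consT_surj]. Qed.

Lemma is_csum_consT m (u : m.+1.-tuple nat -> R[i]) s :
  is_csum (u \o @consT m) s <-> is_csum u s.
Proof.
split; first by apply: is_csum_reindex => [|be _]; [exact: consT_inj|exact: consT_surj].
move=> us; apply: (@is_csum_reindex _ _ _ (fun be : m.+1.-tuple nat =>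
    (thead be, [tuple of behead be]))).
- move=> be be' [e1 e2].
  by rewrite [LHS]tuple_eta [RHS]tuple_eta e1; apply: val_inj; rewrite /= e2.
- by move=> [k al] _; exists (consT (k, al)); congr pair; apply: val_inj.
- by move: us; congr is_csum; apply/funext => be /=; congr u; rewrite [LHS]tuple_eta.
Qed.

Lemma asum_le_tuple_geom m (u : m.-tuple nat -> R[i]) (B x : R) :
  0 <= x -> x < 1 -> (forall al, nm (u al) <= B * x ^+ sumn al) ->
  asum_le u (B * (1 - x)^-1 ^+ m).
Proof.
move=> x0 x1 hu.
have B0 : 0 <= B.
  have := le_trans (nm_ge0 _) (hu [tuple of nseq m 0%N]).
  by rewrite /= sumn_nseq mul0n expr0 mulr1.
suff geo : asum_le (fun al : m.-tuple nat => (x ^+ sumn al)%:C%C) ((1 - x)^-1 ^+ m).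
  apply: (@asum_le_dom _ _ _ (fun al : m.-tuple nat => B%:C%C * (x ^+ sumn al)%:C%C)).
    by move=> al; rewrite nmM !nm_real !ger0_norm// exprn_ge0.
  by have := asum_leZ (B%:C%C) geo; rewrite nm_real ger0_norm.
elim: m {u hu} => [|m IH].
  move=> s us; rewrite expr0; case: s us => [|t s]; first by rewrite big_nil.
  rewrite /= => /andP[ts _]; case: s ts => [|t' s]; last first.
    by rewrite (tuple0 t) (tuple0 t') inE eqxx.
  by move=> _; rewrite big_seq1 -[leLHS]/(nm (x ^+ sumn t)%:C%C) nm_real (tuple0 t) expr0 normr1.
apply: (@asum_le_consT m (fun al => (x ^+ sumn al)%:C%C)); rewrite exprS.
have := asum_le_mul (asum_le_geom x0 x1 (B := 1) (a := fun k => (x ^+ k)%:C%C) _) IH.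
rewrite mul1r => /(_ _) hm.
apply: (@asum_le_dom _ _ _ _ _ _ (hm _)) => [[k al]|k].
  rewrite [X in nm X <= _](_ : _ = (x ^+ k)%:C%C * (x ^+ sumn al)%:C%C)//.
  by rewrite -(rmorphM (real_complex R)) -exprD.
by rewrite mul1r nm_real ger0_norm// exprn_ge0.
Qed.

Lemma nm_mono_le l al (y : R) : size l = size al -> 0 <= y ->
  all (fun z => nm z <= y) l -> nm (mono l al) <= y ^+ sumn al.
Proof.
elim: l al => [|z l IH] [|k al] //; first by rewrite /mono nm1.
move=> /= [sl] y0 /andP[zy ly]; rewrite nmM nmX exprD; apply: ler_pM;
  rewrite ?exprn_ge0 ?nm_ge0 ?IH//.
by apply: lerXn2r; rewrite ?nnegrE ?nm_ge0.
Qed.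

Lemma polyd_le r l : 0 < r -> polyd r l ->
  exists x, [/\ 0 <= x, x < 1 & all (fun z => nm z <= x * r) l].
Proof.
move=> r0; elim: l => [|z l IH] /=; first by exists 0.
move=> /andP[zr /IH[x [x0 x1 hx]]]; exists (Num.max x (nm z / r)); split.
- by rewrite le_max x0.
- by rewrite gt_max x1 ltr_pdivrMr// mul1r.
- rewrite /= -ler_pdivrMr// le_max lexx orbT/=.
  apply: sub_all hx => w /le_trans; apply.
  by rewrite ler_pM2r// le_max lexx.
Qed.

Lemma asum_le_polyd m (c : m.-tuple nat -> R[i]) (B q x : R) l : 0 < q -> size l = m ->
  0 <= x -> x < 1 -> all (fun z => nm z <= x / q) l ->
  (forall al, nm (c al) <= B * q ^+ sumn al) ->
  asum_le (fun al : m.-tuple nat => c al * mono l al) (B * (1 - x)^-1 ^+ m).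
Proof.
move=> q0 sl x0 x1 lx hc; apply: asum_le_tuple_geom => // al.
have xq : 0 <= x / q by rewrite divr_ge0// ltW.
rewrite nmM; apply: le_trans (_ : B * q ^+ sumn al * (x / q) ^+ sumn al <= _).
  apply: ler_pM; rewrite ?nm_ge0 ?hc//; apply: nm_mono_le => //.
  by rewrite sl size_tuple.
by rewrite -mulrA -exprMn mulrC mulrC mulrCA divff ?gt_eqF// mulr1.
Qed.

(** Grouping by the first exponent gives a one-variable series whose coefficients, series in the
    other variables, vanish by [series_coef_eq0]; induction applies to each of them. *)
Lemma mono_series_eq0 m (c : m.-tuple nat -> R[i]) (B q d : R) : 0 < q -> 0 < d ->
  (forall al, nm (c al) <= B * q ^+ sumn al) ->
  (forall l, size l = m -> polyd d l ->
     is_csum (fun al : m.-tuple nat => c al * mono l al) 0) ->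
  forall al, c al = 0.
Proof.
move=> q0; elim: m c B d => [|m IH] c B d d0 hc hS al.
  have := is_csum_unique (hS [::] erefl isT) (@is_csum_fin _ _ _ [:: al] isT _).
  rewrite big_seq1 /= mulr1 => -> // be; rewrite inE (tuple0 al) (tuple0 be).
  by rewrite eqxx.
(* The second bound makes the inner series converge absolutely, with ratio 1 / 2. *)
pose d' := Num.min d (1 / 2 / q).
have d'0 : 0 < d' by rewrite lt_min d0 divr_gt0.
have d'd : d' <= d by rewrite ge_min lexx.
have hc' k be : nm (c (consT (k, be))) <= B * q ^+ k * q ^+ sumn be.
  by apply: le_trans (hc _) _; rewrite /= exprD mulrA.
have lx l : polyd d' l -> all (fun z => nm z <= 1 / 2 / q) l.
  apply: sub_all => z /ltW/le_trans; apply; by rewrite ge_min lexx orbT.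
have h2 : (0 <= 1 / 2 :> R) /\ (1 / 2 < 1 :> R) by split; lra.
suff : forall k l, size l = m -> polyd d' l ->
    is_csum (fun be : m.-tuple nat => c (consT (k, be)) * mono l be) 0.
  move=> h; have [[k be] ->] := consT_surj al.
  exact: (IH (fun be => c (consT (k, be))) (B * q ^+ k) d' d'0 (hc' k) (h k)).
move=> k l sl ld.
pose a k := csum (fun be : m.-tuple nat => c (consT (k, be)) * mono l be).
have ha j : asum_le (fun be : m.-tuple nat => c (consT (j, be)) * mono l be)
    (B * q ^+ j * (1 - 1 / 2)^-1 ^+ m).
  by apply: asum_le_polyd (lx _ ld) (hc' j) => //; case: h2.
suff a0 : a k = 0 by rewrite -a0; exact: csumP (ha k).
apply: (@series_coef_eq0 _ a (B * (1 - 1 / 2)^-1 ^+ m) q d') => // [j|z zd].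
  by rewrite mulrAC; exact: csum_le (ha j).
have zl : polyd d (z :: l).
  rewrite /= (lt_le_trans zd)//=; apply: sub_all ld => w wd; exact: lt_le_trans d'd.
have /is_csum_consT /is_csum_iter := hS (z :: l) (congr1 S sl) zl; apply => j.
have := is_csumZ (z ^+ j) (csumP (ha j)); rewrite mulrC; congr is_csum.
by apply/funext => be /=; rewrite mulrCA.
Qed.

(* The difference quotients of [h] in the first variable are bounded and uniformly
   Cauchy; the fourth hypothesis, which is the power series theorem in [m] variables,
   transfers this to their coefficients. *)
Lemma sephol_coef_cdiff m (r M : R) h (c : R[i] -> m.-tuple nat -> R[i]) :
  0 < r -> sephol r m.+1 h ->
  (forall l, size l = m.+1 -> polyd r l -> nm (h l) <= M) ->
  (forall D K, sephol r m D ->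
    (forall l, size l = m -> polyd r l -> nm (D l) <= K) ->
    exists d : m.-tuple nat -> R[i],
    (forall al, nm (d al) <= 8 ^+ m * K * (2 / r) ^+ sumn al) /\
    forall l, size l = m -> polyd (r / 2) l ->
      is_csum (fun al : m.-tuple nat => d al * mono l al) (D l)) ->
  (forall z, nm z < r ->
    (forall al, nm (c z al) <= 8 ^+ m * M * (2 / r) ^+ sumn al) /\
    forall l, size l = m -> polyd (r / 2) l ->
      is_csum (fun al : m.-tuple nat => c z al * mono l al) (h (z :: l))) ->
  forall al z, nm z < r -> cdiff (fun w => c w al) z.
Proof.
move=> r0 [hs1 hs2] hM ex hc al z zr.
pose s := r - nm z; have s0 : 0 < s by rewrite /s; lra.
have M0 : 0 <= M.
  apply: le_trans (nm_ge0 _) (hM (nseq m.+1 0) _ _); first by rewrite size_nseq.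
  by apply/allP => w /nseqP[-> _]; rewrite nm0.
have zw w : nm w < s -> nm (z + w) < r.
  by move=> ws; apply: le_lt_trans (nmD _ _) _; rewrite /s in ws; lra.
(* The constant of the second Taylor remainder at [z]: [cauchy_disc] on radius [s] bounds the
   coefficients by 8 M (2 / s)^k and [series_remainder] doubles this. *)
pose K0 := 2 * (8 * M) * (2 / s) ^+ 2.
have K00 : 0 <= K0.
  by apply: mulr_ge0; [rewrite !mulr_ge0 | rewrite exprn_ge0// divr_ge0// ltW].
have dq l : size l = m -> polyd r l -> exists e1, forall w, w != 0 -> nm w < s / 4 ->
    nm (w^-1 * (h (z + w :: l) - h (z :: l)) - e1) <= K0 * nm w.
  move=> sl lr; have [||e [he hsum]] := @cauchy_disc R s M (fun w => h (z + w :: l)) s0.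
  - move=> w /zw zwr; have [d hd] := hs2 l sl lr (z + w) zwr.
    exists d => eps eps0; have [d' d'0 hd'] := hd eps eps0; exists d' => // v vd.
    by rewrite addrA; exact: hd'.
  - by move=> w /zw zwr; apply: hM; rewrite /= ?sl ?zwr.
  have q0 : 0 <= 2 / s by rewrite divr_ge0// ltW.
  have e0E : e 0%N = h (z :: l).
    have := hsum 0; rewrite nm0 divr_gt0// addr0 => /(_ isT) h0.
    have := @series_remainder _ e (8 * M) (2 / s) 0 _ 1 q0 _ (fun k _ => he k) h0.
    rewrite nm0 !mulr0 big_ord1 expr0 mulr1 => /(_ ltac:(lra)) le0.
    apply/esym/eqP; rewrite -subr_eq0 -nm_eq0 eq_le nm_ge0 andbT//.
  exists (e 1%N) => w w0 ws.
  have nw : 0 < nm w by rewrite nm_gt0.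
  have qw : 2 / s * nm w <= 1 / 2.
    by rewrite mulrAC ler_pdivrMr//; lra.
  have := @series_remainder _ e (8 * M) (2 / s) w _ 2 q0 qw (fun k _ => he k) (hsum w ltac:(lra)).
  rewrite !big_ord_recr big_ord0 /= add0r expr0 mulr1 expr1 e0E => hr.
  rewrite (_ : _ - _ = w^-1 * (h (z + w :: l) - (h (z :: l) + e 1%N * w))); last by field.
  rewrite nmM nmV mulrC ler_pdivrMr//; apply: (le_trans hr).
  by rewrite exprMn /K0 -!mulrA -expr2.
pose q w := w^-1 * (c (z + w) al - c z al).
have qn : 0 <= (2 / r) ^+ sumn al by rewrite exprn_ge0// divr_ge0// ltW.
have e8 : 0 <= 8 ^+ m :> R by rewrite exprn_ge0.
have K1 : 0 <= 8 ^+ m * K0 * (2 / r) ^+ sumn al.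
  by apply: mulr_ge0 => //; exact: mulr_ge0.
have [L hL] : exists L : R[i], forall w, w != 0 -> nm w < s / 4 ->
    nm (q w - L) <= 8 ^+ m * K0 * (2 / r) ^+ sumn al * nm w.
  apply: complex_quotient_lim => //; first by rewrite divr_gt0.
  move=> w w' w0 w0' ws ws'.
  (* [D] is the difference quotient at [w] minus the one at [w']. Both are close to the same
     derivative, whence the bound K0 (|w| + |w'|). *)
  pose D l := (w^-1 * h (z + w :: l) + (w'^-1 - w^-1) * h (z :: l)) +
     (- w'^-1) * h (z + w' :: l).
  have zwr := zw w ltac:(lra); have zwr' := zw w' ltac:(lra).
  have [||d [hd dsum]] := ex D (K0 * (nm w + nm w')).
  - apply: sepholD; first apply: sepholD; apply: sepholZ; exact: hs1.
  - move=> l' sl lr; have [e1 he1] := dq l' sl lr.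
    rewrite (_ : D l' = (w^-1 * (h (z + w :: l') - h (z :: l')) - e1) -
      (w'^-1 * (h (z + w' :: l') - h (z :: l')) - e1)); last by rewrite /D; ring.
    by apply: (le_trans (nmB _ _)); rewrite [leRHS]mulrDr lerD ?he1.
  pose d' be := (w^-1 * c (z + w) be + (w'^-1 - w^-1) * c z be) +
     (- w'^-1) * c (z + w') be.
  (* Uniqueness of coefficients: the expansion of [D] must be the same linear combination of the
     expansions of [h] at z + w, z and z + w'. *)
  have dd' be : d be - d' be = 0.
    pose Kc := 8 ^+ m * (K0 * (nm w + nm w')) + (nm w^-1 * (8 ^+ m * M) +
      nm (w'^-1 - w^-1) * (8 ^+ m * M) + nm (- w'^-1) * (8 ^+ m * M)).
    apply: (@mono_series_eq0 _ (fun be => d be - d' be) Kc (2 / r) (r / 2));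
      rewrite ?divr_gt0//.
      move=> ga; have := (hc _ zwr').1 ga; have := (hc _ zr).1 ga.
      have := (hc _ zwr).1 ga; have := hd ga.
      move: ((2 / r) ^+ sumn ga) => Q k1 k2 k3 k4.
      rewrite /Kc mulrDl; apply: (le_trans (nmB _ _)); apply: lerD => //.
      rewrite !mulrDl; apply: (le_trans (nmD _ _)); apply: lerD.
        by apply: (le_trans (nmD _ _)); apply: lerD; rewrite nmM -[leRHS]mulrA ler_wpM2l ?nm_ge0.
      by rewrite nmM -[leRHS]mulrA ler_wpM2l ?nm_ge0.
    move=> l' sl lr; rewrite -(subrr (D l')).
    under [X in is_csum X]eq_fun do rewrite mulrBl.
    apply: is_csumB; first exact: dsum.
    rewrite (_ : (fun be => d' be * _) = fun be => (w^-1 * (c (z + w) be * mono l' be) +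
      (w'^-1 - w^-1) * (c z be * mono l' be)) + (- w'^-1) * (c (z + w') be * mono l' be)).
      2: by apply/funext => ga; rewrite /d'; ring.
    apply: is_csumD; first apply: is_csumD; apply: is_csumZ.
    - exact: (hc _ zwr).2.
    - exact: (hc _ zr).2.
    - exact: (hc _ zwr').2.
  rewrite (_ : q w - q w' = d al).
    apply: (le_trans (hd al)); rewrite le_eqVlt; apply/orP; left; apply/eqP; ring.
  by apply/esym/eqP; rewrite -subr_eq0; apply/eqP; rewrite -[RHS](dd' al) /d' /q; ring.
exists L => e e0.
set K := 8 ^+ m * K0 * (2 / r) ^+ sumn al in hL K1.
exists (Num.min (s / 4) (e / (K + 1))) => [|w].
  by rewrite lt_min !divr_gt0//; lra.
rewrite lt_min => /andP[ws we].
have [->|w0] := eqVneq w 0; first by rewrite addr0 subrr mulr0 subrr nm0 mulr0.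
have nw : 0 < nm w by rewrite nm_gt0.
rewrite (_ : _ - _ = w * (q w - L)); last by rewrite /q; field.
rewrite nmM mulrC ler_wpM2r ?nm_ge0//; apply: (le_trans (hL w w0 ws)).
rewrite ltr_pdivlMr in we; [nra|lra].
Qed.

(** For fixed first variable z, induction expands in the others. The coefficients are bounded and,
    by [sephol_coef_cdiff], holomorphic in z, so [cauchy_disc] expands them in turn. Each variable
    contributes a factor 8, but the radius is halved only once. *)
Theorem sephol_series m (r M : R) h : 0 < r -> sephol r m h ->
  (forall l, size l = m -> polyd r l -> nm (h l) <= M) ->
  exists c : m.-tuple nat -> R[i],
    (forall al, nm (c al) <= 8 ^+ m * M * (2 / r) ^+ sumn al) /\
    forall l, size l = m -> polyd (r / 2) l ->
      is_csum (fun al : m.-tuple nat => c al * mono l al) (h l).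
Proof.
move=> r0; elim: m M h => [|m IH] M h.
  move=> _ hM; exists (fun=> h [::]); split=> [al|[|//] _ _].
    by rewrite expr0 mul1r (tuple0 al) /= expr0 mulr1 hM.
  have t0 : 0.-tuple nat by exact: [tuple].
  have := @is_csum_fin _ _ (fun al : 0.-tuple nat => h [::] * mono [::] al) [:: t0] isT.
  rewrite big_seq1 /= mulr1; apply=> be.
  by rewrite inE (tuple0 be) (tuple0 t0) eqxx.
move=> hs hM; have [hs1 hs2] := hs.
have /choice[c hc] : forall z, exists c : m.-tuple nat -> R[i], nm z < r ->
    (forall al, nm (c al) <= 8 ^+ m * M * (2 / r) ^+ sumn al) /\
    forall l, size l = m -> polyd (r / 2) l ->
      is_csum (fun al : m.-tuple nat => c al * mono l al) (h (z :: l)).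
  move=> z; have [zr|] := pselect (nm z < r); last by exists (fun=> 0).
  have [|l sl lr|c hc] := IH M (fun l => h (z :: l)); first exact: hs1.
    by apply: hM; rewrite /= ?sl ?zr.
  by exists c.
have cd := sephol_coef_cdiff r0 hs hM (fun D K => IH K D) hc.
have /choice[b hb] : forall al : m.-tuple nat, exists b : nat -> R[i],
    (forall k, nm (b k) <= 8 * (8 ^+ m * M * (2 / r) ^+ sumn al) * (2 / r) ^+ k) /\
    forall z, nm z < r / 2 -> is_csum (fun k => b k * z ^+ k) (c z al).
  move=> al; apply: cauchy_disc => // [z zr|z zr]; first exact: cd.
  by case: (hc z zr).
pose C (be : m.+1.-tuple nat) := b [tuple of behead be] (thead be).
have CE k (al : m.-tuple nat) : C (consT (k, al)) = b al k.
  by rewrite /C theadE; congr (b _ _); exact: val_inj.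
have hC be : nm (C be) <= 8 ^+ m.+1 * M * (2 / r) ^+ sumn be.
  have [[k al] ->] := consT_surj be; rewrite CE.
  apply: le_trans ((hb al).1 k) _; rewrite /= exprS exprD.
  by rewrite le_eqVlt; apply/orP; left; apply/eqP; ring.
exists C; split=> [//|].
case=> [//|z l] [sl] /andP[zr lr].
have [||x [x0 x1 lx]] := @polyd_le (r / 2) (z :: l); first by rewrite divr_gt0.
  by rewrite /= zr.
have q0 : 0 < 2 / r by rewrite divr_gt0.
have xq : x * (r / 2) = x / (2 / r) by field; rewrite gt_eqF.
rewrite xq in lx.
have [|S hS] := is_csum_ex (asum_le_polyd q0 _ x0 x1 lx hC); first by rewrite /= sl.
suff -> : h (z :: l) = S by [].
have zr' : nm z < r by lra.
apply: is_csum_unique ((hc z zr').2 l sl lr) _.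
pose u (p : m.-tuple nat * nat) := C (consT (p.2, p.1)) * mono (z :: l) (consT (p.2, p.1)).
have hu : is_csum u S.
  apply: (@is_csum_reindex _ _ _ (fun p : nat * m.-tuple nat => (p.2, p.1))).
  - by move=> [k al] [k' al'] [-> ->].
  - by move=> [al k] _; exists (k, al).
  - by have /is_csum_consT := hS; congr is_csum; apply/funext => -[k al].
apply: (is_csum_iter hu) => al.
have := is_csumZ (mono l al) ((hb al).2 z zr); rewrite mulrC; congr is_csum.
by apply/funext => k; rewrite /u CE /=; ring.
Qed.

End SeveralVariables.

(** * Division of power series *)

Section MultiIndices.
Implicit Types (s t : seq nat) (m K : nat).

Fixpoint adds s t := match s, t with
  | a :: s', b :: t' => (a + b)%N :: adds s' t' | _, _ => [::] end.

Fixpoint subs s t := match s, t with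
  | a :: s', b :: t' => (a - b)%N :: subs s' t' | _, _ => [::] end.

Fixpoint lexlt s t := match s, t with
  | a :: s', b :: t' => (a < b)%N || (a == b) && lexlt s' t' | _, _ => false end.

(* Reading exponents as digits in base [K]: unlike the lexicographic order, this weight
   is additive, and [wdeg_lexlt] lets it detect the lexicographic order. *)
Fixpoint wdeg K s := if s is a :: s' then (a * K ^ size s' + wdeg K s')%N else 0%N.

Lemma size_adds s t : size s = size t -> size (adds s t) = size t.
Proof. by elim: s t => [|a s IH] [|b t] //= [/IH ->]. Qed.

Lemma size_subs s t : size s = size t -> size (subs s t) = size t.
Proof. by elim: s t => [|a s IH] [|b t] //= [/IH ->]. Qed.

Lemma subsK s t : all2 leq t s -> adds (subs s t) t = s.
Proof.
by elim: s t => [|a s IH] [|b t] //= /andP[ba /IH ->]; rewrite subnK.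
Qed.

Lemma adds_inj s t t' : size s = size t -> size s = size t' ->
  adds s t = adds s t' -> t = t'.
Proof.
elim: s t t' => [|a s IH] [|b t] [|b' t'] //= [st] [st'] [/addnI -> e].
by rewrite (IH t t').
Qed.

Lemma wdeg_adds K s t : size s = size t -> wdeg K (adds s t) = (wdeg K s + wdeg K t)%N.
Proof.
elim: s t => [|a s IH] [|b t] //= [st]; rewrite IH// size_adds// st mulnDl.
by rewrite addnACA.
Qed.

Lemma wdeg_lt K s : all (fun a => a < K)%N s -> (wdeg K s < K ^ size s)%N.
Proof.
elim: s => [|a s IH] //= /andP[aK /IH sK].
apply: (@leq_trans (a * K ^ size s + K ^ size s)); first by rewrite ltn_add2l.
by rewrite addnC -mulSn expnS leq_mul2r aK orbT.
Qed.

(** At the first difference [t] gains at least one unit of that digit, which exceeds everything the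
    remaining digits of [s], all below [K], can contribute. The digits of [t] may be arbitrarily
    large. *)
Lemma wdeg_lexlt K s t : size s = size t -> all (fun a => a < K)%N s -> lexlt s t ->
  (wdeg K s < wdeg K t)%N.
Proof.
elim: s t => [|a s IH] [|b t] //= [st] /andP[aK sK] /orP[ab|/andP[/eqP <- stl]].
  apply: (@leq_trans (a * K ^ size s + K ^ size s)).
    by rewrite ltn_add2l wdeg_lt.
  by rewrite addnC -mulSn st (leq_trans _ (leq_addr _ _))// leq_mul2r ab orbT.
by rewrite st ltn_add2l IH.
Qed.

Lemma wdeg_ge K s : (0 < K)%N -> (sumn s <= wdeg K s)%N.
Proof.
move=> K0; elim: s => [|a s IH] //=; apply: leq_add => //.
by rewrite leq_pmulr// expn_gt0 K0.
Qed.

Lemma wdeg_le K s : (0 < K)%N -> (wdeg K s <= K ^ size s * sumn s)%N.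
Proof.
move=> K0; elim: s => [|a s IH] //=; rewrite mulnDr; apply: leq_add.
  by rewrite mulnC leq_mul2r leq_pexp2l ?orbT// ltnW.
by apply: leq_trans IH _; rewrite leq_mul2r leq_pexp2l ?orbT.
Qed.

Lemma lexlt_total s t : size s = size t -> s != t -> lexlt s t || lexlt t s.
Proof.
elim: s t => [|a s IH] [|b t] //= [st]; rewrite eqseq_cons negb_and.
by case: (ltngtP a b) => //= _ ne; exact: IH.
Qed.

Lemma exists_min_nat (P : nat -> Prop) : (exists k, P k) ->
  exists2 k, P k & forall j, (j < k)%N -> ~ P j.
Proof.
move=> [k Pk]; have ex : exists k, `[< P k >] by exists k; apply/asboolP.
case: (ex_minnP ex) => j /asboolP Pj hj; exists j => // i ij /asboolP/hj.
by rewrite leqNgt ij.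
Qed.

(** Minimise the first entry, then the remaining ones among the tuples with that first entry. *)
Lemma lexlt_min m (P : seq nat -> Prop) : (exists2 s, size s = m & P s) ->
  exists s, [/\ size s = m, P s & forall t, size t = m -> lexlt t s -> ~ P t].
Proof.
elim: m P => [|m IH] P [s sm Ps]; first by exists s; split=> // -[].
have [k [s' [s'm Ps']] hk] : exists2 k, (exists s, size s = m /\ P (k :: s)) &
    forall j, (j < k)%N -> ~ exists s, size s = m /\ P (j :: s).
  apply: exists_min_nat; case: s sm Ps => [//|k s [sm] Ps].
  by exists k, s.
have [|u [um Pu hu]] := IH (fun s => P (k :: s)); first by exists s'.
exists (k :: u); split=> //=; first by rewrite um.
case=> [//|j t [tm]] /= /orP[jk|/andP[/eqP -> tu]]; last exact: hu.
by move=> Pjt; apply: (hk j jk); exists t.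
Qed.

(** By induction finitely many tails, each with a head [f s], lie below all tails of members of [P].
    They take care of the tuples whose head is at least the maximum [N] of these heads; each of the
    finitely many smaller heads gets its own finite set. *)
Lemma dickson m (P : seq nat -> Prop) :
  exists F : seq (seq nat),
    (forall s, s \in F -> size s = m /\ P s) /\
    forall t, size t = m -> P t -> exists2 s, s \in F & all2 leq s t.
Proof.
elim: m P => [|m IH] P.
  have [P0|nP0] := pselect (P [::]).
    exists [:: [::]]; split=> [s|[|//] _ _]; last by exists [::].
    by rewrite inE => /eqP ->.
  by exists [::]; split=> // -[|//] _ /nP0.
have [F' [F'1 F'2]] := IH (fun s => exists k, P (k :: s)).
have /choice[f hf] : forall s, exists k, s \in F' -> P (k :: s).
  move=> s; have [/F'1[_ [k Pk]]|] := boolP (s \in F'); first by exists k.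
  by exists 0%N.
pose N := (\max_(s <- F') f s)%N.
have /choice[G hG] : forall k, exists G : seq (seq nat),
    (forall s, s \in G -> size s = m /\ P (k :: s)) /\
    forall t, size t = m -> P (k :: t) -> exists2 s, s \in G & all2 leq s t.
  by move=> k; exact: (IH (fun s => P (k :: s))).
exists ([seq f s :: s | s <- F'] ++ [seq k :: s | k <- iota 0 N, s <- G k]); split.
  move=> s; rewrite mem_cat => /orP[/mapP[u uF ->]|/allpairsPdep[k [u [_ uG ->]]]].
    by split; [rewrite /= (F'1 u uF).1|exact: hf].
  by have [um Pu] := (hG k).1 u uG; rewrite /= um.
case=> [//|k t [tm] Pkt].
have [kN|Nk] := ltnP k N.
  have [s sG st] := (hG k).2 t tm Pkt; exists (k :: s); last by rewrite /= leqnn.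
  rewrite mem_cat; apply/orP; right; apply/allpairsPdep; exists k, s.
  by rewrite mem_iota.
have [|s sF st] := F'2 t tm; first by exists k.
exists (f s :: s); first by rewrite mem_cat; apply/orP; left; exact: map_f.
rewrite /= st andbT (leq_trans _ Nk)//.
exact: (@leq_bigmax_seq _ _ xpredT f s sF isT).
Qed.

Lemma size_addT m (s t : m.-tuple nat) : size (adds s t) == m.
Proof. by rewrite size_adds ?size_tuple. Qed.

Definition addT m (s t : m.-tuple nat) : m.-tuple nat := Tuple (size_addT s t).

Lemma size_subT m (s t : m.-tuple nat) : size (subs s t) == m.
Proof. by rewrite size_subs ?size_tuple. Qed.

Definition subT m (s t : m.-tuple nat) : m.-tuple nat := Tuple (size_subT s t).

Lemma addT_inj m (s : m.-tuple nat) : injective (addT s).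
Proof.
move=> t t' /(congr1 (@tval _ _)) /= e; apply: val_inj.
by apply: adds_inj e; rewrite !size_tuple.
Qed.

Lemma subTK m (s t : m.-tuple nat) : all2 leq t s -> addT (subT s t) t = s.
Proof. by move=> ts; apply: val_inj; exact: subsK. Qed.

End MultiIndices.

(** * Division with remainder in a weighted norm *)

Section Division.
Variable R : realType.
Variable m : nat.
Local Notation T := (m.-tuple nat).
Implicit Types (al be ga : T) (l : seq R[i]) (c r : T -> R[i]).

Lemma mono_addT l al be : size l = m -> mono l (addT al be) = mono l al * mono l be.
Proof.
case: al be => [s ss] [t st] /=; move: (eqP ss) (eqP st) => {ss st}; move: l s t.
elim: (m) => [|m' IH] [|z l] [|a s] [|b t] //=; first by rewrite mulr1.
by move=> [sl] [ss] [st]; rewrite IH// exprD; ring.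
Qed.

Definition evs c l := csum (fun al => c al * mono l al).

(** The coefficients of the monomial with exponent [ga] times the series [c]. At most one [be]
    contributes, by injectivity of [addT ga], and the sum is 0 when [ga] does not divide [al]. *)
Definition shiftT ga c al : R[i] := csum (fun be => if addT ga be == al then c be else 0).

Lemma shiftT_addT ga c al : shiftT ga c (addT ga al) = c al.
Proof.
apply: csumE; have := @is_csum_fin _ _ (fun be : T => if addT ga be == addT ga al
  then c be else 0) [:: al] isT.
rewrite big_seq1 eqxx; apply=> be; rewrite inE => /negbTE h.
by case: eqP => // /addT_inj e; rewrite e eqxx in h.
Qed.

Lemma shiftT_neq0 ga c al : shiftT ga c al != 0 -> exists be, al = addT ga be.
Proof.
have [[be ->] _|nex] := pselect (exists be, al = addT ga be); first by exists be.
rewrite /shiftT (_ : (fun be => _) = fun=> 0); last first.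
  by apply/funext => be; case: eqP => // e; case: nex; exists be.
by rewrite (csumE (@is_csum0 _ _)) eqxx.
Qed.

Variable W : T -> R.
Hypotheses (W_gt0 : forall al, 0 < W al)
  (W_add : forall al be, W (addT al be) = W al * W be).

(** A bound on the weighted l^1 norm. As [W] is multiplicative, a product with a monomial scales
    this norm by the weight of the monomial, and on [wdom] the norm bounds the values of the
    series. *)
Definition wle c (B : R) := asum_le (fun al => c al * (W al)%:C%C) B.

Definition wdom l := forall al, nm (mono l al) <= W al.

Lemma wle_mono c B l : wdom l -> wle c B -> asum_le (fun al => c al * mono l al) B.
Proof.
move=> lW; apply: asum_le_dom => al; rewrite !nmM nm_real.
by rewrite ler_wpM2l ?nm_ge0// (le_trans (lW al))// ler_norm.
Qed.

Lemma evsP c B l : wdom l -> wle c B -> is_csum (fun al => c al * mono l al) (evs c l).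
Proof. by move=> lW cB; exact: csumP (wle_mono lW cB). Qed.

Lemma wle_shift ga c B : wle c B -> wle (shiftT ga c) (W ga * B).
Proof.
move=> cB; apply: (@asum_le_reindex _ _ _ (addT ga)).
- exact: addT_inj.
- move=> al; apply: contraNP => nex; apply/eqP.
  have [->|/shiftT_neq0//] := eqVneq (shiftT ga c al) 0; by rewrite mul0r.
- have := asum_leZ (W ga)%:C%C cB; rewrite nm_real (gtr0_norm (W_gt0 ga)).
  apply: asum_le_dom => al; rewrite /= shiftT_addT W_add rmorphM /=.
  by rewrite le_eqVlt; apply/orP; left; apply/eqP; congr nm; ring.
Qed.

Lemma evs_shift ga c B l : size l = m -> wdom l -> wle c B ->
  is_csum (fun al => shiftT ga c al * mono l al) (mono l ga * evs c l).
Proof.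
move=> sl lW cB; apply: (@is_csum_reindex _ _ _ (addT ga)).
- exact: addT_inj.
- move=> al; apply: contraNP => nex; apply/eqP.
  have [->|/shiftT_neq0//] := eqVneq (shiftT ga c al) 0; by rewrite mul0r.
- have := is_csumZ (mono l ga) (evsP lW cB); congr is_csum; apply/funext => al /=.
  by rewrite shiftT_addT mono_addT//; ring.
Qed.

Variables (E : T -> Prop) (F : seq T) (alp gam : T -> T) (g : T -> T -> R[i]) (kap : R).
Hypotheses (alpF : forall be, E be -> alp be \in F)
  (gam_alp : forall be, E be -> addT (gam be) (alp be) = be)
  (g_lead : forall al, al \in F -> wle (fun be => g al be - (be == al)%:R) (W al / 4))
  (kap_ge0 : 0 <= kap) (kapW : forall al, al \in F -> 1 <= kap * W al).

Definition lead_sum l : R := \sum_(al <- F) nm (evs (g al) l).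

Let wle_g al : al \in F -> wle (g al) (W al / 4 + W al).
Proof.
move=> alF; have d : wle (fun be => (be == al)%:R) (W al).
  move=> s us; rewrite (bigID (pred1 al))/= [X in _ + X]big1 => [|be /negbTE ->]; last first.
    by rewrite mul0r nm0.
  rewrite addr0; have [als|nals] := boolP (al \in s).
    by rewrite -big_filter (filter_pred1_uniq us als) big_seq1 eqxx mul1r nm_real gtr0_norm.
  rewrite big_seq_cond big1 ?ltW// => be /andP[bes /eqP e].
  by rewrite e (negbTE nals) in bes.
apply: asum_le_dom (asum_leD (g_lead alF) d) => be.
by rewrite mulrBl subrK.
Qed.

(* [E] is the set of leading exponents, [F] a finite set of generators [g al] with
   leading term [al]. Only the finitely many terms of [c] carrying most of the weight
   are cancelled, so that no infinite combination of the [g al] occurs. *)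
Lemma division_step c B : 0 < B -> wle c B ->
  exists c' r, [/\ wle c' (B / 2), wle r B, forall al, E al -> r al = 0 &
    forall l, size l = m -> wdom l ->
      nm (evs c l - evs r l - evs c' l) <= kap * B * lead_sum l].
Proof.
(* The part of [c] outside [s0] keeps norm at most B / 4. Cancelling on [s0] costs another B / 4,
   because each generator differs from its leading monomial by a quarter of the weight. Together
   they leave B / 2. *)
move=> B0 cB; have [s0 us0 hs0] := asum_tail cB (e := B / 4) ltac:(lra).
pose S := [seq be <- s0 | `[< E be >]].
have SE be : be \in S -> E be by rewrite mem_filter => /andP[/asboolP].
have uS : uniq S by exact: filter_uniq.
have WE be : be \in S -> W be = W (gam be) * W (alp be).
  by move=> /SE Ebe; rewrite -W_add gam_alp.
pose r al := if `[< E al >] then 0 else c al.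
pose q be al := c be * shiftT (gam be) (g (alp be)) al.
pose c' al := c al - r al - \sum_(be <- S) q be al.
have rB : wle r B.
  apply: asum_le_dom cB => al; rewrite /r; case: ifP => // _.
  by rewrite mul0r nm0 nm_ge0.
have q_wle be : exists Bq, be \in S -> wle (q be) Bq.
  have [beS|] := boolP (be \in S); last by exists 0.
  eexists=> _; rewrite /wle /q; under [X in asum_le X]eq_fun do rewrite -mulrA.
  exact: asum_leZ (wle_shift _ (wle_g (alpF (SE _ beS)))).
(* The leading monomials of the subtracted multiples cancel exactly the terms of [c] at [S]; what
   remains is the tail of [c] and the shifted non-leading parts of the generators. *)
have c'E al : c' al = (if `[< E al >] && (al \notin s0) then c al else 0) -
    \sum_(be <- S) c be * shiftT (gam be)
      (fun de => g (alp be) de - (de == alp be)%:R) al.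
  rewrite /c' (_ : \sum_(be <- S) q be al = \sum_(be <- S) c be * shiftT (gam be)
      (fun de => g (alp be) de - (de == alp be)%:R) al + \sum_(be <- S | be == al) c be).
    rewrite opprD addrA addrAC; congr (_ - _).
    have [alS|nalS] := boolP (al \in S).
      rewrite -big_filter (filter_pred1_uniq uS alS) big_seq1 /r.
      move: (alS); rewrite mem_filter => /andP[-> ->] /=.
      by rewrite subr0 subrr.
    rewrite [X in _ - X]big_seq_cond big1 ?subr0 => [|be /andP[beS /eqP e]]; last first.
      by rewrite -e beS in nalS.
    move: nalS; rewrite mem_filter /r; case: (`[< E al >]) => /= [->|_].
      by rewrite subr0.
    by rewrite subrr.
  rewrite [X in _ = _ + X]big_mkcond /= -big_split /= !big_seq.
  apply: eq_bigr => be beS; rewrite /q.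
  have gE := gam_alp (SE _ beS).
  have [[de ->]|nex] := pselect (exists de, al = addT (gam be) de).
    rewrite !shiftT_addT.
    have -> : (be == addT (gam be) de) = (de == alp be).
      by rewrite -{1}gE (inj_eq (@addT_inj _ _)) eq_sym.
    by case: eqP => _ /=; ring.
  have sh0 h : shiftT (gam be) h al = 0.
    by apply/eqP/negPn/negP => /shiftT_neq0.
  rewrite !sh0 !mulr0 add0r ifN//; apply/eqP => e; apply: nex; exists (alp be).
  by rewrite gE.
exists c', r; split=> //.
- rewrite (_ : B / 2 = B / 4 + B / 4); last by field.
  have t1 : wle (fun al => if `[< E al >] && (al \notin s0) then c al else 0) (B / 4).
    move=> s us; apply: le_trans (hs0 [seq al <- s | al \notin s0] _ _).
    + rewrite big_filter [leRHS]big_mkcond /=; apply: ler_sum => al _.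
      case: (al \notin s0); rewrite ?andbF ?andbT ?mul0r ?nm0//.
      by case: ifP => //; rewrite mul0r nm0 nm_ge0.
    + exact: filter_uniq.
    + by move=> al; rewrite mem_filter => /andP[].
  have t2 : wle (fun al => \sum_(be <- S) c be * shiftT (gam be)
      (fun de => g (alp be) de - (de == alp be)%:R) al) (B / 4).
    have hS : \sum_(be <- S) nm (c be * (W be)%:C%C) <= B by exact: cB.
    apply: (@asum_leW _ _ _ (\sum_(be <- S) (nm (c be * (W be)%:C%C) / 4))).
      by rewrite -mulr_suml ler_pM2r.
    apply: (@asum_le_dom _ _ _ (fun al => \sum_(be <- S) c be * (shiftT (gam be)
      (fun de => g (alp be) de - (de == alp be)%:R) al * (W al)%:C%C))).
      move=> al; rewrite mulr_suml le_eqVlt; apply/orP; left; apply/eqP.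
      by congr nm; apply: eq_bigr => be _; rewrite mulrA.
    apply: asum_le_sum => be beS.
    have := asum_leZ (c be) (wle_shift (gam be) (g_lead (alpF (SE _ beS)))).
    by rewrite nmM nm_real gtr0_norm// (WE _ beS) !mulrA.
  have := asum_leD t1 (asum_leZ (-1) t2); rewrite nmN nm1 mul1r.
  apply: asum_le_dom => al; rewrite le_eqVlt; apply/orP; left; apply/eqP.
  by congr nm; rewrite c'E; ring.
- by move=> al Eal; rewrite /r asboolT.
- move=> l sl lW.
  have hq : is_csum (fun al => \sum_(be <- S) q be al * mono l al)
      (\sum_(be <- S) c be * (mono l (gam be) * evs (g (alp be)) l)).
    apply: is_csum_sum => be beS; rewrite /q.
    under [X in is_csum X]eq_fun do rewrite -mulrA.
    exact: is_csumZ (evs_shift _ sl lW (wle_g (alpF (SE _ beS)))).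
  have -> : evs c l - evs r l - evs c' l =
      \sum_(be <- S) c be * (mono l (gam be) * evs (g (alp be)) l).
    have h := is_csumB (is_csumB (evsP lW cB) (evsP lW rB)) hq.
    have -> : evs c' l = evs c l - evs r l -
        \sum_(be <- S) c be * (mono l (gam be) * evs (g (alp be)) l).
      apply: csumE; move: h; congr is_csum; apply/funext => al.
      by rewrite /c' -mulr_suml; ring.
    by ring.
  apply: (le_trans (nm_sum _ _ _)).
  apply: (@le_trans _ _ (\sum_(be <- S) nm (c be * (W be)%:C%C) * (kap * lead_sum l))).
    rewrite big_seq [leRHS]big_seq; apply: ler_sum => be beS; have Ebe := SE _ beS.
    rewrite !nmM nm_real gtr0_norm// -mulrA ler_wpM2l ?nm_ge0//.
    have aF := alpF Ebe; rewrite (WE _ beS).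
    (* The cofactor has weight W be / W (alp be), at most kap W be by the choice of [kap]. *)
    apply: (@le_trans _ _ (W (gam be) * lead_sum l)); last first.
      rewrite mulrA; apply: ler_wpM2r.
        by rewrite sumr_ge0// => *; exact: nm_ge0.
      by rewrite -[leLHS]mulr1 -mulrA ler_wpM2l ?(ltW (W_gt0 _))// mulrC kapW.
    apply: ler_pM; rewrite ?nm_ge0 ?lW// /lead_sum (perm_big _ (perm_to_rem aF)).
    by rewrite big_cons lerDl sumr_ge0// => *; exact: nm_ge0.
  rewrite -mulr_suml [leRHS]mulrAC [leRHS]mulrC.
  apply: ler_wpM2r; last exact: cB.
  by rewrite mulr_ge0// sumr_ge0// => *; exact: nm_ge0.
Qed.

(** Iterating [division_step] halves the norm of what is left. The partial remainders add up to [r],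
    and the geometric series B 2^-n accounts for both factors 2. *)
Lemma division c B : 0 < B -> wle c B ->
  exists r, [/\ wle r (2 * B), forall al, E al -> r al = 0 &
    forall l, size l = m -> wdom l ->
      nm (evs c l - evs r l) <= 2 * kap * B * lead_sum l].
Proof.
move=> B0 cB.
have /choice[f hf] : forall p : (T -> R[i]) * R, exists q : (T -> R[i]) * (T -> R[i]),
    0 < p.2 -> wle p.1 p.2 -> [/\ wle q.1 (p.2 / 2), wle q.2 p.2,
    forall al, E al -> q.2 al = 0 & forall l, size l = m -> wdom l ->
      nm (evs p.1 l - evs q.2 l - evs q.1 l) <= kap * p.2 * lead_sum l].
  move=> [c0 B1] /=; have [[B10 cB1]|n] := pselect (0 < B1 /\ wle c0 B1).
    by have [c' [r hr]] := division_step B10 cB1; exists (c', r).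
  by exists (c0, c0) => B10 cB1; case: n.
pose Bn n := B * 2^-1 ^+ n.
have Bn0 n : 0 < Bn n by rewrite mulr_gt0// exprn_gt0// invr_gt0.
have BnS n : Bn n.+1 = Bn n / 2 by rewrite /Bn exprSr mulrA.
pose cs := fix cs n := if n is n'.+1 then (f (cs n', Bn n')).1 else c.
pose rs n := (f (cs n, Bn n)).2.
have csB n : wle (cs n) (Bn n).
  elim: n => [|n IH]; first by rewrite /Bn expr0 mulr1.
  by rewrite BnS; have [] := hf (cs n, Bn n) (Bn0 n) IH.
have rsB n : wle (rs n) (Bn n) by have [] := hf (cs n, Bn n) (Bn0 n) (csB n).
have rsE n al : E al -> rs n al = 0.
  by have [_ _ h _] := hf (cs n, Bn n) (Bn0 n) (csB n); exact: h.
have rsl n l : size l = m -> wdom l ->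
    nm (evs (cs n) l - evs (rs n) l - evs (cs n.+1) l) <= kap * Bn n * lead_sum l.
  by have [_ _ _] := hf (cs n, Bn n) (Bn0 n) (csB n); apply.
have half : 0 <= 2^-1 :> R /\ 2^-1 < 1 :> R by split; lra.
have sumBn s : uniq s -> \sum_(n <- s) Bn n <= 2 * B.
  case: half => h0 h1 us; apply: le_trans (sum_geom_le h0 h1 (ltW B0) us) _.
  by rewrite ler_pdivrMr; lra.
(* Absolute summability over pairs of step and exponent gives the norm of [r] and lets evaluation be
   exchanged with the sum over the steps. *)
pose u (p : nat * T) := rs p.1 p.2 * (W p.2)%:C%C.
have uB : asum_le u (2 * B) by apply: asum_le_pair sumBn => n; exact: rsB.
pose r al := csum (fun n => rs n al).
have rP al : is_csum (fun n => rs n al) (r al).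
  have W0 : (W al)%:C%C != 0 :> R[i] by rewrite -nm_gt0 nm_real gtr0_norm.
  have := csumP (asum_le_slice al (asum_le_swap uB)).
  move=> /(is_csumZ ((W al)%:C%C^-1)) /=.
  under [X in is_csum X]eq_fun do rewrite /u /= mulrCA mulVf// mulr1.
  by move=> h; rewrite /r (csumE h).
exists r; split.
- apply: asum_le_dom (asum_le_iter (asum_le_swap uB)) => al /=.
  rewrite le_eqVlt; apply/orP; left; apply/eqP; congr nm; apply/esym/csumE.
  have := is_csumZ (W al)%:C%C (rP al); rewrite [_ * r al]mulrC; congr is_csum.
  by apply/funext => n; rewrite /u mulrC.
- move=> al Eal; apply: csumE; under [X in is_csum X]eq_fun do rewrite rsE//.
  exact: is_csum0.
move=> l sl lW.
pose v (p : nat * T) := rs p.1 p.2 * mono l p.2.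
have vB : asum_le v (2 * B).
  apply: asum_le_dom uB => -[n al]; rewrite /u /v /= !nmM nm_real gtr0_norm//.
  by rewrite ler_wpM2l ?nm_ge0.
have hr : is_csum (fun n => evs (rs n) l) (evs r l).
  have := csum_iter vB; congr is_csum; rewrite -(csumE (csum_iter vB)) (csum_swap vB).
  congr csum; apply/funext => al; apply: csumE.
  have := is_csumZ (mono l al) (rP al); rewrite [_ * r al]mulrC; congr is_csum.
  by apply/funext => n; rewrite /v mulrC.
have ls0 : 0 <= lead_sum l by rewrite sumr_ge0// => *; exact: nm_ge0.
apply/ler_addgt0Pr => e e0.
have [N hN] := is_csum_partial hr (e := e / 2) ltac:(lra).
have [N' hN'] := @expr_small R 2^-1 B (e / 2) half.1 half.2 ltac:(lra).
pose n := maxn N N'.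
have h1 := hN n (leq_maxl _ _); have h2 := hN' n (leq_maxr _ _).
have h3 : nm (evs (cs n) l) <= e / 2.
  by apply: le_trans h2; exact: is_csum_le (wle_mono lW (csB n)) (evsP lW (csB n)).
have -> : evs c l - evs r l = (\sum_(k < n) (evs (cs k) l - evs (rs k) l - evs (cs k.+1) l) +
    evs (cs n) l) + (\sum_(k < n) evs (rs k) l - evs r l).
  elim: (n) => [|k IH]; first by rewrite !big_ord0 /= add0r sub0r.
  by rewrite IH !big_ord_recr /=; ring.
apply: (le_trans (nmD _ _)); rewrite (_ : _ + e = (2 * kap * B * lead_sum l + e / 2) + e / 2).
  apply: lerD => //; apply: (le_trans (nmD _ _)); apply: lerD => //.
  apply: (le_trans (nm_sum _ _ _)).
  apply: (@le_trans _ _ (\sum_(k < n) Bn k * (kap * lead_sum l))).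
    by apply: ler_sum => k _; rewrite [leRHS]mulrCA mulrA; exact: rsl.
  rewrite -mulr_suml (_ : 2 * kap * B * _ = 2 * B * (kap * lead_sum l)); last by ring.
  rewrite ler_wpM2r ?mulr_ge0//; have := sumBn (index_iota 0 n) (iota_uniq _ _).
  by rewrite big_mkord.
by field.
Qed.

End Division.

(** * Weights for which the lexicographically least term dominates *)

Section Weights.
Variable R : realType.
Variable m : nat.
Local Notation T := (m.-tuple nat).
Implicit Types (al be : T) (l : seq R[i]) (c : T -> R[i]) (t q B : R).

Definition wt K t al : R := t ^+ wdeg K al.

Lemma wt_gt0 K t al : 0 < t -> 0 < wt K t al.
Proof. exact: exprn_gt0. Qed.

Lemma wt_add K t al be : wt K t (addT al be) = wt K t al * wt K t be.
Proof. by rewrite /wt -exprD wdeg_adds// !size_tuple. Qed.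

(** The weight degree is at most K^m times the total degree, and t <= 1. *)
Lemma wdom_polyd K t l : (0 < K)%N -> 0 < t -> t <= 1 -> size l = m ->
  polyd (t ^+ (K ^ m)) l -> wdom (wt K t) l.
Proof.
move=> K0 t0 t1 sl lt al; have y0 : 0 <= t ^+ (K ^ m) by rewrite exprn_ge0// ltW.
apply: le_trans (nm_mono_le (y := t ^+ (K ^ m)) _ y0 _) _.
- by rewrite sl size_tuple.
- by apply: sub_all lt => z /ltW.
rewrite -exprM; apply: ler_wiXn2l => //; first exact: ltW.
by apply: leq_trans (wdeg_le al K0) _; rewrite size_tuple.
Qed.

Lemma wle_geom K t q B c : (0 < K)%N -> 0 < t -> t <= 1 -> 0 <= q -> q * t <= 1 / 2 ->
  (forall al, nm (c al) <= B * q ^+ sumn al) -> wle (wt K t) c (B * 2 ^+ m).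
Proof.
move=> K0 t0 t1 q0 qt hc.
have := @asum_le_tuple_geom R m (fun al => c al * (wt K t al)%:C%C) B (1 / 2).
rewrite (_ : (1 - 1 / 2)^-1 = 2); last by field.
apply=> [||al]; [lra|lra|].
rewrite nmM nm_real gtr0_norm ?wt_gt0//.
have B0 : 0 <= B * q ^+ sumn al by apply: le_trans (hc al); exact: nm_ge0.
apply: (@le_trans _ _ (B * q ^+ sumn al * t ^+ sumn al)).
  apply: ler_pM; rewrite ?nm_ge0 ?hc//; first exact/ltW/wt_gt0.
  by apply: ler_wiXn2l; rewrite ?(ltW t0)//; exact: wdeg_ge.
rewrite -mulrA -exprMn; have [s0|s0] := eqVneq (sumn al) 0%N.
  by rewrite s0 !expr0 lexx.
apply: ler_wpM2l.
  by have := hc [tuple of nseq m 0%N]; rewrite /= sumn_nseq mul0n expr0 mulr1;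
    apply: le_trans; exact: nm_ge0.
by apply: lerXn2r; rewrite ?nnegrE ?mulr_ge0// ?ltW//; lra.
Qed.

(** The non-leading terms of [c] come lexicographically after [al] and so have weight degree at
    least D + 1. Lowering the parameter from [t0] to [t] multiplies their norm by at most (t /
    t0)^(D+1), whereas the leading monomial weighs t^D; a small [t] makes up for the constants. *)
Lemma lead_small K q B c al : (0 < K)%N -> 0 < q ->
  (forall be, nm (c be) <= B * q ^+ sumn be) ->
  all (fun a => a < K)%N al -> c al = 1 ->
  (forall be, lexlt be al -> c be = 0) ->
  exists2 t1 : R, 0 < t1 & forall t, 0 < t -> t <= t1 ->
    wle (wt K t) (fun be => c be - (be == al)%:R) (wt K t al / 4).
Proof.
move=> K0 q0 hc alK cal clt.
pose t0 := Num.min 1 (1 / 2 / q); pose S := B * 2 ^+ m.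
have t00 : 0 < t0 by rewrite lt_min ltr01 divr_gt0.
have [t01 t0q] : t0 <= 1 /\ q * t0 <= 1 / 2.
  by rewrite mulrC -ler_pdivlMr// !ge_min !lexx orbT.
have cS : wle (wt K t0) c S by apply: wle_geom hc => //; exact: ltW.
have S0 := asum_le_ge0 cS; pose D := wdeg K al.
exists (Num.min t0 (t0 ^+ D.+1 / (4 * (S + 1)))) => [|t tp].
  by rewrite lt_min t00 divr_gt0 ?exprn_gt0//; lra.
rewrite le_min => /andP[tt0 tS].
have x0 : 0 <= t / t0 by rewrite divr_ge0// ltW.
have x1 : t / t0 <= 1 by rewrite ler_pdivrMr// mul1r.
apply: (@asum_leW _ _ _ (nm ((t / t0) ^+ D.+1)%:C%C * S)).
  rewrite nm_real ger0_norm ?exprn_ge0// /wt -/D.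
  move: tS; rewrite ler_pdivlMr; last lra.
  have tD : 0 <= t ^+ D by rewrite exprn_ge0// ltW.
  rewrite expr_div_n mulrAC ler_pdivrMr ?exprn_gt0// => tS.
  rewrite [t ^+ D.+1]exprSr -[leLHS]mulrA -[leRHS]mulrA ler_wpM2l//.
  by lra.
apply: asum_le_dom (asum_leZ ((t / t0) ^+ D.+1)%:C%C cS) => be.
have [ab|nab] := boolP (lexlt al be); last first.
  have -> : c be - (be == al)%:R = 0.
    have [->|ne] := eqVneq be al; first by rewrite cal subrr.
    have := @lexlt_total be al; rewrite !size_tuple => /(_ erefl).
    rewrite (inj_eq val_inj) ne (negbTE nab) orbF => /(_ isT) ba.
    by rewrite clt// subr0.
  by rewrite mul0r nm0 nm_ge0.
have lt_ab : (D < wdeg K be)%N by apply: wdeg_lexlt => //; rewrite !size_tuple.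
have ne : (be == al) = false.
  by apply/negP => /eqP e; rewrite e ltnn in lt_ab.
rewrite ne subr0 !nmM !nm_real mulrCA ler_wpM2l ?nm_ge0//.
rewrite !ger0_norm ?exprn_ge0 ?(ltW t00) ?(ltW tp)// /wt.
rewrite -[t in t ^+ wdeg _ _](@divfK _ t0) ?gt_eqF// exprMn.
by rewrite ler_wpM2r ?exprn_ge0 ?(ltW t00)//; exact: ler_wiXn2l.
Qed.

End Weights.

(** * Domination of all coefficients by finitely many *)

Section Bautin.
Variable R : realType.
Variable m : nat.
Local Notation T := (m.-tuple nat).
Implicit Types (al be : T) (l : seq R[i]) (c : T -> R[i]).
Variables (a : nat -> T -> R[i]) (B0 q0 : R).
Hypotheses (q0_gt0 : 0 < q0) (a_le : forall k al, nm (a k al) <= B0 * q0 ^+ sumn al).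

Definition dominated (phi : seq R[i] -> R) := exists N C d, [/\ 0 < d, 0 <= C &
  forall l, size l = m -> polyd d l -> phi l <= C * \sum_(j < N) nm (evs (a j) l)].

Lemma polyd_min d d' l : polyd (Num.min d d') l -> polyd d l /\ polyd d' l.
Proof.
by move=> h; split; apply: sub_all h => z; rewrite lt_min => /andP[].
Qed.

Lemma dominated_le phi psi d : 0 < d ->
  (forall l, size l = m -> polyd d l -> phi l <= psi l) ->
  dominated psi -> dominated phi.
Proof.
move=> d0 h [N [C [d' [d'0 C0 hC]]]]; exists N, C, (Num.min d d').
split=> // [|l sl /polyd_min[ld ld']]; first by rewrite lt_min d0.
by apply: le_trans (h l sl ld) _; exact: hC.
Qed.

Lemma dominatedD phi psi : dominated phi -> dominated psi ->
  dominated (fun l => phi l + psi l).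
Proof.
move=> [N [C [d [d0 C0 hC]]]] [N' [C' [d' [d'0 C'0 hC']]]].
exists (maxn N N'), (C + C'), (Num.min d d'); split; first by rewrite lt_min d0.
  exact: addr_ge0.
move=> l sl /polyd_min[ld ld']; rewrite mulrDl.
have mon n n' : (n <= n')%N ->
    \sum_(j < n) nm (evs (a j) l) <= \sum_(j < n') nm (evs (a j) l).
  move=> nn'; rewrite -!(big_mkord xpredT (fun j => nm (evs (a j) l))).
  by rewrite [leRHS](big_cat_nat (n := n))//= lerDl sumr_ge0// => *; exact: nm_ge0.
apply: lerD.
  apply: le_trans (hC l sl ld) _; rewrite ler_wpM2l// mon// leq_maxl//.
by apply: le_trans (hC' l sl ld') _; rewrite ler_wpM2l// mon// leq_maxr.
Qed.

Lemma dominatedZ x phi : 0 <= x -> dominated phi -> dominated (fun l => x * phi l).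
Proof.
move=> x0 [N [C [d [d0 C0 hC]]]]; exists N, (x * C), d; split=> // [|l sl ld].
  exact: mulr_ge0.
by rewrite -mulrA ler_wpM2l// hC.
Qed.

Lemma dominated_sum (I : eqType) (s : seq I) (phi : I -> seq R[i] -> R) :
  (forall i, i \in s -> dominated (phi i)) -> dominated (fun l => \sum_(i <- s) phi i l).
Proof.
elim: s => [|i s IH] h.
  by exists 0%N, 0, 1; split=> // l _ _; rewrite big_nil mul0r.
apply: (@dominated_le _ (fun l => phi i l + \sum_(j <- s) phi j l) 1) => //.
  by move=> l _ _; rewrite big_cons.
apply: dominatedD; first by apply: h; rewrite inE eqxx.
by apply: IH => j js; apply: h; rewrite inE js orbT.
Qed.

Lemma dominated_coef k : dominated (fun l => nm (evs (a k) l)).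
Proof.
exists k.+1, 1, 1; split=> // l _ _; rewrite mul1r big_ord_recr/= lerDr.
by rewrite sumr_ge0// => *; exact: nm_ge0.
Qed.

(** This growth condition stands in for membership in the ideal of the [a j]: it is weaker than
    algebraic membership, and it is inherited by remainders of division through the triangle
    inequality. *)
Definition in_ideal c := (exists B q, 0 < q /\ forall al, nm (c al) <= B * q ^+ sumn al) /\
  dominated (fun l => nm (evs c l)).

Definition lead_exp al := exists c, [/\ in_ideal c, c al = 1 &
  forall be, lexlt be al -> c be = 0].

Lemma mem_le_sumn (s : seq nat) x : x \in s -> (x <= sumn s)%N.
Proof.
elim: s => [//|y s IH]; rewrite inE => /orP[/eqP ->|/IH h] /=; first exact: leq_addr.
by rewrite (leq_trans h)// leq_addl.
Qed.

Lemma in_idealZ x c : in_ideal c -> in_ideal (fun al => x * c al).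
Proof.
move=> [[B [q [qp hB]]] hd]; split.
  exists (nm x * B), q; split=> // al; rewrite nmM -mulrA ler_wpM2l ?nm_ge0//.
have := dominatedZ (nm_ge0 x) hd.
pose d := Num.min 1 (1 / 2 / q).
have d0 : 0 < d by rewrite lt_min ltr01 divr_gt0.
apply: (dominated_le d0) => l sl ld; rewrite -nmM.
rewrite le_eqVlt; apply/orP; left; apply/eqP; congr nm; apply: csumE.
have [||y [y0 y1 ly]] := @polyd_le R (1 / 2 / q) l; first by rewrite divr_gt0.
  by apply: sub_all ld => z; rewrite lt_min => /andP[].
have ly' : all (fun z => nm z <= 1 / 2 / q) l.
  apply: sub_all ly => z /le_trans; apply; rewrite ler_piMl// ?ltW// divr_gt0//.
have h2 : (0 <= 1 / 2 :> R) /\ (1 / 2 < 1 :> R) by split; lra.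
have := is_csumZ x (csumP (asum_le_polyd qp sl h2.1 h2.2 ly' hB)).
by congr is_csum; apply/funext => al; rewrite mulrA.
Qed.

(** Otherwise the lexicographically least exponent of [c], with [c] scaled to have coefficient 1
    there, would be a leading exponent. *)
Lemma in_ideal_eq0 c : in_ideal c -> (forall al, lead_exp al -> c al = 0) ->
  forall al, c al = 0.
Proof.
move=> hc c0 al; apply/eqP/negPn/negP => cal.
have [|s [sm [be [bes cbe]] hs]] := @lexlt_min m (fun s => exists be : T,
    tval be = s /\ c be != 0); first by exists (tval al); [rewrite size_tuple|exists al].
suff /c0 e : lead_exp be by rewrite e eqxx in cbe.
exists (fun ga => (c be)^-1 * c ga); split; [exact: in_idealZ|by rewrite mulVf|].
move=> ga gb; apply/eqP; rewrite mulf_eq0; apply/orP; right.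
apply/negPn/negP => cga; apply: (hs (tval ga)); rewrite ?size_tuple -?bes//.
by exists ga.
Qed.

Lemma exists_small (I : eqType) (s : seq I) (P : I -> R -> Prop) :
  (forall i, i \in s -> exists2 t1 : R, 0 < t1 & forall t, 0 < t -> t <= t1 -> P i t) ->
  exists2 t1 : R, 0 < t1 & forall t, 0 < t -> t <= t1 -> forall i, i \in s -> P i t.
Proof.
elim: s => [|i s IH] h; first by exists 1.
have [t1 t10 h1] := h i (mem_head _ _).
have [|t2 t20 h2] := IH; first by move=> j js; apply: h; rewrite inE js orbT.
exists (Num.min t1 t2) => [|t tp]; first by rewrite lt_min t10.
rewrite le_min => /andP[tt1 tt2] j; rewrite inE => /orP[/eqP ->|js]; first exact: h1.
exact: h2.
Qed.

(* By division, [a k] differs from a combination of the generators by a series without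
   exponents in [lead_exp]; this series lies in the ideal, hence vanishes. *)
Theorem bautin : exists N C d, [/\ 0 < d, 0 <= C & forall k l, size l = m -> polyd d l ->
  nm (evs (a k) l) <= C * \sum_(j < N) nm (evs (a j) l)].
Proof.
have [F' [F'1 F'2]] := @dickson m (fun s => exists al : T, tval al = s /\ lead_exp al).
pose F : seq T := pmap insub F'.
have FE al : al \in F -> lead_exp al.
  rewrite mem_pmap_sub => /F'1[_ [be [bea hbe]]].
  by have -> : al = be by exact/esym/val_inj.
have /choice[g hg] : forall al, exists c, al \in F -> [/\ in_ideal c, c al = 1 &
    forall be, lexlt be al -> c be = 0].
  move=> al; have [/FE[c hc]|] := boolP (al \in F); first by exists c.
  by exists (fun=> 0).
have /choice[alp halp] : forall be, exists al, lead_exp be -> al \in F /\ all2 leq al be.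
  move=> be; have [Ebe|] := pselect (lead_exp be); last by exists be.
  have [||s sF sbe] := F'2 (tval be); rewrite ?size_tuple//; first by exists be.
  have sm : size s == m by apply/eqP; case: (F'1 s sF).
  by exists (Tuple sm) => _; rewrite mem_pmap_sub.
pose gam be := subT be (alp be).
(* The base exceeds every entry of every generator exponent, as [wdeg_lexlt] requires of the smaller
   tuple. *)
pose K := (\max_(al <- F) sumn al).+1.
have FK al : al \in F -> all (fun x => x < K)%N al.
  move=> alF; apply/allP => x /mem_le_sumn/leq_trans; apply; rewrite ?ltnS.
  exact: (@leq_bigmax_seq _ _ xpredT (fun al : T => sumn al) al alF isT).
have [t1 t10 ht1] : exists2 t1 : R, 0 < t1 & forall t, 0 < t -> t <= t1 ->
    forall al, al \in F -> wle (wt K t) (fun be => g al be - (be == al)%:R) (wt K t al / 4).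
  apply: exists_small => al alF; have [[[B [q [qp hB]]] _] g1 g0] := hg al alF.
  by apply: lead_small hB _ _ _ => //; exact: FK.
pose t := Num.min t1 (Num.min 1 (1 / 2 / q0)).
have t0 : 0 < t by rewrite !lt_min t10 ltr01 divr_gt0.
have [tt1 t_1 tq] : [/\ t <= t1, t <= 1 & q0 * t <= 1 / 2].
  by rewrite mulrC -ler_pdivlMr// !ge_min !lexx !orbT.
have aB k : wle (wt K t) (a k) (B0 * 2 ^+ m) by apply: wle_geom (a_le k) => //; exact: ltW.
pose B := B0 * 2 ^+ m + 1.
have Bp : 0 < B by have := asum_le_ge0 (aB 0%N); rewrite /B; lra.
(* The sum bounds every single inverse weight, and [F] is finite. *)
pose kap := \sum_(al <- F) (wt K t al)^-1.
have wV0 al : 0 <= (wt K t al)^-1 by rewrite invr_ge0 ltW// wt_gt0.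
have kap0 : 0 <= kap by rewrite sumr_ge0.
have kapW al : al \in F -> 1 <= kap * wt K t al.
  move=> alF; rewrite -ler_pdivrMr ?wt_gt0// mul1r /kap.
  by rewrite (perm_big _ (perm_to_rem alF)) big_cons lerDl sumr_ge0.
pose d := t ^+ (K ^ m).
have dp : 0 < d by rewrite exprn_gt0.
have wd l : size l = m -> polyd d l -> @wdom R m (wt K t) l.
  by move=> sl ld; exact: wdom_polyd ld.
have aB' k : wle (wt K t) (a k) B.
  by apply: asum_leW (aB k); rewrite /B; lra.
have div k : exists r : T -> R[i], [/\ wle (wt K t) r (2 * B),
    forall al, lead_exp al -> r al = 0 &
    forall l, size l = m -> @wdom R m (wt K t) l ->
      nm (evs (a k) l - evs r l) <= 2 * kap * B * lead_sum F g l].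
  apply: (@division R m (wt K t) _ _ lead_exp F alp gam g kap _ _ _ _ _ (a k) B) => //.
  - by move=> al; exact: wt_gt0.
  - exact: wt_add.
  - by move=> be /halp[].
  - by move=> be /halp[_ h]; exact: subTK.
  - exact: ht1.
have lsd : dominated (lead_sum F g).
  by apply: dominated_sum => al alF; have [[_ h] _ _] := hg al alF.
have key k l : size l = m -> polyd d l ->
    nm (evs (a k) l) <= 2 * kap * B * lead_sum F g l.
  move=> sl ld; have [r [rB rE rl]] := div k.
  (* The norm bound on [r] gives geometric coefficient bounds, and |r| is at most |a k| plus a
     multiple of [lead_sum]. This domination involves [k] through its number of terms, which does no
     harm: [r] vanishes, and the final constants come from the generators alone. *)
  have r0 : forall al, r al = 0.
    apply: in_ideal_eq0 => //; split.
      exists (2 * B), (t^-1 ^+ (K ^ m)); split; first by rewrite exprn_gt0// invr_gt0.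
      move=> al; have := asum_le_pt al rB; rewrite nmM nm_real gtr0_norm ?wt_gt0//.
      rewrite -ler_pdivlMr ?wt_gt0// => /le_trans; apply.
      rewrite ler_wpM2l ?mulr_ge0// ?(ltW Bp)// /wt -exprVn -exprM.
      apply: ler_weXn2l; first by rewrite invf_ge1.
      by have := @wdeg_le K al (ltn0Sn _); rewrite size_tuple.
    apply: (@dominated_le _ (fun l => nm (evs (a k) l) + 2 * kap * B * lead_sum F g l) d) => //.
      move=> l' sl' ld'; have := rl l' sl' (wd l' sl' ld').
      have := ler_dist_nm (evs r l') (evs (a k) l'); rewrite [nm (evs r _ - _)]nmBC; lra.
    apply: dominatedD; first exact: dominated_coef.
    by apply: dominatedZ => //; rewrite !mulr_ge0// ltW.
  have := rl l sl (wd l sl ld).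
  rewrite [evs r l](_ : _ = 0) ?subr0//; apply: csumE.
  by under [X in is_csum X]eq_fun do rewrite r0 mul0r; exact: is_csum0.
have [N [C [d' [d'0 C0 hC]]]] := lsd.
have kB : 0 <= 2 * kap * B by rewrite !mulr_ge0// ltW.
exists N, (2 * kap * B * C), (Num.min d d'); split; first by rewrite lt_min dp.
  exact: mulr_ge0.
move=> k l sl /polyd_min[ld ld']; apply: (le_trans (key k l sl ld)).
by rewrite -[leRHS]mulrA ler_wpM2l// hC.
Qed.

End Bautin.

(** * Expansion along lines *)

Section Differentiability.
Variable R : realType.
Variable n : nat.
Implicit Types (x y v : 'rV[R[i]]_n) (z w : R[i]) (f : 'rV[R[i]]_n -> R[i]).

Lemma normCE z : `|z| = (nm z)%:C%C.
Proof. by case: z. Qed.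

Lemma pos_complex (e : R[i]) : 0 < e -> 0 < Re e /\ e = (Re e)%:C%C.
Proof. by case: e => a b; rewrite ltcE /= => /andP[/eqP -> a0]. Qed.

Lemma cdiff_line f (phi : R[i] -> 'rV[R[i]]_n) z v :
  (forall w, phi (z + w) = phi z + w *: v) ->
  differentiable f (phi z) -> cdiff (fun w => f (phi w)) z.
Proof.
move=> hphi df.
have /cvg_ex[/= l /cvgrPdist_le hl] := @diff_derivable _ _ _ _ _ v df.
exists l => e e0; have : 0 < e%:C%C :> R[i] by rewrite ltcR.
move=> /hl; rewrite near_withinE => /nbhs_ballP[/= d /pos_complex[d0 ->] hd].
exists (Re d) => // w wd.
have [->|w0] := eqVneq w 0; first by rewrite addr0 subrr mulr0 subrr nm0 mulr0.
have := hd w; rewrite -ball_normE /= sub0r normrN normCE ltcR => /(_ wd w0).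
rewrite normCE lecR hphi [_ + phi z]addrC => hw.
rewrite (_ : _ - _ = w * (w^-1 * (f (phi z + w *: v) - f (phi z)) - l)); last by field.
by rewrite nmM nmBC mulrC ler_wpM2r ?nm_ge0.
Qed.

Lemma differentiable_bounded f x : differentiable f x ->
  exists2 d : R, 0 < d & forall y : 'rV[R[i]]_n, (forall j, nm (y 0 j - x 0 j) < d) ->
    nm (f y) <= nm (f x) + 1.
Proof.
move=> /differentiable_continuous/cvgrPdist_le/(_ 1 ltr01).
move=> /nbhs_ballP[/= d /pos_complex[d0 dE] hd]; exists (Re d) => // y hy.
have := hd y; rewrite /= => /(_ _)/wrap[].
  rewrite dE; split=> [|i j]; first by rewrite ltcR.
  by rewrite ord1 -ball_normE /= normCE ltcR nmBC.
rewrite -[1]/((1 : R)%:C%C) normCE lecR nmBC => h.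
by have := ler_dist_nm (f y) (f x); lra.
Qed.

Lemma enorm_ge0 x : 0 <= enorm x.
Proof. exact: sqrtr_ge0. Qed.

Lemma nm_le_enorm x j : nm (x 0 j) <= enorm x.
Proof.
rewrite -[leLHS]ger0_norm ?nm_ge0// -sqrtr_sqr /enorm ler_wsqrtr//.
by rewrite (bigD1 j)//= lerDl sumr_ge0// => k _; exact: sqr_ge0.
Qed.

(** With the l^1 norm for the second summand, |x_j| <= [enorm x] replaces the Cauchy-Schwarz
    inequality. *)
Lemma enormD_le x y : enorm (x + y) <= enorm x + \sum_j nm (y 0 j).
Proof.
have s0 : 0 <= \sum_j nm (y 0 j) by rewrite sumr_ge0// => *; exact: nm_ge0.
rewrite -(ler_pXn2r (_ : 0 < 2)%N)//; last 2 first.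
- by rewrite nnegrE enorm_ge0.
- by rewrite nnegrE addr_ge0 ?enorm_ge0.
have sq u : 0 <= \sum_(j < n) nm ((u : 'rV[R[i]]_n) 0 j) ^+ 2.
  by rewrite sumr_ge0// => *; exact: sqr_ge0.
rewrite [leLHS]sqr_sqrtr ?sq//.
apply: (@le_trans _ _ (\sum_j (nm (x 0 j) ^+ 2 + 2 * enorm x * nm (y 0 j) +
    nm (y 0 j) * \sum_k nm (y 0 k)))).
  apply: ler_sum => j _; rewrite mxE.
  have yj : nm (y 0 j) <= \sum_k nm (y 0 k).
    by rewrite (bigD1 j)//= lerDl sumr_ge0// => *; exact: nm_ge0.
  have := nmD (x 0 j) (y 0 j); have := nm_le_enorm x j.
  have := nm_ge0 (x 0 j); have := nm_ge0 (y 0 j); have := nm_ge0 (x 0 j + y 0 j).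
  rewrite !expr2; nra.
rewrite !big_split/= -mulr_sumr -mulr_suml.
have -> : \sum_(j < n) nm (x 0 j) ^+ 2 = enorm x ^+ 2 by rewrite sqr_sqrtr ?sq.
by rewrite le_eqVlt; apply/orP; left; apply/eqP; ring.
Qed.

End Differentiability.

(** * Points on lines as a function of 2n + 1 variables *)

Section LineSeries.
Variable R : realType.
Variable n : nat.
Implicit Types (x y v : 'rV[R[i]]_n) (z w : R[i]) (f : 'rV[R[i]]_n -> R[i]).
Implicit Types (l : seq R[i]) (h : seq R[i] -> R[i]).

Lemma sephol_coordwise r m h :
  (forall l, size l = m -> polyd r l -> forall i, (i < m)%N ->
     cdiff (fun w => h (set_nth 0 l i w)) (nth 0 l i)) ->
  sephol r m h.
Proof.
elim: m h => [//|m IH] h hc; split=> [z zr|l sl lr z zr].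
  apply: IH => l sl lr i im; apply: (hc (z :: l) _ _ i.+1) => //=; first by rewrite sl.
  by rewrite zr.
by apply: (hc (z :: l) _ _ 0%N) => //=; rewrite ?sl ?zr.
Qed.

(* The list [z :: xi ++ w] of length [n + n + 1] encodes the point
   [x + xi + z (v + w)]: the parameter on the line, the shift of the base point and the
   shift of the direction. *)
Definition pencil x v l : 'rV[R[i]]_n :=
  \row_j (x 0 j + nth 0 l j.+1 + nth 0 l 0 * (v 0 j + nth 0 l (j.+1 + n))).

(** The point is affine in each single entry of [l], though not in all of them jointly; this reduces
    separate holomorphy to [cdiff_line]. *)
Lemma pencil_dir x v l i : exists u, forall w w',
  pencil x v (set_nth 0 l i (w + w')) = pencil x v (set_nth 0 l i w) + w' *: u.
Proof.
exists (\row_j ((i == j.+1)%:R + (i == 0%N)%:R * (v 0 j + nth 0 l (j.+1 + n)) +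
   nth 0 l 0 * (i == (j.+1 + n)%N)%:R)) => w w'.
apply/rowP => j; rewrite !mxE !nth_set_nth /= ![_ == i]eq_sym.
have [->|i0] := eqVneq i 0%N.
  by rewrite /=; ring.
rewrite /= mul0r addr0.
have [->|i1] := eqVneq i j.+1.
  have -> : (j.+1 == j.+1 + n)%N = false.
    by rewrite -[X in X == _]addn0 eqn_add2l; case: (n) j => [[]|].
  by rewrite /=; ring.
by case: eqP => _ /=; ring.
Qed.

Lemma pencil_near x v l (rho : R) j : polyd rho l -> 0 < rho -> rho <= 1 ->
  nm (pencil x v l 0 j - x 0 j) <= rho * (2 + nm (v 0 j)).
Proof.
move=> lr r0 r1.
have nthr i : nm (nth 0 l i) <= rho.
  have [il|il] := ltnP i (size l); last by rewrite nth_default// nm0 ltW.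
  by apply: ltW; exact: (allP lr _ (mem_nth _ il)).
rewrite mxE (_ : _ - x 0 j = nth 0 l j.+1 + nth 0 l 0 * (v 0 j + nth 0 l (j.+1 + n))).
  apply: (le_trans (nmD _ _)); rewrite nmM.
  rewrite (_ : rho * _ = rho + rho * (nm (v 0 j) + 1)); last by ring.
  apply: lerD => //; apply: ler_pM; rewrite ?nm_ge0//.
  by apply: (le_trans (nmD _ _)); rewrite lerD2l (le_trans (nthr _)).
by ring.
Qed.

Lemma pencil_line x0 v0 x v z :
  pencil x0 v0 (z :: [seq x 0 j - x0 0 j | j <- enum 'I_n] ++
     [seq v 0 j - v0 0 j | j <- enum 'I_n]) = x + z *: v.
Proof.
have szE (g : 'I_n -> R[i]) : size [seq g j | j <- enum 'I_n] = n.
  by rewrite size_map size_enum_ord.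
have nthE (g : 'I_n -> R[i]) (j : 'I_n) : nth 0 [seq g j | j <- enum 'I_n] j = g j.
  by rewrite (nth_map j) ?size_enum_ord// nth_ord_enum.
have := (szE (fun j => x 0 j - x0 0 j), nthE (fun j => x 0 j - x0 0 j)).
have := nthE (fun j => v 0 j - v0 0 j).
move: [seq _ | j <- _] [seq _ | j <- _] => A B hB [sA hA].
apply/rowP => j; rewrite !mxE /= !nth_cat sA ltn_ord ltnNge leq_addl /= addnK.
by rewrite hA hB; ring.
Qed.

End LineSeries.

(** * Coefficient bounds common to all lines meeting the unit ball *)

Section UniformLineBound.
Variable R : realType.
Variable n : nat.
Implicit Types (x v : 'rV[R[i]]_n) (z w : R[i]) (f : 'rV[R[i]]_n -> R[i]).

(** The Taylor coefficients of z |-> f (x + z v) are compared only with each other, so the condition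
    remains meaningful, with all of them 0, on lines where [f] vanishes. *)
Definition line_bound (N : nat) (C rho : R) f x v := exists a : nat -> R[i],
  (forall k, nm (a k) * rho ^+ k <= C * \sum_(j < N) nm (a j)) /\
  forall z, nm z < rho -> is_csum (fun k => a k * z ^+ k) (f (x + z *: v)).

Lemma line_boundW N N' C C' rho rho' f x v : (N <= N')%N -> 0 <= C -> C <= C' ->
  0 <= rho' -> rho' <= rho -> line_bound N C rho f x v -> line_bound N' C' rho' f x v.
Proof.
move=> NN' C0 CC' r0 rr' [a [ha hs]]; exists a; split=> [k|z zr]; last first.
  by apply: hs; exact: lt_le_trans rr'.
apply: (@le_trans _ _ (nm (a k) * rho ^+ k)).
  by rewrite ler_wpM2l ?nm_ge0// lerXn2r// nnegrE (le_trans r0).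
apply: (le_trans (ha k)); apply: ler_pM => //.
  by rewrite sumr_ge0// => *; exact: nm_ge0.
rewrite -!(big_mkord xpredT (fun j => nm (a j))) [leRHS](big_cat_nat (n := N))//=.
by rewrite lerDl sumr_ge0// => *; exact: nm_ge0.
Qed.

Lemma set_nth_same (T : Type) (x0 : T) (s : seq T) i : (i < size s)%N ->
  set_nth x0 s i (nth x0 s i) = s.
Proof. by elim: s i => [//|y s IH] [|i] //= /IH ->. Qed.

Lemma local_line_bound f (r : R) x0 v0 :
  (forall x, enorm x < r -> differentiable f x) -> enorm x0 < r ->
  exists N C rho d, [/\ 0 < rho, rho <= 1, 0 <= C, 0 < d &
    forall x v, (forall j, nm (x 0 j - x0 0 j) < d) ->
      (forall j, nm (v 0 j - v0 0 j) < d) -> line_bound N C rho f x v].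
Proof.
move=> hf x0r; have [d0 d0p hM] := differentiable_bounded (hf x0 x0r).
set M := nm (f x0) + 1 in hM.
(* Each of the n coordinates moves by less than [d1]; the divisor n + 1 keeps the point strictly
   inside the ball of radius [r]. *)
pose d1 := Num.min d0 ((r - enorm x0) / n.+1%:R).
have d1p : 0 < d1 by rewrite lt_min d0p divr_gt0// subr_gt0.
have [d1d0 d1r] : d1 <= d0 /\ n.+1%:R * d1 <= r - enorm x0.
  by rewrite mulrC -ler_pdivlMr// !ge_min !lexx orbT.
pose A := \sum_j nm (v0 0 j).
have A0 : 0 <= A by rewrite sumr_ge0// => *; exact: nm_ge0.
have vA j : nm (v0 0 j) <= A.
  by rewrite /A (bigD1 j)//= lerDl sumr_ge0// => *; exact: nm_ge0.
(* By [pencil_near] a coordinate moves by at most rho (2 + A), strictly less than rho (3 + A) <=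
   d1. *)
pose rho := Num.min 1 (d1 / (3 + A)).
have rho0 : 0 < rho by rewrite lt_min ltr01 divr_gt0//; lra.
have [rho1 rhod] : rho <= 1 /\ rho * (3 + A) <= d1.
  by rewrite -ler_pdivlMr ?ge_min ?lexx ?orbT//; lra.
have near l j : polyd rho l -> nm (pencil x0 v0 l 0 j - x0 0 j) < d1.
  move=> lr; apply: le_lt_trans (pencil_near x0 v0 j lr rho0 rho1) _.
  by have := vA j; nra.
have inball l : polyd rho l -> enorm (pencil x0 v0 l) < r.
  move=> lr; rewrite -(subrK x0 (pencil x0 v0 l)) addrC.
  apply: le_lt_trans (enormD_le _ _) _.
  have : \sum_j nm ((pencil x0 v0 l - x0) 0 j) <= n%:R * d1.
    apply: (@le_trans _ _ (\sum_(j < n) d1)).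
      by apply: ler_sum => j _; rewrite !mxE; have := near l j lr; rewrite !mxE => /ltW.
    by rewrite sumr_const card_ord mulr_natl.
  by move: d1r; rewrite -natr1 mulrDl mul1r; lra.
pose h l := f (pencil x0 v0 l).
have hs : sephol rho (n + n).+1 h.
  apply: sephol_coordwise => l sl lr i im; have [u hu] := pencil_dir x0 v0 l i.
  apply: (cdiff_line (hu _)); rewrite set_nth_same ?sl//; apply: hf; exact: inball.
have [|c [hc csum_h]] := sephol_series (M := M) rho0 hs.
  by move=> l sl lr; apply: hM => j; apply: lt_le_trans (near l j lr) d1d0.
pose rh := rho / 2; pose q := 2 / rho.
have rh0 : 0 < rh by rewrite divr_gt0.
have rh1 : rh <= 1 by rewrite /rh; lra.
have q0 : 0 < q by rewrite divr_gt0.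
have rhq : rh * q = 1 by rewrite /rh /q; field; rewrite gt_eqF.
pose B0 := 8 ^+ (n + n).+1 * M.
(* The factor rh^k cancels the growth q^k of the coefficients of z^k, so that [bautin] applies with
   bounds independent of [k]. *)
pose b k (al : (n + n).-tuple nat) := (rh ^+ k)%:C%C * c (consT (k, al)).
have cB k (al : (n + n).-tuple nat) : nm (c (consT (k, al))) <= B0 * q ^+ k * q ^+ sumn al.
  by apply: le_trans (hc _) _; rewrite /= exprD mulrA.
have bB k al : nm (b k al) <= B0 * q ^+ sumn al.
  have rk : 0 < rh ^+ k by rewrite exprn_gt0.
  rewrite nmM nm_real gtr0_norm// mulrC -ler_pdivlMr//.
  apply: (le_trans (cB k al)); rewrite le_eqVlt; apply/orP; left; apply/eqP.
  have qk : q ^+ k = (rh ^+ k)^-1.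
    by apply: (mulIf (lt0r_neq0 rk)); rewrite -exprMn mulrC rhq expr1n mulVf ?lt0r_neq0.
  by rewrite qk; ring.
have [N [C [d [dp C0 hN]]]] := bautin q0 bB.
(* Here [d] serves [bautin], and [rh] the convergence of the series in the shifts of x and v. *)
exists N, C, rh, (Num.min d rh); split=> //; first by rewrite lt_min dp.
move=> x v hx hv.
pose la := [seq x 0 j - x0 0 j | j <- enum 'I_n] ++ [seq v 0 j - v0 0 j | j <- enum 'I_n].
have sla : size la = (n + n)%N by rewrite size_cat 2!size_map size_enum_ord.
have lad : polyd (Num.min d rh) la.
  rewrite /polyd all_cat !all_map; apply/andP; split; apply/allP => j _ /=.
    exact: hx.
  exact: hv.
have [lad1 lad2] := polyd_min lad.
have [y [y0 y1 ly]] := polyd_le rh0 lad2.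
have yq : y * rh = y / q.
  by apply: (mulIf (lt0r_neq0 q0)); rewrite -mulrA rhq mulr1 divfK ?lt0r_neq0.
rewrite yq in ly.
have hA k := asum_le_polyd q0 sla y0 y1 ly (cB k).
pose a k := csum (fun al : (n + n).-tuple nat => c (consT (k, al)) * mono la al).
have aP k : is_csum (fun al : (n + n).-tuple nat => c (consT (k, al)) * mono la al) (a k).
  exact: csumP (hA k).
have evb k : evs (b k) la = (rh ^+ k)%:C%C * a k.
  apply: csumE; have := is_csumZ (rh ^+ k)%:C%C (aP k); congr is_csum.
  by apply/funext => al; rewrite mulrA.
have nevb k : nm (evs (b k) la) = nm (a k) * rh ^+ k.
  by rewrite evb nmM nm_real ger0_norm 1?mulrC// exprn_ge0// ltW.
exists a; split=> [k|z zr].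
  rewrite -nevb; apply: (le_trans (hN k la sla lad1)); rewrite ler_wpM2l//.
  apply: ler_sum => j _; rewrite nevb ler_piMr ?nm_ge0// exprn_ile1// ltW//.
rewrite -(pencil_line x0 v0) -/la -/(h (z :: la)).
have zla : polyd (rho / 2) (z :: la) by rewrite /= zr.
have /is_csum_consT /is_csum_iter := csum_h (z :: la) (congr1 S sla) zla; apply => k.
have := is_csumZ (z ^+ k) (aP k); rewrite mulrC; congr is_csum.
by apply/funext => al /=; rewrite mulrCA.
Qed.

(** [X] and [V] read a point of the real cube [-1, 1]^(4n) as a base point and a direction;
    compactness of this cube makes the local constants uniform. *)
Theorem uniform_line_bound f (r : R) : 1 < r ->
  (forall x, enorm x < r -> differentiable f x) ->
  exists N C rho, [/\ 0 < rho, rho <= 1, 0 <= C &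
    forall x v, enorm x <= 1 -> (forall j, nm (v 0 j) <= 1) -> line_bound N C rho f x v].
Proof.
move=> r1 hf.
pose X (q : 'rV[R]_((n + n) + (n + n))) : 'rV[R[i]]_n :=
  \row_j Complex (q 0 (lshift (n + n) (lshift n j))) (q 0 (lshift (n + n) (rshift n j))).
pose V (q : 'rV[R]_((n + n) + (n + n))) : 'rV[R[i]]_n :=
  \row_j Complex (q 0 (rshift (n + n) (lshift n j))) (q 0 (rshift (n + n) (rshift n j))).
(* One index replaces the three constants, since [line_bound] weakens as [N] and [C] grow and [rho]
   shrinks. Compactness then yields an [i] valid on the whole cube. *)
pose P (i : nat) q := enorm (X q) <= 1 -> line_bound i i%:R i.+1%:R^-1 f (X q) (V q).
have cB := @rV_compact R ((n + n) + (n + n)) (fun=> `[-1, 1]%classic)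
  (fun=> @segment_compact R (-1) 1).
have near_entry q0 e : 0 < e -> exists2 U, nbhs q0 U & forall q, U q ->
    (forall j, nm (X q 0 j - X q0 0 j) < e) /\ (forall j, nm (V q 0 j - V q0 0 j) < e).
  move=> e0; exists (ball q0 (e / 2)); first by apply: nbhsx_ballx; rewrite divr_gt0.
  move=> q [_ hq].
  have bnd (a b a' b' : R) : ball a (e / 2) a' -> ball b (e / 2) b' ->
      nm (Complex a' b' - Complex a b) < e.
    move=> h1 h2; rewrite -ball_normE /= distrC in h1; rewrite -ball_normE /= distrC in h2.
    by apply: le_lt_trans (nm_le_ReIm _) _ => /=; lra.
  by split=> j; rewrite !mxE; apply: bnd; exact: hq.
have /compact_near_coveringP/(_ nat \oo P _) := cB; case=> [q0 _|N _ hN].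
  have big (x : R) : exists i : nat, x <= i%:R.
    exists (Num.bound `|x|); apply: le_trans (ler_norm _) _.
    by apply: ltW; exact: archi_boundP.
  have [x0r|x0r] := ltP (enorm (X q0)) r; last first.
    (* The cube also contains base points outside the ball. Near one of norm at least [r] the norm
       stays above 1, which falsifies the premise of [P]. *)
    have e0 : 0 < (r - 1) / n.+1%:R by rewrite divr_gt0// subr_gt0.
    have [U Uq hU] := near_entry q0 _ e0.
    exists (U, setT); first by split=> //; exact: filterT.
    move=> [q i] [/= /hU[hX _] _] q1.
    have := enormD_le (X q) (X q0 - X q); rewrite addrC subrK => h.
    have : \sum_j nm ((X q0 - X q) 0 j) <= n%:R * ((r - 1) / n.+1%:R).
      apply: (@le_trans _ _ (\sum_(j < n) ((r - 1) / n.+1%:R))).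
        apply: ler_sum => j _; have := hX j; rewrite nmBC => /ltW.
        by rewrite !mxE.
      by rewrite sumr_const card_ord mulr_natl.
    have : n%:R * ((r - 1) / n.+1%:R) < r - 1.
      rewrite mulrCA -[ltRHS]mulr1 ltr_pM2l ?subr_gt0//.
      by rewrite ltr_pdivrMr// mul1r ltr_nat.
    move=> t1 t2; have := le_trans x0r (le_trans h (lerD q1 t2)).
    by rewrite leNgt -ltrBrDl t1.
  have [N [C [rho [d [rho0 rho1 C0 d0 hloc]]]]] := local_line_bound (V q0) hf x0r.
  have [U Uq hU] := near_entry q0 _ d0.
  have [i1 hi1] := big C; have [i2 hi2] := big rho^-1.
  pose i0 := maxn N (maxn i1 i2).
  exists (U, [set i | (i0 <= i)%N]); first by split=> //; exact: nbhs_infty_ge.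
  move=> [q i] [/= /hU[hX hV] ii0] _.
  have [Ni i1i i2i] : [/\ (N <= i)%N, (i1 <= i)%N & (i2 <= i)%N].
    by move: ii0; rewrite !geq_max => /and3P[].
  apply: line_boundW (hloc _ _ hX hV) => //.
    by apply: (le_trans hi1); rewrite ler_nat.
  rewrite -[leRHS]invrK lef_pV2 ?posrE ?invr_gt0//.
  by apply: (le_trans hi2); rewrite ler_nat leqW.
exists N, N%:R, N.+1%:R^-1; split=> //; first by rewrite invf_le1// ler1n.
move=> x v x1 v1.
pose q : 'rV[R]_((n + n) + (n + n)) :=
  row_mx (row_mx (\row_j Re (x 0 j)) (\row_j Im (x 0 j)))
         (row_mx (\row_j Re (v 0 j)) (\row_j Im (v 0 j))).
have Xq : X q = x.
  apply/rowP => j; rewrite /X mxE /q !(row_mxEl, row_mxEr) !mxE.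
  by case: (x 0 j).
have Vq : V q = v.
  apply/rowP => j; rewrite /V mxE /q !(row_mxEl, row_mxEr) !mxE.
  by case: (v 0 j).
have ReIm (z : R[i]) : nm z <= 1 -> (-1 <= Re z <= 1) /\ (-1 <= Im z <= 1).
  by move=> z1; rewrite -!ler_norml; split; apply: le_trans z1;
    [exact: Re_le_nm|exact: Im_le_nm].
have hx j := ReIm _ (le_trans (nm_le_enorm x j) x1); have hv j := ReIm _ (v1 j).
have := hN N (leqnn N) q; rewrite /P Xq Vq; apply=> // j; rewrite /= in_itv /= /q.
case: (split_ordP j) => k ->; rewrite ?row_mxEl ?row_mxEr;
  case: (split_ordP k) => k' ->; rewrite ?row_mxEl ?row_mxEr mxE.
- exact: (hx k').1.
- exact: (hx k').2.
- exact: (hv k').1.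
- exact: (hv k').2.
Qed.

End UniformLineBound.

(** * Remez inequalities on lines *)

Section DividedDifferences.
Variable R : realType.
Implicit Types (a : nat -> R[i]) (s t : R) (g : R -> R[i]).

Lemma is_csum_cons (u : nat -> R[i]) S : is_csum (fun k => u k.+1) S ->
  is_csum u (u 0%N + S).
Proof.
move=> hS; have h0 : is_csum (fun k => if k is 0 then u 0%N else 0) (u 0%N).
  have := @is_csum_fin _ _ (fun k => if k is 0 then u 0%N else 0) [:: 0%N] isT.
  by rewrite big_seq1; apply=> -[].
have h1 : is_csum (fun k => if k is 0 then 0 else u k) S.
  apply: (@is_csum_reindex _ _ _ succn) => //; first exact: succn_inj.
  by case=> [|k _]; [rewrite eqxx|exists k].
have := is_csumD h0 h1; congr is_csum.
by apply/funext => -[|k]; rewrite ?addr0 ?add0r.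
Qed.

(* [b l] is the sum of the [a (l + p) * s ^ p], so that [g s = b 0] and the
   coefficients of [(g t - g s) / (t - s)] are the [b l.+1]. *)
Lemma quotient_series a (B Q h : R) s t gs gt :
  0 <= Q -> Q * h <= 1 / 2 -> (forall k, nm (a k) <= B * Q ^+ k) ->
  `|s| <= h -> `|t| <= h -> s != t ->
  is_csum (fun k => a k * s%:C%C ^+ k) gs -> is_csum (fun k => a k * t%:C%C ^+ k) gt ->
  exists b : nat -> R[i], [/\ forall l, is_csum (fun p => a (l + p)%N * s%:C%C ^+ p) (b l),
    forall l, b l = a l + s%:C%C * b l.+1, forall l, nm (b l) <= 2 * B * Q ^+ l &
    is_csum (fun l => b l.+1 * t%:C%C ^+ l) ((gt - gs) / (t - s)%:C%C)].
Proof.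
move=> Q0 Qh ha sh th st hgs hgt.
have B0 : 0 <= B by have := le_trans (nm_ge0 _) (ha 0%N); rewrite expr0 mulr1.
have h0 : 0 <= h by apply: le_trans sh; exact: normr_ge0.
have Qh0 : 0 <= Q * h by rewrite mulr_ge0.
have lt1 : Q * h < 1 by lra.
pose b l := csum (fun p => a (l + p)%N * s%:C%C ^+ p).
have asb l : asum_le (fun p => a (l + p)%N * s%:C%C ^+ p) (B * Q ^+ l / (1 - Q * h)).
  apply: asum_le_geom => // p; rewrite nmM nmX nm_real.
  rewrite (_ : _ * _ ^+ p = B * Q ^+ (l + p) * h ^+ p); last first.
    by rewrite exprMn exprD; ring.
  by apply: ler_pM; rewrite ?nm_ge0 ?exprn_ge0// lerXn2r// nnegrE.
have hb l : is_csum (fun p => a (l + p)%N * s%:C%C ^+ p) (b l) by exact: csumP (asb l).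
have bS l : b l = a l + s%:C%C * b l.+1.
  apply: csumE; have := @is_csum_cons (fun p => a (l + p)%N * s%:C%C ^+ p) (s%:C%C * b l.+1).
  rewrite addn0 expr0 mulr1; apply; have := is_csumZ s%:C%C (hb l.+1).
  by congr is_csum; apply/funext => p; rewrite addSnnS exprS mulrCA.
have bB l : nm (b l) <= 2 * B * Q ^+ l.
  apply: le_trans (csum_le (asb l)) _; rewrite ler_pdivrMr; last lra.
  have := mulr_ge0 B0 (exprn_ge0 l Q0); rewrite -mulrA; nra.
exists b; split=> //.
have [S hS] : exists S, is_csum (fun l => b l.+1 * t%:C%C ^+ l) S.
  apply: (@is_csum_ex _ _ _ (2 * B * Q / (1 - Q * h))).
  apply: asum_le_geom => // l; rewrite nmM nmX nm_real.
  rewrite (_ : _ * _ ^+ l = 2 * B * Q ^+ l.+1 * h ^+ l); last first.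
    by rewrite exprMn exprS; ring.
  by apply: ler_pM; rewrite ?nm_ge0 ?exprn_ge0// lerXn2r// nnegrE.
have b0 : b 0%N = gs by apply: is_csum_unique (hb 0%N) hgs.
have h1 : is_csum (fun l => b l * t%:C%C ^+ l) (gs + t%:C%C * S).
  have := @is_csum_cons (fun l => b l * t%:C%C ^+ l) (t%:C%C * S).
  rewrite expr0 mulr1 b0; apply; have := is_csumZ t%:C%C hS; congr is_csum.
  by apply/funext => l; rewrite exprS mulrCA.
have h2 := is_csumD hgt (is_csumZ s%:C%C hS).
have e : gs + t%:C%C * S = gt + s%:C%C * S.
  apply: is_csum_unique h1 _; move: h2; congr is_csum; apply/funext => l.
  by rewrite [b l]bS; ring.
have ts : (t - s)%:C%C != 0 :> R[i].
  by rewrite -nm_eq0 nm_real normr_eq0 subr_eq0 eq_sym.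
suff -> : (gt - gs) / (t - s)%:C%C = S by [].
apply: (mulIf ts); rewrite divfK// (rmorphB (real_complex R)).
have -> : gt = gs + t%:C%C * S - s%:C%C * S by rewrite e; ring.
ring.
Qed.

(** Replacing [g] by its difference quotient at one of the points lowers [j], doubles [A] and
    multiplies [e] by 2 / d. Recovering a (j+1) from the shifted coefficients costs 2 A q h more,
    and 2^(j+2) - 2 solves the recursion x -> 2 x + 2 starting from 2. The bounds [B] and [Q] secure
    convergence only. *)
Lemma divided_difference_bound j a (A B q Q h d e : R) g (pts : seq R) :
  0 <= A -> 0 <= q -> 0 <= Q -> q * h <= 1 / 2 -> Q * h <= 1 / 2 -> 0 < d -> 0 <= e ->
  (forall k, nm (a k) <= B * Q ^+ k) ->
  (forall k, (j < k)%N -> nm (a k) <= A * q ^+ (k - j)) ->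
  size pts = j.+1 -> all (fun t => `|t| <= h) pts ->
  pairwise (fun s t => d <= `|s - t|) pts ->
  {in pts, forall t, is_csum (fun k => a k * t%:C%C ^+ k) (g t) /\ nm (g t) <= e} ->
  nm (a j) <= (2 ^+ j.+2 - 2) * (A * q * h) + (2 / d) ^+ j * e.
Proof.
move=> + q0 Q0 qh Qh d0; elim: j a A B g e pts => [|j IH] a A B g e pts A0 e0 haQ ha sp ph pp hg.
  case: pts sp ph pp hg => [//|t [|//]] _ /= /andP[th _] _ /(_ t (mem_head _ _))[hs ge].
  have qt : q * nm t%:C%C <= 1 / 2.
    by rewrite nm_real; apply: le_trans qh; rewrite ler_wpM2l.
  have := @series_remainder _ a A q t%:C%C (g t) 1 q0 qt _ hs.
  rewrite big_ord1 expr0 mulr1 expr1 => /(_ _)/wrap[k k0|].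
    by have := ha k k0; rewrite subn0.
  have := ler_dist_nm (a 0%N) (g t); rewrite nmBC nm_real => i1 i2.
  have i3 : q * `|t| <= q * h by rewrite ler_wpM2l.
  have := ler_wpM2l A0 i3; move: i2; rewrite -[ord0 : nat]/0%N mul1r !expr2; lra.
case: pts sp ph pp hg => [//|s pts] [sp] /= /andP[sh ph] /andP[ps pp] hg.
have h0 : 0 <= h by apply: le_trans sh; exact: normr_ge0.
have [gss gse] := hg s (mem_head _ _).
have tin t : t \in pts -> t \in s :: pts by rewrite inE orbC => ->.
have ne t : t \in pts -> s != t.
  move=> /(allP ps) dt; apply/eqP => e'; move: dt; rewrite e' subrr normr0; lra.
have [t0 t0p] : exists t0, t0 \in pts.
  by case: pts sp {ph ps pp hg tin ne} => [//|t0 ?] _; exists t0; rewrite mem_head.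
have [b [hb bS bB _]] := quotient_series Q0 Qh haQ sh (allP ph _ t0p) (ne _ t0p) gss (hg _ (tin _ t0p)).1.
(* The coefficients produced for different [t] agree, since they are determined by sums at [s]
   alone. *)
have hq t : t \in pts ->
    is_csum (fun l => b l.+1 * t%:C%C ^+ l) ((g t - g s) / (t - s)%:C%C).
  move=> tp; have [b' [hb' _ _]] :=
    quotient_series Q0 Qh haQ sh (allP ph _ tp) (ne _ tp) gss (hg _ (tin _ tp)).1.
  congr is_csum; apply/funext => l; congr (_ * _); exact: is_csum_unique (hb' _) (hb _).
have qh0 : 0 <= q * h by rewrite mulr_ge0.
have btail l : (j.+1 < l)%N -> nm (b l) <= 2 * A * q ^+ (l - j.+1).
  move=> jl; have Aq : 0 <= A * q ^+ (l - j.+1) by rewrite mulr_ge0 ?exprn_ge0.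
  apply: (@le_trans _ _ (A * q ^+ (l - j.+1) / (1 - q * h))).
    apply: is_csum_le (hb l); apply: asum_le_geom => //; first lra.
    move=> p; rewrite nmM nmX nm_real.
    rewrite (_ : _ * _ ^+ p = A * q ^+ (l + p - j.+1) * h ^+ p); last first.
      by rewrite exprMn -addnBAC 1?ltnW// exprD; ring.
    apply: ler_pM; rewrite ?nm_ge0 ?exprn_ge0//.
      by apply: ha; rewrite ltn_addr.
    by rewrite lerXn2r// nnegrE.
  by rewrite ler_pdivrMr; nra.
have := IH (fun l => b l.+1) (2 * A) (2 * B * Q) (fun t => (g t - g s) / (t - s)%:C%C) (2 * e / d) pts.
move=> /(_ _ _ _ _ sp ph pp _)/wrap[||k|k jk|t tp|].
- by rewrite mulr_ge0.
- by rewrite divr_ge0 ?mulr_ge0// ltW.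
- by have := bB k.+1; rewrite exprS mulrA.
- by have := btail k.+1; rewrite subSS ltnS; apply.
- split; first exact: hq.
  have dt := allP ps _ tp; rewrite nmM nmV nm_real; apply: ler_pM.
  + exact: nm_ge0.
  + by rewrite invr_ge0.
  + apply: (le_trans (nmB _ _)); have := (hg _ (tin _ tp)).2; lra.
  + by rewrite lef_pV2 ?posrE 1?distrC// (lt_le_trans d0).
move=> bj; have bj2 := btail j.+2 (leqnn _).
rewrite subSn// subnn expr1 in bj2.
have -> : a j.+1 = b j.+1 - s%:C%C * b j.+2 by rewrite bS; ring.
apply: (le_trans (nmB _ _)); rewrite nmM nm_real.
have sb : `|s| * nm (b j.+2) <= h * (2 * A * q) by apply: ler_pM; rewrite ?nm_ge0.
apply: (le_trans (lerD bj sb)).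
rewrite [leRHS](_ : _ = (2 ^+ j.+2 - 2) * (2 * A * q * h) + (2 / d) ^+ j * (2 * e / d) +
  h * (2 * A * q)) ?lexx//.
by rewrite [2 ^+ j.+3]exprS [(2 / d) ^+ j.+1]exprS; field; rewrite gt_eqF.
Qed.

End DividedDifferences.

(** * Remez inequality on short intervals *)

Section LocalRemez.
Variable R : realType.
Variable n : nat.
Implicit Types (x y v : 'rV[R[i]]_n) (t d e ell : R) (f : 'rV[R[i]]_n -> R[i]).

Lemma exists_max_upto (F : nat -> R) N :
  exists j, (j <= N)%N /\ forall k, (k <= N)%N -> F k <= F j.
Proof.
elim: N => [|N [j [jN hj]]]; first by exists 0%N; split=> // k; rewrite leqn0 => /eqP ->.
have [le|lt] := leP (F N.+1) (F j).
  exists j; split; first exact: leqW.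
  by move=> k; rewrite leq_eqVlt ltnS => /orP[/eqP ->//|]; exact: hj.
exists N.+1; split=> // k; rewrite leq_eqVlt ltnS => /orP[/eqP ->//|/hj].
by move=> /le_trans; apply; exact: ltW.
Qed.

(** The two summands serve the two ranges in [dominant_coef]: 2^(N+1) outweighs 2^k for k <= N, and
    the term with [C] covers k > N. *)
Definition remez_const (N : nat) (C rho : R) : R :=
  2 ^+ N.+1 * (1 + C * N.+1%:R * rho^-1 ^+ N).

(** Take [j] maximising |a_k| ell^k among k <= N. For larger k the hypothesis compares |a_k| with
    the first coefficients, each at most [mu] ell^-N, and ell / rho <= 1 / 2 provides both the
    compensating ell^N and the geometric decay. *)
Lemma dominant_coef N (C rho ell : R) (a : nat -> R[i]) :
  0 < rho -> rho <= 1 -> 0 <= C -> 0 < ell -> ell <= rho / 2 ->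
  (forall k, nm (a k) * rho ^+ k <= C * \sum_(j < N.+1) nm (a j)) ->
  exists j, (j <= N)%N /\ forall k, nm (a k) * ell ^+ k <=
    remez_const N C rho * (nm (a j) * ell ^+ j) * (1 / 2) ^+ k.
Proof.
move=> r0 r1 C0 l0 lr ha.
have [j [jN hj]] := exists_max_upto (fun k => nm (a k) * ell ^+ k) N.
exists j; split=> // k; set mu := nm (a j) * ell ^+ j in hj *.
have mu0 : 0 <= mu by rewrite mulr_ge0 ?nm_ge0// exprn_ge0// ltW.
have rV : 0 <= rho^-1 ^+ N by rewrite exprn_ge0// invr_ge0 ltW.
have P0 : 0 <= C * N.+1%:R * rho^-1 ^+ N by rewrite !mulr_ge0.
have h0 (i : nat) : 0 <= (1 / 2) ^+ i :> R by rewrite exprn_ge0.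
have two i : 2 ^+ i * (1 / 2) ^+ i = 1 :> R by rewrite -exprMn mulrCA mulfV// mulr1 expr1n.
have [kN|Nk] := leqP k N.
  apply: (le_trans (hj k kN)).
  have : 1 <= remez_const N C rho * (1 / 2) ^+ k.
    have q1 : 1 <= 2 ^+ N.+1 * (1 / 2) ^+ k :> R.
      by rewrite -(subnK (leqW kN)) exprD -mulrA two mulr1 exprn_ege1// ler1n.
    by rewrite /remez_const mulrAC; nra.
  by move=> q2; rewrite -[leLHS]mul1r [leRHS]mulrAC ler_wpM2r.
have lV1 : 1 <= ell^-1 by rewrite invf_ge1//; lra.
have aj i : (i <= N)%N -> nm (a i) <= mu * ell^-1 ^+ N.
  move=> iN; have li : 0 < ell ^+ i by rewrite exprn_gt0.
  rewrite -(ler_pM2r li); apply: (le_trans (hj i iN)).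
  rewrite -mulrA ler_peMr// -(subnK iN) exprD -mulrA -exprMn mulVf ?gt_eqF//.
  by rewrite expr1n mulr1 exprn_ege1.
have sum_le : \sum_(i < N.+1) nm (a i) <= N.+1%:R * (mu * ell^-1 ^+ N).
  apply: (@le_trans _ _ (\sum_(i < N.+1) (mu * ell^-1 ^+ N))).
    by apply: ler_sum => i _; apply: aj; rewrite -ltnS.
  by rewrite sumr_const card_ord mulr_natl.
have rk : 0 < rho ^+ k by rewrite exprn_gt0.
have lk : 0 <= (ell / rho) ^+ k by rewrite exprn_ge0// divr_ge0 ?ltW.
have step : nm (a k) * ell ^+ k <= C * (N.+1%:R * (mu * ell^-1 ^+ N)) * (ell / rho) ^+ k.
  rewrite (_ : nm (a k) * ell ^+ k = nm (a k) * rho ^+ k * (ell / rho) ^+ k); last first.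
    by rewrite expr_div_n; field; rewrite expf_neq0// gt_eqF.
  by rewrite ler_wpM2r//; apply: (le_trans (ha k)); rewrite ler_wpM2l.
apply: (le_trans step).
have ratio : (ell / rho) ^+ k <= ell ^+ N * rho^-1 ^+ N * (2 ^+ N * (1 / 2) ^+ k).
  have kE (z : R) : z ^+ k = z ^+ N * z ^+ (k - N) by rewrite -exprD subnKC// ltnW.
  rewrite !kE [(ell / rho) ^+ N]exprMn [2 ^+ N * _]mulrA two [1 * (_ ^+ _)]mul1r; apply: ler_wpM2l.
    by rewrite mulr_ge0 ?exprn_ge0 ?invr_ge0// ltW.
  apply: lerXn2r; rewrite ?nnegrE ?divr_ge0 ?(ltW l0) ?(ltW r0)//.
  by rewrite ler_pdivrMr//; lra.
have Cm : 0 <= C * (N.+1%:R * (mu * ell^-1 ^+ N)).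
  do 3 (apply: mulr_ge0 => //); rewrite exprn_ge0//; lra.
apply: (le_trans (ler_wpM2l Cm ratio)).
have lN : ell^-1 ^+ N * ell ^+ N = 1 by rewrite -exprMn mulVf ?expr1n// gt_eqF.
rewrite (_ : _ * (_ * (2 ^+ N * _)) = 2 ^+ N * (C * N.+1%:R * rho^-1 ^+ N) * mu * (1 / 2) ^+ k *
  (ell^-1 ^+ N * ell ^+ N)); last by ring.
rewrite lN mulr1 ler_wpM2r// ler_wpM2r// /remez_const exprS.
have := exprn_ge0 N (ler0n R 2); nra.
Qed.

Lemma local_remez N (C rho : R) : 0 < rho -> rho <= 1 -> 0 <= C ->
  exists eta K, [/\ 0 < eta, eta <= 1, 0 <= K &
    forall f y v ell d e (pts : seq R), line_bound N.+1 C rho f y v ->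
      0 < ell -> ell <= rho / 2 -> 0 < d -> d <= ell -> 0 <= e ->
      size pts = N.+1 -> all (fun t => `|t| <= eta * ell) pts ->
      pairwise (fun s t => d <= `|s - t|) pts ->
      {in pts, forall t, nm (f (y + t%:C%C *: v)) <= e} ->
      forall t, `|t| <= ell ->
        nm (f (y + t%:C%C *: v)) <= K * (ell / d) ^+ N.+1 * e].
Proof.
move=> r0 r1 C0; pose D := remez_const N C rho.
have D1 : 1 <= D.
  have P0 : 0 <= C * N.+1%:R * rho^-1 ^+ N.
    by apply: mulr_ge0; [exact: mulr_ge0|rewrite exprn_ge0// invr_ge0 ltW].
  have : 1 <= 2 ^+ N.+1 :> R by rewrite exprn_ege1// ler1n.
  by rewrite /D /remez_const; nra.
(* With the points within ell / E of 0, the error of the divided difference is at most (2^(j+2) - 2)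
   |a_j| D / E <= |a_j| / 2 and can be absorbed on the left. *)
pose E : R := 2 ^+ N.+3 * D.
have two1 i : 1 <= 2 ^+ i :> R by rewrite exprn_ege1// ler1n.
have E4 : 4 <= E.
  have XD : 1 <= 2 ^+ N.+1 * D by rewrite mulr_ege1.
  by rewrite /E 2!exprS; lra.
exists E^-1, (2 * D * 2 * 2 ^+ N.+1); split.
- by rewrite invr_gt0; lra.
- by rewrite invf_le1; lra.
- by apply: mulr_ge0; [lra|exact: exprn_ge0].
move=> f y v ell d e pts [a [ha hs]] l0 lr d0 dl e0 sp pe pp hp t tl.
have [j [jN hj]] := dominant_coef r0 r1 C0 l0 lr ha; rewrite -/D in hj.
have el0 : 0 <= ell by exact: ltW.
have lj : 0 < ell ^+ j by rewrite exprn_gt0.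
set mu := nm (a j) * ell ^+ j in hj.
have mu0 : 0 <= mu by rewrite mulr_ge0 ?nm_ge0// ltW.
have D0 : 0 <= D by lra.
have ht s : `|s| <= ell -> is_csum (fun k => a k * s%:C%C ^+ k) (f (y + s%:C%C *: v)).
  by move=> sl; apply: hs; rewrite nm_real; lra.
have half : 0 <= 1 / 2 :> R /\ 1 / 2 < 1 :> R by split; lra.
have sup_le : nm (f (y + t%:C%C *: v)) <= 2 * D * mu.
  apply: (@le_trans _ _ (D * mu / (1 - 1 / 2))); last by rewrite ler_pdivrMr; lra.
  apply: is_csum_le (ht t tl); apply: asum_le_geom; [exact: half.1|exact: half.2|].
  move=> k; apply: le_trans (hj k); rewrite nmM nmX nm_real ler_wpM2l ?nm_ge0//.
  by rewrite lerXn2r// nnegrE.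
(* The dominant index [j] depends on the line; j + 1 of the N + 1 points suffice for its divided
   difference. *)
pose pts' := take j.+1 pts.
have sub : {subset pts' <= pts} by move=> s; exact: mem_take.
have mu_le : mu <= 2 * (2 * ell / d) ^+ j * e.
  pose A := D * nm (a j).
  have A0 : 0 <= A by rewrite mulr_ge0 ?nm_ge0//; lra.
  have V0 : 0 < E^-1 by rewrite invr_gt0; lra.
  have qh : ell^-1 * (E^-1 * ell) <= 1 / 2.
    rewrite mulrCA mulVf ?gt_eqF// mulr1 -[1 / 2]invrK lef_pV2 ?posrE; lra.
  have lV : 0 <= ell^-1 by rewrite invr_ge0.
  have bound k : nm (a k) <= D * mu * ell^-1 ^+ k.
    have lk : 0 < ell ^+ k by rewrite exprn_gt0.
    rewrite exprVn ler_pdivlMr//.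
    apply: (le_trans (hj k)); apply: ler_piMr; first exact: mulr_ge0.
    by case: half => h0 h1; apply: exprn_ile1 => //; exact: ltW.
  have := @divided_difference_bound R j a A (D * mu) ell^-1 ell^-1 (E^-1 * ell) d e
    (fun s => f (y + s%:C%C *: v)) pts' A0 lV lV qh qh d0 e0 bound.
  move=> /(_ _ _ _ _ _)/wrap[k jk||||s sp'|].
  - apply: (le_trans (bound k)).
    have -> : ell^-1 ^+ k = ell^-1 ^+ j * ell^-1 ^+ (k - j) by rewrite -exprD subnKC// ltnW.
    rewrite /mu /A [leLHS](_ : _ = D * nm (a j) * ell^-1 ^+ (k - j) *
      (ell ^+ j * ell^-1 ^+ j)); last by ring.
    by rewrite -exprMn mulfV ?gt_eqF// expr1n mulr1.
  - by rewrite size_takel// sp.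
  - by apply/allP => s /sub; exact: (allP pe).
  - by move: pp; rewrite -{1}(cat_take_drop j.+1 pts) pairwise_cat => /and3P[].
  - have sp2 := sub s sp'; split; last exact: hp.
    by apply: ht; apply: (le_trans (allP pe _ sp2)); rewrite ler_piMl// invf_le1; lra.
  move=> main.
  have two_j : (2 ^+ j.+2 - 2) * (A * ell^-1 * (E^-1 * ell)) <= nm (a j) / 2.
    rewrite (_ : A * _ * _ = nm (a j) * (D / E)); last first.
      by rewrite /A; field; rewrite !gt_eqF//; lra.
    rewrite (_ : D / E = (2 ^+ N.+3)^-1); last first.
      by rewrite /E; field; rewrite expf_neq0// gt_eqF//; lra.
    rewrite mulrCA ler_wpM2l ?nm_ge0// ler_pdivrMr ?exprn_gt0// [2 ^+ N.+3]exprS.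
    rewrite mulrA mulVf// mul1r.
    have : 2 ^+ j.+2 <= 2 ^+ N.+2 :> R by rewrite ler_weXn2l ?ler1n.
    by lra.
  have aj_le : nm (a j) <= 2 * ((2 / d) ^+ j * e) by lra.
  apply: (le_trans (ler_wpM2r (ltW lj) aj_le)); rewrite le_eqVlt; apply/orP; left; apply/eqP.
  by rewrite -[2 * ell]mulrC -[ell * 2 / d]mulrA [in RHS]exprMn; ring.
apply: (le_trans sup_le).
have ld1 : 1 <= 2 * ell / d by rewrite ler_pdivlMr//; lra.
have pw : (2 * ell / d) ^+ j <= (2 * ell / d) ^+ N.+1 by rewrite ler_weXn2l// leqW.
apply: (@le_trans _ _ (2 * D * (2 * (2 * ell / d) ^+ N.+1 * e))).
  rewrite ler_wpM2l//; first lra.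
  by apply: (le_trans mu_le); rewrite ler_wpM2r// ler_wpM2l.
rewrite le_eqVlt; apply/orP; left; apply/eqP.
by rewrite -[2 * ell / d]mulrA [in LHS]exprMn; ring.
Qed.

End LocalRemez.

(** * Outer length and separated points *)

Section OuterLength.
Variable R : realType.
Implicit Types (A W : set R) (a b c d h w : R).

(** [line_length] is convertible to this outer measure of the preimage. Monotonicity and
    subadditivity on all subsets allow sets to be cut by intervals without side conditions. *)
Definition outer_len : set R -> \bar R := (wlength (@idfun R))^*%mu.

Lemma outer_len_le A W : A `<=` W -> (outer_len A <= outer_len W)%E.
Proof. exact: (le_outer_measure (wlength (@idfun R))^*%mu). Qed.

Lemma outer_lenU A W : (outer_len (A `|` W) <= outer_len A + outer_len W)%E.
Proof. exact: (outer_measureU2 (wlength (@idfun R))^*%mu). Qed.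

Lemma outer_len0 : outer_len set0 = 0%E.
Proof. exact: (outer_measure0 (wlength (@idfun R))^*%mu). Qed.

Lemma outer_len_itv a b : a <= b -> outer_len `[a, b]%classic = (b - a)%:E.
Proof.
move=> ab; rewrite -[LHS]/(lebesgue_measure `[a, b]%classic) lebesgue_measure_itv/=.
by rewrite lte_fin; case: ltgtP ab => // -> _; rewrite subrr.
Qed.

Lemma outer_len_cover (s : seq R) W d : 0 <= d ->
  (forall x, W x -> exists2 t, t \in s & `|x - t| <= d) ->
  (outer_len W <= ((size s)%:R * (2 * d))%:E)%E.
Proof.
move=> d0; elim: s W => [|t s IH] W hW.
  suff -> : W = set0 by rewrite outer_len0 mul0r.
  by apply/seteqP; split=> // x /hW[].
pose W1 := W `&` `[t - d, t + d]; pose W2 := W `\` `[t - d, t + d].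
have -> : W = W1 `|` W2 by rewrite /W1 /W2 setUIDK.
apply: (le_trans (outer_lenU _ _)); rewrite /= -nat1r mulrDl mul1r EFinD.
apply: leeD.
  apply: (@le_trans _ _ (outer_len `[t - d, t + d]%classic)).
    by apply: outer_len_le; exact: subIsetr.
  by rewrite outer_len_itv ?lee_fin; lra.
apply: IH => x [Wx nx]; have [t' + xt'] := hW x Wx.
rewrite inE => /orP[/eqP e|]; last by exists t'.
case: nx; move: xt'; rewrite e /= in_itv/= ler_norml => /andP[? ?].
by apply/andP; split; lra.
Qed.

(** Greedy choice: if no further point were possible, intervals of length 2 d around the chosen
    points would cover [W]. *)
Lemma separated_points N W d : 0 < d -> ((N%:R * (2 * d))%:E < outer_len W)%E ->
  exists pts : seq R, [/\ size pts = N.+1, {in pts, forall t, W t} &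
    pairwise (fun s t => d <= `|s - t|) pts].
Proof.
move=> d0; elim: N => [|N IH] NW.
  have [t Wt] : exists t, W t.
    apply: contrapT => /forallNP nW; move: NW; rewrite mul0r.
    suff -> : W = set0 by rewrite outer_len0 ltxx.
    by apply/seteqP; split=> // x Wx; case: (nW x Wx).
  by exists [:: t]; split=> // s; rewrite inE => /eqP ->.
have [|pts [sp hp pp]] := IH.
  by apply: le_lt_trans NW; rewrite lee_fin ler_pM2r ?ler_nat// mulr_gt0.
have [t [Wt ht]] : exists t, W t /\ forall s, s \in pts -> d < `|t - s|.
  apply: contrapT => /forallNP no; move: NW; rewrite -sp ltNge => /negP; apply.
  apply: outer_len_cover; first exact: ltW.
  move=> x Wx; apply: contrapT => nx; apply: (no x); split=> // s sp'.
  by rewrite ltNge; apply/negP => xs; apply: nx; exists s.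
exists (t :: pts); split=> /=; first by rewrite sp.
  by move=> s; rewrite inE => /orP[/eqP ->//|/hp].
by rewrite pp andbT; apply/allP => s /ht/ltW.
Qed.

Lemma pigeonhole_itv P W a h w : 0 <= h -> W `<=` `[a, a + P.+1%:R * h] ->
  ((P.+1%:R * w)%:E <= outer_len W)%E ->
  exists b, (w%:E <= outer_len (W `&` `[b, (b + h)%R]))%E.
Proof.
move=> h0; elim: P W a => [|P IH] W a Wa hw.
  exists a; rewrite mul1r in hw; apply: (le_trans hw); apply: outer_len_le => x Wx.
  by split=> //; have := Wa x Wx; rewrite mul1r.
have [le|lt] := leP w%:E (outer_len (W `&` `[a, (a + h)%R])); first by exists a.
have [||b hb] := IH (W `\` `[a, a + h]) (a + h).
- move=> x [/Wa /= + nx]; rewrite !in_itv/= => /andP[ax xP].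
  rewrite -nat1r mulrDl mul1r in xP; apply/andP; split; last lra.
  rewrite leNgt; apply/negP => xh.
  by apply: nx; rewrite /= in_itv/= ax ltW.
- rewrite leNgt; apply/negP => lt2; move: hw; rewrite leNgt => /negP; apply.
  apply: le_lt_trans (_ : (outer_len (W `&` `[a, (a + h)%R]) +
      outer_len (W `\` `[a, (a + h)%R]) < _)%E).
    by apply: le_trans (outer_lenU _ _); rewrite setUIDK.
  by rewrite -nat1r mulrDl mul1r EFinD; exact: lteD.
exists b; apply: (le_trans hb); apply: outer_len_le => x [[Wx _] bx]; split=> //.
Qed.

End OuterLength.

(** * From short to long intervals *)

Section LineRemez.
Variable R : realType.
Variable n : nat.
Implicit Types (x v : 'rV[R[i]]_n) (A W : set R) (t ell w e : R).
Implicit Types (f : 'rV[R[i]]_n -> R[i]).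

(** The exponent [N] stays fixed while [K] may grow with [s]. Since [ell] and [w] are mere bounds on
    the diameter and the outer length, subintervals can be used without computing exact lengths. *)
Definition remez_upto f (N : nat) (s K : R) := forall x v A W ell w e,
  (forall j, nm (v 0 j) <= 1) -> (forall t, A t -> enorm (x + t%:C%C *: v) <= 1) ->
  is_interval A -> W `<=` A -> 0 < w -> (w%:E <= outer_len W)%E ->
  ell <= s -> (forall t t', A t -> A t' -> `|t - t'| <= ell) ->
  0 <= e -> (forall t, W t -> nm (f (x + t%:C%C *: v)) <= e) ->
  forall t, A t -> nm (f (x + t%:C%C *: v)) <= K * (ell / w) ^+ N * e.

Lemma outer_len_gt0_ex W w : 0 < w -> (w%:E <= outer_len W)%E -> exists t, W t.
Proof.
move=> w0 hw; apply: contrapT => /forallNP nW; move: hw.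
suff -> : W = set0 by rewrite outer_len0 lee_fin leNgt w0.
by apply/seteqP; split=> // x Wx; case: (nW x Wx).
Qed.

(** [local_remez] wants its points within eta ell of its centre. Among P + 1 segments of length eta
    ell covering [W], one carries at least w / (P + 1) of the length; the points are chosen there
    and one of them is the centre. *)
Lemma small_remez f N (C rho : R) : 0 < rho -> rho <= 1 -> 0 <= C ->
  (forall x v, enorm x <= 1 -> (forall j, nm (v 0 j) <= 1) ->
     line_bound N.+1 C rho f x v) ->
  exists2 K, 0 <= K & remez_upto f N.+1 (rho / 2) K.
Proof.
move=> r0 r1 C0 hf; have [eta [K [eta0 eta1 K0 hloc]]] := local_remez n N r0 r1 C0.
have [P hP] : exists P : nat, 2 / eta <= P.+1%:R.
  exists (Num.bound (2 / eta)); apply: ltW.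
  apply: (@lt_le_trans _ _ (Num.bound (2 / eta))%:R); last by rewrite ler_nat.
  by apply: archi_boundP; rewrite divr_ge0// ltW.
(* With d = w / Z, the N intervals of length 2 d in [separated_points] have total length below w /
   (P + 1). *)
pose Z : R := P.+1%:R * (4 * N.+1%:R).
exists (K * Z ^+ N.+1); first by rewrite mulr_ge0// exprn_ge0// !mulr_ge0.
move=> x v A W ell w e hv hA _ WA w0 hw elr diam e0 We t At.
have [c Wc] := outer_len_gt0_ex w0 hw.
have l0 : 0 <= ell by apply: le_trans (diam c c (WA c Wc) (WA c Wc)); exact: normr_ge0.
have Wc2 : W `<=` `[c - ell, c + ell].
  move=> y Wy; have := diam y c (WA y Wy) (WA c Wc).
  by rewrite /= in_itv/= ler_norml => /andP[? ?]; apply/andP; split; lra.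
have w2 : w <= 2 * ell.
  rewrite -lee_fin; apply: (le_trans hw); apply: le_trans (outer_len_le Wc2) _.
  by rewrite outer_len_itv ?lee_fin; lra.
have lp : 0 < ell by lra.
have P0 : 0 < P.+1%:R :> R by [].
have [|||b hb] := @pigeonhole_itv R P W (c - ell) (eta * ell) (w / P.+1%:R).
- by rewrite mulr_ge0// ltW.
- have h2 : 2 * ell <= P.+1%:R * (eta * ell) by rewrite mulrA ler_wpM2r// -ler_pdivrMr.
  by move=> y /Wc2; rewrite /= !in_itv/= => /andP[-> yc] /=; lra.
- by rewrite mulrC divfK ?gt_eqF.
pose d := w / Z.
have Z0 : 0 < Z by rewrite !mulr_gt0.
have d0 : 0 < d by rewrite divr_gt0.
have [|pts [sp hp pp]] := @separated_points R N _ d d0 (lt_le_trans _ hb).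
  rewrite lte_fin /d /Z.
  rewrite (_ : _ * (2 * _) = w / P.+1%:R * (N%:R / N.+1%:R / 2)); last first.
    by field; rewrite !gt_eqF.
  rewrite gtr_pMr ?divr_gt0// ltr_pdivrMr// ltr_pdivrMr//.
  have : N%:R <= N.+1%:R :> R by rewrite ler_nat.
  have : 0 < N.+1%:R :> R by [].
  by lra.
case: pts sp hp pp => [//|t0 pts] sp hp pp.
have hW s : s \in t0 :: pts -> W s by move=> /hp[].
have At0 : A t0 by apply/WA/hW/mem_head.
have shift s : x + t0%:C%C *: v + (s - t0)%:C%C *: v = x + s%:C%C *: v.
  rewrite -addrA -scalerDl -(rmorphD (real_complex R)).
  by congr (_ + _%:C%C *: _); ring.
rewrite -(shift t).
have dl : d <= ell.
  rewrite /d ler_pdivrMr//; apply: (le_trans w2); rewrite [leRHS]mulrC ler_wpM2r//.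
  have : 1 <= P.+1%:R :> R by rewrite ler1n.
  have : 1 <= N.+1%:R :> R by rewrite ler1n.
  by rewrite /Z; nra.
have := hloc f (x + t0%:C%C *: v) v ell d e [seq s - t0 | s <- t0 :: pts]
  (hf _ _ (hA _ At0) hv) lp elr d0 dl e0.
move=> /(_ _ _ _ _ (t - t0) (diam _ _ At At0))/wrap[||||].
- by rewrite size_map.
- rewrite all_map; apply/allP => s sp' /=.
  have [_] := hp s sp'; have [_] := hp t0 (mem_head _ _).
  rewrite /= !in_itv/= => /andP[? ?] /andP[? ?].
  by rewrite ler_norml; apply/andP; split; lra.
- rewrite pairwise_map; apply: sub_pairwise pp => s s' /=.
  by rewrite (_ : s - t0 - (s' - t0) = s - s'); last by ring.
- by move=> s /mapP[s' sp' ->]; rewrite shift; apply: We; exact: hW.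
move=> h; apply: (le_trans h); rewrite le_eqVlt; apply/orP; left; apply/eqP.
rewrite (_ : ell / d = Z * (ell / w)); last by rewrite /d; field; rewrite !gt_eqF.
by rewrite exprMn; ring.
Qed.

Lemma is_intervalI_itv A (p q : R) : is_interval A -> is_interval (A `&` `[p, q]).
Proof.
move=> iA s t [As] + [At]; rewrite /= !in_itv/= => /andP[ps sq] /andP[pt tq] u sut.
split; first exact: iA sut.
by move: sut => /andP[su ut]; rewrite in_itv/=; apply/andP; split; lra.
Qed.

(* One half of the interval carries half of the length of the set. The bound there
   passes to the middle half, which overlaps it, and from this to the other half. *)
Lemma remez_double f N (s K : R) : 0 <= K -> remez_upto f N s K ->
  exists2 K', 0 <= K' & remez_upto f N (2 * s) K'.
Proof.
(* Passing from a quarter of the interval to a half containing it has length ratio 2, hence the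
   factor K 2^N; the 1 makes [kap] at least 1, so that one bound serves both halves. *)
move=> K0 hs; pose kap := K * 2 ^+ N + 1.
have kap1 : 1 <= kap by rewrite lerDr mulr_ge0// exprn_ge0.
exists (kap ^+ 2 * K); first by rewrite mulr_ge0// exprn_ge0//; lra.
move=> x v A W ell w e hv hA iA WA w0 hw els diam e0 We.
have [c Wc] := outer_len_gt0_ex w0 hw; have Ac := WA c Wc.
have supA : has_sup A.
  split; [by exists c|exists (c + ell) => t At].
  by have := diam t c At Ac; rewrite ler_norml => /andP[_]; lra.
have infA : has_inf A.
  split; [by exists c|exists (c - ell) => t At].
  by have := diam t c At Ac; rewrite ler_norml => /andP[+ _]; lra.
pose a := inf A; pose b := sup A; pose L := b - a.
have Aab t : A t -> a <= t /\ t <= b.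
  by move=> At; split; [apply: ge_inf => //; case: infA|apply: ub_le_sup => //; case: supA].
have Lell : L <= ell.
  rewrite /L lerBlDr; apply: ge_sup; first by exists c.
  move=> t At; rewrite -lerBlDl; apply: lb_le_inf; first by exists c.
  by move=> t' At'; have := diam t t' At At'; rewrite ler_norml => /andP[_]; lra.
(* [A] need not contain its endpoints; interior points suffice for the quarter segments used in
   [spread], which avoid both ends. *)
have inA t : a < t -> t < b -> A t.
  move=> at_ tb; have e1 : 0 < t - a by lra.
  have e2 : 0 < b - t by lra.
  have [t1 At1 h1] := inf_adherent e1 infA; have [t2 At2 h2] := sup_adherent e2 supA.
  by apply: (iA t1 t2) => //; rewrite -/a -/b in h1 h2; apply/andP; split; lra.
have wL : w <= L.
  have WAab : W `<=` `[a, b].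
    by move=> t /WA /Aab[? ?]; rewrite /= in_itv/=; apply/andP.
  rewrite -lee_fin; apply: (le_trans hw); apply: le_trans (outer_len_le WAab) _.
  by rewrite outer_len_itv ?lee_fin//; have [? ?] := Aab c Ac; lra.
have Lp : 0 < L by lra.
have part p q (e' : R) W' w' ell' : q - p = L / 2 -> W' `<=` A `&` `[p, q] -> 0 < w' ->
    (w'%:E <= outer_len W')%E -> L / 2 <= ell' -> ell' <= s ->
    0 <= e' -> (forall t, W' t -> nm (f (x + t%:C%C *: v)) <= e') ->
    forall t, A t -> p <= t -> t <= q ->
      nm (f (x + t%:C%C *: v)) <= K * (ell' / w') ^+ N * e'.
  move=> pq W'A w'0 hw' ell'L ell's e'0 We' t At pt tq.
  apply: (hs x v (A `&` `[p, q]) W') => //.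
  - by move=> t' [/hA].
  - exact: is_intervalI_itv.
  - move=> t1 t2 [_ +] [_ +]; rewrite /= !in_itv/= => /andP[? ?] /andP[? ?].
    by rewrite ler_norml; apply/andP; split; lra.
  - by split=> //; rewrite /= in_itv/= pt.
have spread p q u (e' : R) : q - p = L / 2 -> a < u -> u + L / 4 < b -> p <= u ->
    u + L / 4 <= q -> 0 <= e' ->
    (forall t, A t -> u <= t -> t <= u + L / 4 -> nm (f (x + t%:C%C *: v)) <= e') ->
    forall t, A t -> p <= t -> t <= q -> nm (f (x + t%:C%C *: v)) <= kap * e'.
  move=> pq au ub pu uq e'0 hu t At pt tq.
  have uA t' : `[u, u + L / 4]%classic t' -> A t'.
    by rewrite /= in_itv/= => /andP[? ?]; apply: inA; lra.
  have := @part p q e' `[u, u + L / 4]%classic (L / 4) (L / 2) pq _ _ _ _ _ e'0 _ t At pt tq.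
  move=> /(_ _ _ _ _ _ _)/wrap[t' ut'||||| t' ut'|].
  - split; first exact: uA.
    by move: ut'; rewrite /= !in_itv/= => /andP[? ?]; apply/andP; split; lra.
  - lra.
  - by rewrite outer_len_itv ?lee_fin; lra.
  - exact: lexx.
  - lra.
  - by apply: hu; [exact: uA| |]; move: ut'; rewrite /= in_itv/= => /andP[].
  rewrite (_ : L / 2 / (L / 4) = 2); last by field; rewrite gt_eqF.
  move=> /le_trans; apply; rewrite ler_wpM2r// /kap; lra.
pose mid := a + L / 2; pose E := K * (ell / w) ^+ N * e.
have lw : 0 <= ell / w by rewrite divr_ge0//; lra.
have E0 : 0 <= E by rewrite !mulr_ge0// exprn_ge0.
have k0 : 0 <= kap by lra.
have E1 : E <= kap ^+ 2 * E by rewrite ler_peMl// exprn_ege1.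
have E2 : kap * E <= kap ^+ 2 * E by rewrite ler_wpM2r// ler_eXnr.
have E3 : kap * (kap * E) = kap ^+ 2 * E by rewrite mulrA -expr2.
have kE0 : 0 <= kap * E by rewrite mulr_ge0.
have ew : ell / 2 / (w / 2) = ell / w by field; rewrite gt_eqF.
have [be mb mE] : [/\ b = a + L, b = mid + L / 2 & mid = a + L / 2].
  by rewrite /mid /L; split; field.
have w20 : 0 < w / 2 by lra.
move=> t At; rewrite -[kap ^+ 2 * K * _]mulrA -[kap ^+ 2 * _ * e]mulrA -/E.
have [ta tb] := Aab t At; clearbody mid L a b.
have [le|lt] := leP (w / 2)%:E (outer_len (W `&` `[a, mid])).
  have F1 t' : A t' -> a <= t' -> t' <= mid -> nm (f (x + t'%:C%C *: v)) <= E.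
    have := @part a mid e (W `&` `[a, mid]) (w / 2) (ell / 2); rewrite ew; apply=> //.
    - by rewrite mE; ring.
    - by move=> y [/WA].
    - by lra.
    - by lra.
    - by move=> y [/We].
  have F2 : forall t', A t' -> a + L / 4 <= t' -> t' <= mid + L / 4 ->
      nm (f (x + t'%:C%C *: v)) <= kap * E.
    apply: (@spread (a + L / 4) (mid + L / 4) (a + L / 4)) => //; try by clear - Lp be mb mE; lra.
    by move=> t' At' t1 t2; apply: F1 => //; clear - Lp be mb mE t1 t2; lra.
  have F3 : forall t', A t' -> mid <= t' -> t' <= b ->
      nm (f (x + t'%:C%C *: v)) <= kap * (kap * E).
    apply: (@spread mid b mid) => //; try by clear - Lp be mb mE; lra.
    by move=> t' At' t1 t2; apply: F2 => //; clear - Lp be mb mE t1 t2; lra.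
  case/orP: (le_total t mid) => tm; first by apply: le_trans E1; exact: F1.
  by rewrite -E3; exact: F3.
have le2 : ((w / 2)%:E <= outer_len (W `&` `[mid, b]))%E.
  rewrite leNgt; apply/negP => lt2; move: hw; rewrite leNgt => /negP; apply.
  rewrite [w in w%:E](_ : w = w / 2 + w / 2); last by field.
  rewrite EFinD; apply: le_lt_trans (lteD lt lt2).
  apply: le_trans (outer_lenU _ _); apply: outer_len_le => y Wy.
  have [ya yb] := Aab y (WA y Wy); case/orP: (le_total y mid) => ym; [left|right];
    by split=> //; rewrite /= in_itv/=; apply/andP.
have F1 t' : A t' -> mid <= t' -> t' <= b -> nm (f (x + t'%:C%C *: v)) <= E.
  have := @part mid b e (W `&` `[mid, b]) (w / 2) (ell / 2); rewrite ew; apply=> //.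
  - by rewrite mb; ring.
  - by move=> y [/WA].
  - by lra.
  - by lra.
  - by move=> y [/We].
have F2 : forall t', A t' -> a + L / 4 <= t' -> t' <= mid + L / 4 ->
    nm (f (x + t'%:C%C *: v)) <= kap * E.
  apply: (@spread (a + L / 4) (mid + L / 4) mid) => //; try by clear - Lp be mb mE; lra.
  by move=> t' At' t1 t2; apply: F1 => //; clear - Lp be mb mE t1 t2; lra.
have F3 : forall t', A t' -> a <= t' -> t' <= mid ->
    nm (f (x + t'%:C%C *: v)) <= kap * (kap * E).
  apply: (@spread a mid (a + L / 4)) => //; try by clear - Lp be mb mE; lra.
  by move=> t' At' t1 t2; apply: F2 => //; clear - Lp be mb mE t1 t2; lra.
case/orP: (le_total t mid) => tm; first by rewrite -E3; exact: F3.
by apply: le_trans E1; exact: F1.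
Qed.

Lemma remez_all f N (s K S : R) : 0 < s -> 0 <= K -> remez_upto f N s K ->
  exists2 K', 0 <= K' & remez_upto f N S K'.
Proof.
move=> s0 K0 hs.
have [k hk] : exists k : nat, S <= 2 ^+ k * s.
  exists (Num.bound `|S / s|); rewrite -ler_pdivrMr//; apply: le_trans (ler_norm _) _.
  apply: ltW; apply: (lt_trans (archi_boundP (normr_ge0 _))).
  by rewrite -natrX ltr_nat; exact: ltn_expl.
have [K' K'0 hK'] : exists2 K', 0 <= K' & remez_upto f N (2 ^+ k * s) K'.
  elim: k {hk} => [|k [K' K'0 hK']]; first by exists K => //; rewrite expr0 mul1r.
  by rewrite exprS -mulrA; exact: remez_double hK'.
exists K' => // x v A W ell w e hv hA iA WA w0 hw elS.
by apply: hK' => //; apply: le_trans hk.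
Qed.

End LineRemez.

(** Each coordinate changes by at most 2, and the l^1 norm of [v] is at least its Euclidean norm 1.
    The bound 2n is crude, but any bound independent of the line will do. *)
Lemma line_diam_le (R : realType) (n : nat) (x v : 'rV[R[i]]_n) (t t' : R) :
  enorm v = 1 -> enorm (x + t%:C%C *: v) <= 1 -> enorm (x + t'%:C%C *: v) <= 1 ->
  `|t - t'| <= 2 * n%:R.
Proof.
move=> v1 ht ht'.
have s1 : 1 <= \sum_j nm (v 0 j).
  have := enormD_le 0 v; rewrite add0r v1; suff -> : enorm (0 : 'rV[R[i]]_n) = 0 by rewrite add0r.
  by rewrite /enorm big1 ?sqrtr0// => j _; rewrite mxE nm0 expr0n.
apply: (@le_trans _ _ (\sum_j `|t - t'| * nm (v 0 j))).
  by rewrite -mulr_sumr ler_peMr.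
apply: (@le_trans _ _ (\sum_(j < n) 2)); last by rewrite sumr_const card_ord mulr_natr.
apply: ler_sum => j _; rewrite -nm_real -nmM.
have h1 := le_trans (nm_le_enorm _ j) ht; have h2 := le_trans (nm_le_enorm _ j) ht'.
rewrite (_ : _ * _ = (x + t%:C%C *: v) 0 j - (x + t'%:C%C *: v) 0 j); last first.
  by rewrite !mxE (rmorphB (real_complex R)) mulrBl opprD addrACA subrr add0r.
by apply: (le_trans (nmB _ _)); rewrite mulr2n; exact: lerD.
Qed.

Lemma powR_absorb (R : realType) (N M : nat) (K Z : R) : K <= 4 ^+ M -> 1 <= Z ->
  K * Z ^+ N <= (4 * Z) `^ (N + M)%:R.
Proof.
move=> KM Z1; rewrite powR_mulrn; last by lra.
rewrite exprD [leLHS]mulrC; apply: le_trans (_ : Z ^+ N * 4 ^+ M <= _).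
  by rewrite ler_wpM2l// exprn_ge0//; lra.
by apply: ler_pM; rewrite ?exprn_ge0 ?lerXn2r ?nnegrE//; lra.
Qed.

Theorem theorem1p1 (R : realType) (n : nat) (hn : (1 <= n)%N) (r : R)
    (hr : 1 < r) (f : 'rV[R[i]]_n -> R[i])
    (hf : holomorphic_on (cball 0 r) f) :
  exists2 d : R, 0 < d &
    forall (x v : 'rV[R[i]]_n) (I omega : set 'rV[R[i]]_n),
      cball 0 1 x -> enorm v = 1 ->
      I `<=` line x v `&` cball 0 1 -> line_interval x v I ->
      omega `<=` I -> line_measurable x v omega ->
      (0 < line_length x v omega)%E ->
      (sup_modulus f I <=
       ((4 * fine (line_length x v I) / fine (line_length x v omega))
          `^ d)%:E * sup_modulus f omega)%E.
Proof.
have df x : enorm x < r -> differentiable f x by move=> xr; apply: hf; rewrite /cball /= subr0.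
have [N [C [rho [rho0 rho1 C0 bound]]]] := uniform_line_bound hr df.
(* One more coefficient guarantees a nonempty range for the maximum in [dominant_coef]. *)
have bound' (x v : 'rV[R[i]]_n) : enorm x <= 1 -> (forall j, nm (v 0 j) <= 1) -> line_bound N.+1 C rho f x v.
  by move=> x1 v1; apply: line_boundW (bound x v x1 v1) => //; exact: ltW.
have [K0 K00 small] := small_remez rho0 rho1 C0 bound'.
(* All of the interval lies within 2n of one of its points, so its length is at most 4n. *)
have [K K_ge0 remez] := remez_all (2 * (2 * n%:R)) (divr_gt0 rho0 (ltr0Sn R 1)) K00 small.
have [M KM] : exists M : nat, K <= 4 ^+ M.
  exists (Num.bound K); apply: ltW; apply: (lt_trans (archi_boundP K_ge0)).
  by rewrite -natrX ltr_nat; exact: ltn_expl.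
exists (N.+1 + M)%:R => [|x v I omega _ v1 hI iI oI _ o_gt0]; first by rewrite ltr0n.
pose A := line_param x v @^-1` I; pose W := line_param x v @^-1` omega.
have WA : W `<=` A by move=> t; exact: oI.
have hA t : A t -> enorm (x + t%:C%C *: v) <= 1.
  by move=> /hI[_]; rewrite /cball /= subr0 => /ltW.
have diam t t' : A t -> A t' -> `|t - t'| <= 2 * n%:R.
  by move=> /hA At /hA; exact: line_diam_le.
have [c Wc] : exists t, W t.
  apply: contrapT => /forallNP nW; move: o_gt0; rewrite ltNge => /negP; apply.
  rewrite -[line_length _ _ _]/(outer_len W).
  suff -> : W = set0 by rewrite outer_len0.
  by apply/seteqP; split=> // t Wt; case: (nW t Wt).
have Ac := WA c Wc.
have n0 : 0 <= n%:R :> R by [].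
have A_itv : A `<=` `[c - 2 * n%:R, c + 2 * n%:R].
  move=> t At; have := diam t c At Ac.
  by rewrite /= in_itv/= ler_norml => /andP[? ?]; apply/andP; split; lra.
have fin_len B : B `<=` A -> outer_len B \is a fin_num.
  move=> BA; rewrite ge0_fin_numE; last exact: outer_measure_ge0.
  apply: le_lt_trans (outer_len_le (subset_trans BA A_itv)) _.
  by rewrite outer_len_itv ?ltry//; lra.
pose w := fine (outer_len W); pose ell := fine (outer_len A).
have wE : w%:E = outer_len W by rewrite fineK// fin_len.
have lE : ell%:E = outer_len A by rewrite fineK// fin_len.
have w0 : 0 < w by rewrite -lte_fin wE.
have wl : w <= ell by rewrite -lee_fin wE lE; exact: outer_len_le.
(* The segment between two points of an interval lies in it, so the diameter is at most the
   length. *)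
have ltdiam t t' : A t -> A t' -> t <= t' -> t' - t <= ell.
  move=> At At' tt'; rewrite -lee_fin lE -outer_len_itv//; apply: outer_len_le => u.
  by rewrite /= in_itv/=; exact: iI.
have diam_ell t t' : A t -> A t' -> `|t - t'| <= ell.
  move=> At At'; have [tt'|/ltW tt'] := leP t t'.
    by rewrite distrC ger0_norm ?subr_ge0// ltdiam.
  by rewrite ger0_norm ?subr_ge0// ltdiam.
have ell_le : ell <= 2 * (2 * n%:R).
  rewrite -lee_fin lE; apply: le_trans (outer_len_le A_itv) _.
  by rewrite outer_len_itv ?lee_fin; lra.
rewrite -[fine (line_length _ _ I)]/ell -[fine _]/w -mulrA.
set P := (4 * (ell / w)) `^ _.
have P0 : 0 < P by rewrite powR_gt0// mulr_gt0// divr_gt0//; lra.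
have omega_le t : W t -> ((nm (f (x + t%:C%C *: v)))%:E <= sup_modulus f omega)%E.
  by move=> Wt; apply: ereal_sup_ubound; exists (x + t%:C%C *: v).
(* An infinite supremum makes the right-hand side infinite, as the factor is positive; -oo is
   excluded because omega is nonempty. *)
case S : (sup_modulus f omega) => [e| |]; last first.
- by have := omega_le c Wc; rewrite S.
- by rewrite gt0_muley ?lte_fin// leey.
have e0 : 0 <= e.
  by have := omega_le c Wc; rewrite S lee_fin; apply: le_trans; exact: nm_ge0.
rewrite -EFinM; apply: ge_ereal_sup => _ [z Iz <-]; rewrite lee_fin.
have [[t _ tz] _] := hI z Iz.
have At : A t by rewrite /A /= tz.
rewrite -tz; apply: le_trans (remez x v A W ell w e _ hA iI WA w0 _ _ diam_ell e0 _ t At) _.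
- by move=> j; rewrite -v1; exact: nm_le_enorm.
- by rewrite wE.
- exact: ell_le.
- by move=> s /omega_le; rewrite S lee_fin.
rewrite ler_wpM2r// /P; apply: powR_absorb => //.
by rewrite ler_pdivlMr// mul1r.
Qed.
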